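(* Let $(\mathcal{A},\phi,B)$ be an operator-valued probability space and let $a,b\in\mathcal{A}$ be two random variables which are free over $B$ and satisfy $\phi(a)=\phi(b)=1_B$. Let $K_a,K_b,K_{ab},V_{a,b}\in\mathrm{Mult}[[B]]$ be the multilinear function series defined in the context. Then $$V_{a,b}=K_a\times\big[(K_b\times[I\cdot V_{a,b}])\cdot I\big],$$ and the cumulant series $K_{ab}$ is given by $$K_{ab}=V_{a,b}\cdot\big(K_b\times[I\cdot V_{a,b}]\big).$$
   Context: Operator-valued probability space (algebraic setting, no topology): $\mathcal{A}$ and $B$ are unital involutive complex algebras, $\mathcal{A}$ is a $B$-$B$-bimodule (actions compatible with the product of $\mathcal{A}$ and with $(c\cdot x)^\star=x^\star\cdot c^\star$), and $\phi:\mathcal{A}\to B$ is a positive $B$-$B$-bimodule map. Operator-valued free cumulants: the multilinear maps $\kappa_n:\mathcal{A}^n\to B$ ($n\ge1$) determined by $\phi(x_1\cdots x_N)=\sum_{\sigma\in\mathrm{NC}(N)}\kappa_\sigma(x_1,\dots,x_N)$ for all $N\ge 1$, where $\mathrm{NC}(N)$ is the set of non-crossing partitions of $\{1,\dots,N\}$ and $\kappa_\sigma$ is the nested partitioned cumulant: if $\sigma$ has a single block, $\kappa_\sigma=\kappa_N$; otherwise, for a block $\{r+1,\dots,r+s\}$ of $\sigma$ that is an interval, $\kappa_\sigma(x_1,\dots,x_N)=\kappa_{\sigma'}(x_1,\dots,x_r\cdot\kappa_s(x_{r+1},\dots,x_{r+s}),x_{r+s+1},\dots,x_N)$ (if $r=0$,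 the element of $B$ multiplies $x_{s+1}$ from the left), $\sigma'$ being $\sigma$ with that block removed (and relabelled). Freeness of $a$ and $b$ over $B$ is Voiculescu's freeness with amalgamation; equivalently, mixed $B$-valued free cumulants in $a$ and $b$ (with coefficients from $B$) vanish. Multilinear function series: $\mathrm{Mult}[[B]]$ is the set of sequences $\alpha=(\alpha_n)_{n\ge0}$ with $\alpha_0\in B$ and $\alpha_n:B^{\otimes n}\to B$ linear. $1=(1_B,0,0,\dots)$ and $I=(0,\mathrm{id}_B,0,\dots)$. Concatenation: $(\alpha\cdot\beta)_n(c_1,\dots,c_n)=\sum_{k=0}^n\alpha_k(c_1,\dots,c_k)\beta_{n-k}(c_{k+1},\dots,c_n)$. Composition, for $\beta_0=0$: $(\alpha\times\beta)_0=\alpha_0$ and, for $n\geq 1$, $(\alpha\times\beta)_n(c_1,\dots,c_n)=\sum_{k=1}^n\sum_{p_1+\cdots+p_k=n,\,p_i\ge1}\alpha_k\big(\beta_{p_1}(c_1,\dots,c_{p_1}),\dots,\beta_{p_k}(c_{q_k+1},\dots,c_{q_k+p_k})\big)$ with $q_j=p_1+\cdots+p_{j-1}$. Cumulant series: for $x\in\{a,b,ab\}$, $K_x$ has constant term $1_B$ and, for $n\ge1$, $(K_x)_n(c_1,\dots,c_n)=\kappa_{n+1}(xc_1,xc_2,\dots,xc_n,x)$, $c_i\in B$. For $\pi\in\mathrm{NC}(n)$, $\mathrm{Kr}(\pi)$ is the Kreweras complement: the maximal (for refinement) partition in $\mathrm{NC}(n)$ such that $\pi\cup\mathrm{Kr}(\pi)\in\mathrm{NC}(2n)$,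 where $\pi\cup\mathrm{Kr}(\pi)$ denotes the partition of $\{1,\dots,2n\}$ that restricts to $\pi$ on odd integers and to $\mathrm{Kr}(\pi)$ on even integers (each relabelled increasingly). $\mathrm{NC}_{\mathrm{irr}}(n)$ is the set of irreducible non-crossing partitions, i.e. those with $1$ and $n$ in the same block. The series $V_{a,b}$ has constant term $1_B$ and, for $n\ge1$, $$(V_{a,b})_n(c_1,\dots,c_n)=\sum_{\pi\in\mathrm{NC}_{\mathrm{irr}}(n+1)}\kappa_{\pi\cup\mathrm{Kr}(\pi)}(a,\,bc_1,\,a,\,bc_2,\,\dots,\,a,\,bc_n,\,a,\,b).$$ *)

(* Defs.v *)
From HB Require Import structures.
From mathcomp Require Import all_boot all_order all_algebra.
From mathcomp Require Import reals complex zify.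

Set Implicit Arguments.
Unset Strict Implicit.
Unset Printing Implicit Defensive.

Import Order.TTheory GRing.Theory Num.Theory.
Local Open Scope ring_scope.

(* A sequence of maps f_n : U^n -> V (n >= 0) is encoded by a single function *)
(* on lists, f_n being its restriction to the lists of size n.                *)
Definition multilinear (K : pzRingType) (U V : lmodType K)
    (f : seq U -> V) : Prop :=
  forall (l : K) (x y : U) (u v : seq U),
    f (u ++ (l *: x + y) :: v) = l *: f (u ++ x :: v) + f (u ++ y :: v).

(* The integers 1, ..., n are the ordinals 0, ..., n.-1. *)
Definition noncrossing n (P : {set {set 'I_n}}) : bool :=
  [forall V in P, forall W in P, (V != W) ==>
    ~~ [exists i in V, exists j in W, exists k in V, exists l in W,
          [&& i < j, j < k & k < l]%N]].

Definition NC n : {set {set {set 'I_n}}} :=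
  [set P | partition P [set: 'I_n] && noncrossing P].

(* Indexed so that NCirr n is NC_irr(n + 1), which makes ord0 and ord_max     *)
(* available.                                                                 *)
Definition NCirr n : {set {set {set 'I_n.+1}}} :=
  [set P in NC n.+1 | pblock P ord0 == pblock P ord_max].

Definition refines n (P Q : {set {set 'I_n}}) : bool :=
  [forall V in P, exists W in Q, V \subset W].

Lemma evn_proof n (i : 'I_n) : (i.*2 < n.*2)%N.
Proof. by rewrite ltn_double. Qed.

Lemma odn_proof n (i : 'I_n) : (i.*2.+1 < n.*2)%N.
Proof. by rewrite ltn_Sdouble. Qed.

Definition evn n (i : 'I_n) : 'I_n.*2 := Ordinal (evn_proof i).
Definition odn n (i : 'I_n) : 'I_n.*2 := Ordinal (odn_proof i).

(* The partition "P u Q" of {1, ..., 2n}; the odd integers 1, 3, ..., 2n - 1  *)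
(* are the even ordinals.                                                     *)
Definition interleave n (P Q : {set {set 'I_n}}) : {set {set 'I_n.*2}} :=
  [set [set evn i | i in V] | V : {set 'I_n} in P]
  :|: [set [set odn i | i in V] | V : {set 'I_n} in Q].

Definition Kr_candidates n (P : {set {set 'I_n}}) : {set {set {set 'I_n}}} :=
  [set Q in NC n | interleave P Q \in NC n.*2].

(* The default value set0 is never used: Kr_candidates P has a greatest       *)
(* element for the refinement order when P is in NC n.                        *)
Definition Kr n (P : {set {set 'I_n}}) : {set {set 'I_n}} :=
  odflt set0 [pick Q in Kr_candidates P |
    [forall Q' in Kr_candidates P, refines Q' Q]].

Record involution (C : numClosedFieldType) (A : algType C) := Involution {
  star :> A -> A;
  starK : involutive star;
  starD : {morph star : x y / x + y};
  starZ : forall (l : C) x, star (l *: x) = l^* *: star x;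
  starM : forall x y, star (x * y) = star y * star x
}.

(* Without a topology, the positive elements are the finite sums of elements  *)
(* of the form z^* z.                                                         *)
Definition star_positive (C : numClosedFieldType) (A : algType C)
    (st : involution A) (x : A) : Prop :=
  exists s : seq A, x = \sum_(z <- s) st z * z.

Record opv_space (C : numClosedFieldType) (B A : algType C) := OpvSpace {
  starA : involution A;
  starB : involution B;
  lact : B -> A -> A;
  ract : A -> B -> A;
  lactDl : forall c d x, lact (c + d) x = lact c x + lact d x;
  lactDr : forall c x y, lact c (x + y) = lact c x + lact c y;
  lactZl : forall (l : C) c x, lact (l *: c) x = l *: lact c x;
  lactZr : forall (l : C) c x, lact c (l *: x) = l *: lact c x;
  lact1 : forall x, lact 1 x = x;
  lactA : forall c d x, lact (c * d) x = lact c (lact d x);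
  ractDl : forall x y c, ract (x + y) c = ract x c + ract y c;
  ractDr : forall x c d, ract x (c + d) = ract x c + ract x d;
  ractZl : forall (l : C) x c, ract (l *: x) c = l *: ract x c;
  ractZr : forall (l : C) x c, ract x (l *: c) = l *: ract x c;
  ract1 : forall x, ract x 1 = x;
  ractA : forall x c d, ract x (c * d) = ract (ract x c) d;
  lractA : forall c x d, ract (lact c x) d = lact c (ract x d);
  lact_mul : forall c x y, lact c (x * y) = lact c x * y;
  ract_mul : forall x y c, ract (x * y) c = x * ract y c;
  mul_ract_lact : forall x c y, ract x c * y = x * lact c y;
  star_lact : forall c x, starA (lact c x) = ract (starA x) (starB c);
  phi : {linear A -> B};
  phi_bimod : forall c x d, phi (ract (lact c x) d) = c * phi x * d;
  phi_pos : forall x, star_positive starA x -> star_positive starB (phi x)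
}.

Section Cumulants.
Variables (C : numClosedFieldType) (B A : algType C) (S : opv_space B A).

(* Puts c between the words u and v: on the right of the last letter of u or, *)
(* if u is empty, on the left of the first letter of v.                       *)
Definition absorb (c : B) (u v : seq A) : seq A :=
  if u is y :: u' then rcons (belast y u') (ract S (last y u') c) ++ v
  else if v is z :: v' then lact S c z :: v' else [::].

(* With l_i the block containing i, the block starting at position r is an    *)
(* interval.                                                                  *)
Definition interval_at (L : eqType) (l : seq L) (r : nat) : bool :=
  if drop r l is V :: _ then prefix (nseq (count_mem V l) V) (drop r l)
  else false.

(* A partition is passed as the list l of the blocks of the successive        *)
(* letters of x, so that removing an interval block, together with the        *)
(* relabelling of what remains, is deletion of a factor of l. The block which *)
(* is removed is the leftmost interval block. The first argument is a bound   *)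
(* on the number of steps.                                                    *)
Fixpoint nested (T : finType) (kappa : seq A -> B) (m : nat)
    (l : seq {set T}) (x : seq A) : B :=
  if m is m'.+1 then
    if constant l then kappa x else
    let r := find (interval_at l) (iota 0 (size l)) in
    let s := count_mem (nth set0 l r) l in
    nested kappa m' (take r l ++ drop (r + s) l)
      (absorb (kappa (take s (drop r x))) (take r x) (drop (r + s) x))
  else 0.

Definition kappa_part (kappa : seq A -> B) n (P : {set {set 'I_n}})
    (x : seq A) : B :=
  nested kappa n [seq pblock P i | i <- enum 'I_n] x.

(* kappa restricted to lists of size n >= 1 is kappa_n; the value on [::] is  *)
(* irrelevant.                                                                *)
Record is_free_cumulants (kappa : seq A -> B) : Prop := IsFreeCumulants {
  cumulants_multilinear : multilinear kappa;
  moment_cumulant : forall x : seq A, x != [::] ->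
    phi S (\prod_(y <- x) y) = \sum_(P in NC (size x)) kappa_part kappa P x
}.

(* The algebra generated by x and the image of B in A. *)
Inductive alg_gen (x : A) : A -> Prop :=
| AlgGenVar : alg_gen x x
| AlgGenCst c : alg_gen x (lact S c 1)
| AlgGenAdd y z : alg_gen x y -> alg_gen x z -> alg_gen x (y + z)
| AlgGenMul y z : alg_gen x y -> alg_gen x z -> alg_gen x (y * z).

(* In a pair p, the letter p.2 is taken in the algebra generated by a if p.1  *)
(* is true and by b otherwise.                                                *)
Definition free_with_amalgamation (a b : A) : Prop :=
  forall s : seq (bool * A), s != [::] ->
    sorted (fun p q => p.1 != q.1) s ->
    (forall p, p \in s ->
       alg_gen (if p.1 then a else b) p.2 /\ phi S p.2 = 0) ->
    phi S (\prod_(p <- s) p.2) = 0.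

(* In a triple (t, c, d), the letter is c a d if t is true and c b d          *)
(* otherwise.                                                                 *)
Definition mixed_cumulants_vanish (kappa : seq A -> B) (a b : A) : Prop :=
  forall s : seq (bool * B * B),
    ~~ constant [seq p.1.1 | p <- s] ->
    kappa [seq ract S (lact S p.1.2 (if p.1.1 then a else b)) p.2
          | p <- s] = 0.

(* Voiculescu's condition has its usual meaning only if phi restricts to the  *)
(* identity on B, i.e. phi 1 = 1, and is then equivalent to the vanishing of  *)
(* mixed cumulants. The latter makes sense for every bimodule map phi.        *)
Definition free_over (kappa : seq A -> B) (a b : A) : Prop :=
  phi S 1 = 1 /\ free_with_amalgamation a b
  \/ mixed_cumulants_vanish kappa a b.

End Cumulants.

Section Series.
Variables (C : numClosedFieldType) (B : algType C).

(* A series alpha is encoded as above by a function on lists: the constant    *)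
(* term alpha_0 is alpha [::].                                                *)
Definition series_I (s : seq B) : B := if s is [:: c] then c else 0.

Definition series_cat (alpha beta : seq B -> B) (s : seq B) : B :=
  \sum_(0 <= k < (size s).+1) alpha (take k s) * beta (drop k s).

(* Meant for beta [::] = 0. *)
Definition series_comp (alpha beta : seq B -> B) (s : seq B) : B :=
  if s is [::] then alpha [::] else
  \sum_(1 <= k < (size s).+1)
    \sum_(p : k.-tuple 'I_(size s).+1 |
           all (ltn 0) [seq val i | i <- p]
           && (sumn [seq val i | i <- p] == size s))
      alpha [seq beta q | q <- reshape [seq val i | i <- p] s].

Variables (A : algType C) (S : opv_space B A) (kappa : seq A -> B).

Definition cumulant_series (x : A) (s : seq B) : B :=
  if s is [::] then 1 else kappa (rcons [seq ract S x c | c <- s] x).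

Definition V_series (a b : A) (s : seq B) : B :=
  if s is [::] then 1 else
  \sum_(P in NCirr (size s))
    kappa_part S kappa (interleave P (Kr P))
      (flatten [seq [:: a; ract S b c] | c <- s] ++ [:: a; b]).

End Series.

Section Existence.
Variables (C : numClosedFieldType) (B A : algType C) (S : opv_space B A).

Lemma size_absorb c (u v : seq A) :
  (0 < size u + size v)%N -> size (absorb S c u v) = (size u + size v)%N.
Proof.
case: u => [|y u] /=; first by case: v.
by rewrite size_cat size_rcons size_belast.
Qed.

Lemma absorb_cl l c d (u v : seq A) :
  (0 < size u + size v)%N ->
  exists u' v' y z, [/\ absorb S c u v = u' ++ y :: v',
    absorb S d u v = u' ++ z :: v' &
    absorb S (l *: c + d) u v = u' ++ (l *: y + z) :: v'].
Proof.
case: u => [|y u] /=.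
  case: v => [//|z v] _; exists [::], v, (lact S c z), (lact S d z).
  by rewrite lactDl lactZl.
move=> _; exists (belast y u), v, (ract S (last y u) c), (ract S (last y u) d).
by rewrite !cat_rcons ractDr ractZr.
Qed.

Lemma absorb_ul l c (u1 u2 v : seq A) x y :
  exists u' v' x' y', [/\ absorb S c (u1 ++ x :: u2) v = u' ++ x' :: v',
    absorb S c (u1 ++ y :: u2) v = u' ++ y' :: v' &
    absorb S c (u1 ++ (l *: x + y) :: u2) v = u' ++ (l *: x' + y') :: v'].
Proof.
have absE u z : absorb S c (rcons u z) v = u ++ ract S z c :: v.
  by case: u => //= t u; rewrite belast_rcons last_rcons cat_rcons.
case/lastP: u2 => [|u2 t].
  exists u1, v, (ract S x c), (ract S y c).
  by rewrite !cats1 !absE ractDl ractZl.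
exists u1, (u2 ++ ract S t c :: v), x, y.
by rewrite -!rcons_cons -!rcons_cat !absE -!catA.
Qed.

Lemma absorb_vl l c (u v1 v2 : seq A) x y :
  exists u' v' x' y', [/\ absorb S c u (v1 ++ x :: v2) = u' ++ x' :: v',
    absorb S c u (v1 ++ y :: v2) = u' ++ y' :: v' &
    absorb S c u (v1 ++ (l *: x + y) :: v2) = u' ++ (l *: x' + y') :: v'].
Proof.
case: u => [|t u] /=.
  case: v1 => [|t v1] /=.
    by exists [::], v2, (lact S c x), (lact S c y); rewrite lactDr lactZr.
  by exists (lact S c t :: v1), v2, x, y.
exists (rcons (belast t u) (ract S (last t u) c) ++ v1), v2, x, y.
by rewrite -!catA.
Qed.

Lemma interval_at_lt (L : eqType) (l : seq L) r :
  interval_at l r -> (r < size l)%N.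
Proof.
rewrite /interval_at; case E: (drop r l) => [//|V t] _.
by rewrite ltnNge; apply/negP => /drop_oversize; rewrite E.
Qed.

Section Nested.
Variables (T : finType) (l : seq {set T}).
Hypothesis lNC : ~~ constant l.
Let r := find (interval_at l) (iota 0 (size l)).
Let s := count_mem (nth set0 l r) l.

Lemma step_cases : (r + s <= size l /\ 0 < s)%N \/ (size l <= r)%N.
Proof.
case: (leqP (size l) r) => [|rl]; first by right.
have rI : interval_at l r.
  have := nth_find 0%N (a := interval_at l) (s := iota 0 (size l)).
  rewrite has_find size_iota => /(_ rl); rewrite nth_iota //.
left; split; last by rewrite -has_count has_pred1 mem_nth.
move: rI; rewrite /interval_at (drop_nth set0 rl) -/s => /prefixP[t].
rewrite -(drop_nth set0 rl) => /(congr1 size).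
rewrite size_drop size_cat size_nseq => e.
by rewrite -(subnKC (ltnW rl)) e leq_add2l leq_addr.
Qed.

Lemma step_lt : (s < size l)%N.
Proof.
rewrite /s; set V := nth _ _ _; rewrite ltn_neqAle count_size andbT.
rewrite -all_count; apply: contra lNC => /all_pred1_constant //.
Qed.

End Nested.

Lemma nested_ext (T : finType) (k1 k2 : seq A -> B) m (l : seq {set T}) x :
  size l = size x -> ~~ constant l ->
  (forall y, (size y < size x)%N -> k1 y = k2 y) ->
  nested S k1 m l x = nested S k2 m l x.
Proof.
elim: m l x => [//|m IH] l x slx lN k12 /=; rewrite (negPf lN).
set r := find _ _; set s := count_mem _ _.
have sl := step_lt lN; rewrite -/r -/s in sl.
have -> : k1 (take s (drop r x)) = k2 (take s (drop r x)).
  by apply: k12; rewrite size_take_min size_drop; lia.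
set c := k2 _; set l' := _ ++ _; set x' := absorb _ _ _ _.
have x0 : (0 < size x)%N by rewrite -slx; case: (l) lN.
have sizes : size l' = size x' /\
    (~~ constant l' \/ (size x' < size x)%N).
  rewrite /l' /x'; have := step_cases l; rewrite -/r -/s => -[[h1 h2]|h].
    have sT : size (take r x) = r by rewrite size_takel -?slx; lia.
    have sT' : size (take r l) = r by rewrite size_takel; lia.
    rewrite size_absorb !(sT, size_drop, size_cat, sT') -?slx; last by lia.
    by split; [lia | right; lia].
  rewrite take_oversize // drop_oversize ?cats0; last by lia.
  rewrite (take_oversize (s := x)) ?(drop_oversize (s := x)); try lia.
  by rewrite size_absorb ?addn0 //; split=> //; left.
case: sizes => sl'x' sizes.
have sx' : (size x' <= size x)%N.
  rewrite -sl'x' -slx size_cat size_take_min size_drop; lia.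
case: (boolP (constant l')) => l'C; last first.
  by apply: IH => // y yx; apply: k12; apply: leq_trans yx sx'.
case: sizes => [/negP//|sx'x]; case: m {IH} => //= m.
by rewrite l'C; apply: k12.
Qed.

Lemma nested_multilinear (T : finType) (k : seq A -> B) m (l : seq {set T})
    a x y u v :
  multilinear k -> size l = (size u + size v).+1 ->
  nested S k m l (u ++ (a *: x + y) :: v)
  = a *: nested S k m l (u ++ x :: v) + nested S k m l (u ++ y :: v).
Proof.
move=> kM; elim: m l x y u v => [|m IH] l x y u v sl.
  by rewrite /= scaler0 addr0.
rewrite /=; case: ifP => [_|/negbT lN]; first exact: kM.
set r := find _ _; set s := count_mem _ _.
have := step_lt lN; have := step_cases l; rewrite -/r -/s => cs slt.
set l' := _ ++ _.
have dropE z : (size u < r)%N -> drop r (u ++ z :: v) = drop (r - size u).-1 v.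
  by move=> ur; rewrite drop_cat ltnNge (ltnW ur) /=;
     case E: (r - size u)%N => [|j] //; lia.
have dropE2 z : (size u < r + s)%N ->
    drop (r + s) (u ++ z :: v) = drop (r + s - size u).-1 v.
  by move=> ur; rewrite drop_cat ltnNge (ltnW ur) /=;
     case E: (r + s - size u)%N => [|j] //; lia.
have takeE z : (size u < r)%N ->
    take r (u ++ z :: v) = u ++ z :: take (r - size u).-1 v.
  by move=> ur; rewrite take_cat ltnNge (ltnW ur) /=;
     case E: (r - size u)%N => [|j] //; lia.
have sl' w : size w = size l -> (size (take r w) + size (drop (r + s) w) =
    size l')%N.
  by move=> sw; rewrite /l' size_cat !size_take_min !size_drop sw.
have szw z : size (u ++ z :: v) = size l by rewrite size_cat /= sl addnS.
have l'0 : (0 < size l')%N.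
  rewrite /l' size_cat size_take_min size_drop.
  by case: cs => [[h1 h2]|h]; lia.
have rec x1 y1 z1 (h : exists u' v' x' y', [/\ x1 = u' ++ x' :: v',
     y1 = u' ++ y' :: v' & z1 = u' ++ (a *: x' + y') :: v']) :
   size x1 = size l' ->
   nested S k m l' z1 = a *: nested S k m l' x1 + nested S k m l' y1.
  case: h => u' [v' [x' [y' [-> -> ->]]]]; rewrite size_cat /= => e.
  by apply: IH; rewrite -e addnS.
case: (ltnP (size u) r) => ur.
  have e w z : take w (drop r (u ++ z :: v)) = take w (drop (r - size u).-1 v).
    by rewrite dropE.
  have e2 z : drop (r + s) (u ++ z :: v) = drop (r + s - size u).-1 v.
    by rewrite dropE2 //; lia.
  rewrite !e !e2; apply: rec; first by rewrite !takeE //; apply: absorb_ul.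
  by rewrite -(e2 x) size_absorb sl'.
have tE z : take r (u ++ z :: v) = take r u.
  by rewrite take_cat; case: ltngtP ur => // -> _;
     rewrite subnn take0 cats0 take_oversize.
have dE z : drop r (u ++ z :: v) = drop r u ++ z :: v.
  by rewrite drop_cat; case: ltngtP ur => // -> _;
     rewrite subnn drop0 drop_oversize.
case: (ltnP (size u) (r + s)) => us.
  have eT z : take s (drop r (u ++ z :: v)) =
      drop r u ++ z :: take (s - size (drop r u)).-1 v.
    rewrite dE take_cat size_drop; case: ltnP => [|_]; first by lia.
    by case E: (s - (size u - r))%N => [|j] //; lia.
  rewrite !eT !dropE2 // kM; apply: rec.
    rewrite !tE; apply: absorb_cl.
    by rewrite -(tE x) -(dropE2 x) // sl'.
  by rewrite -(dropE2 x us) size_absorb sl'.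
have eT z : take s (drop r (u ++ z :: v)) = take s (drop r u).
  rewrite dE take_cat size_drop; case: ltnP => // h.
  rewrite (_ : s - (size u - r) = 0)%N ?take0 ?cats0; last by lia.
  by rewrite take_oversize // size_drop.
have eD z : drop (r + s) (u ++ z :: v) = drop (r + s) u ++ z :: v.
  by rewrite drop_cat; case: ltngtP us => // -> _;
     rewrite subnn drop0 drop_oversize.
rewrite !eT; apply: rec; first by rewrite !tE !eD; apply: absorb_vl.
by rewrite size_absorb sl'.
Qed.

Lemma kappa_part_multilinear k n (P : {set {set 'I_n}}) a x y u v :
  multilinear k -> n = (size u + size v).+1 ->
  kappa_part S k P (u ++ (a *: x + y) :: v)
  = a *: kappa_part S k P (u ++ x :: v) + kappa_part S k P (u ++ y :: v).
Proof.
move=> kM nE; apply: nested_multilinear => //.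
by rewrite size_map size_enum_ord.
Qed.

Lemma partition_constant n (P : {set {set 'I_n.+1}}) :
  partition P [set: 'I_n.+1] ->
  constant [seq pblock P i | i <- enum 'I_n.+1] = (P == [set [set: 'I_n.+1]]).
Proof.
move=> PP; have cP i : i \in cover P by rewrite (cover_partition PP).
have tP : trivIset P by case/and3P: PP.
apply/idP/eqP => [/constantP|->].
  move=> /(_ set0)[V VE].
  have bV i : pblock P i = V.
    have : pblock P i \in [seq pblock P j | j <- enum 'I_n.+1].
      by rewrite map_f ?mem_enum.
    by rewrite VE => /nseqP[].
  have VT : V = setT.
    by apply/setP=> i; rewrite -(bV i) mem_pblock cP inE.
  apply/setP=> W; rewrite inE -VT; apply/idP/eqP => [WP|->].
    have [i iW] : exists i, i \in W.
      apply/set0Pn; apply: contraTneq WP => ->.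
      by case/and3P: PP.
    by rewrite -(bV i) (def_pblock tP WP iW).
  by rewrite -(bV ord0) pblock_mem.
apply: (@all_pred1_constant _ [set: 'I_n.+1]); apply/allP => W /mapP[i _ ->].
have T1 : trivIset [set [set: 'I_n.+1]].
  apply/trivIsetP => V W'; rewrite !inE => /eqP-> /eqP->.
  by rewrite eqxx.
by rewrite /= (def_pblock T1 (B := setT)) ?inE.
Qed.

Lemma setT_NC n : [set [set: 'I_n.+1]] \in NC n.+1.
Proof.
rewrite inE; apply/andP; split.
  apply/and3P; split.
  - by rewrite /cover big_set1.
  - by apply/trivIsetP => V W; rewrite !inE => /eqP-> /eqP->; rewrite eqxx.
  - by rewrite inE eq_sym; apply/set0Pn; exists ord0; rewrite inE.
apply/forall_inP => V; rewrite inE => /eqP->.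
by apply/forall_inP => W; rewrite inE => /eqP->; rewrite eqxx.
Qed.

Lemma kappa_part_setT k n x :
  kappa_part S k [set [set: 'I_n.+1]] x = k x.
Proof.
rewrite /kappa_part [nested _ _ _ _ _]/= partition_constant ?eqxx //.
by have := setT_NC n; rewrite inE => /andP[].
Qed.

(* Solves the moment-cumulant relation for the term of the one-block          *)
(* partition; the first argument bounds the depth of the recursion.           *)
Fixpoint cumul_rec (m : nat) (x : seq A) : B :=
  if m is m'.+1 then
    if x is [::] then 0 else
    phi S (\prod_(y <- x) y)
    - \sum_(P in NC (size x) | P != [set [set: 'I_(size x)]])
        kappa_part S (cumul_rec m') P x
  else 0.

Lemma cumul_rec_stable m n x :
  (size x <= m)%N -> (size x <= n)%N -> cumul_rec m x = cumul_rec n x.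
Proof.
elim: m n x => [|m IH] [|n] [|z x] //= xm xn; congr (_ - _).
apply: eq_bigr => P /andP[]; rewrite inE => /andP[PP _] PT.
apply: nested_ext; first by rewrite size_map size_enum_ord.
  by rewrite partition_constant.
by move=> y yx; apply: IH; move: yx xm xn => /=; lia.
Qed.

Lemma cumul_rec_multilinear m : multilinear (cumul_rec m).
Proof.
elim: m => [|m IH] l x y u v; first by rewrite /= scaler0 addr0.
have E z : cumul_rec m.+1 (u ++ z :: v) =
    phi S (\prod_(t <- u ++ z :: v) t) -
    \sum_(P in NC (size u + size v).+1 |
             P != [set [set: 'I_(size u + size v).+1]])
        kappa_part S (cumul_rec m) P (u ++ z :: v).
  rewrite -addnS -[(size v).+1]/(size (z :: v)) -size_cat.
  by case: u.
rewrite !E !big_cat !big_cons /= mulrDl mulrDr -scalerAl -scalerAr.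
rewrite linearD linearZ scalerBr addrACA -opprD; congr (_ - _).
rewrite scaler_sumr -big_split; apply: eq_bigr => P _ /=.
exact: kappa_part_multilinear.
Qed.

Lemma is_free_cumulants_exist : exists kappa, is_free_cumulants S kappa.
Proof.
exists (fun x => cumul_rec (size x) x); split.
  move=> l x y u v; rewrite !size_cat /=; exact: cumul_rec_multilinear.
case=> [//|z x] _; set w := z :: x.
rewrite (bigD1 [set [set: 'I_(size w)]]) ?setT_NC //=.
rewrite kappa_part_setT {1}[cumul_rec _ _]/= -/w -addrA.
rewrite [X in _ = _ + X](_ : _ = 0) ?addr0 //; apply/eqP.
rewrite addrC subr_eq0; apply/eqP/eq_bigr => P /andP[].
rewrite inE => /andP[PP _] PT.
apply: nested_ext; first by rewrite size_map size_enum_ord.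
  by rewrite partition_constant.
by move=> y yw; apply: cumul_rec_stable.
Qed.

Lemma cumulant_series_multilinear kappa x :
  multilinear kappa -> multilinear (cumulant_series S kappa x).
Proof.
move=> kM l c d u v.
have E e : cumulant_series S kappa x (u ++ e :: v) =
    kappa ([seq ract S x c | c <- u] ++ ract S x e
             :: rcons [seq ract S x c | c <- v] x).
  by rewrite -rcons_cons -rcons_cat -map_cons -map_cat; case: u.
by rewrite !E ractDr ractZr kM.
Qed.

Lemma V_series_multilinear kappa a b :
  multilinear kappa -> multilinear (V_series S kappa a b).
Proof.
move=> kM l c d u v.
pose w (s : seq B) := flatten [seq [:: a; ract S b c] | c <- s].
have sw s : size (w s) = (size s).*2 by elim: s => //= t s IH; rewrite IH.
have E e : V_series S kappa a b (u ++ e :: v) =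
    \sum_(P in NCirr (size u + size v).+1)
      kappa_part S kappa (interleave P (Kr P))
        (rcons (w u) a ++ ract S b e :: w v ++ [:: a; b]).
  rewrite -addnS -[(size v).+1]/(size (e :: v)) -size_cat.
  rewrite cat_rcons -!cat_cons catA -[a :: _ :: w v]/(w (e :: v)).
  by rewrite /w -flatten_cat -map_cat; case: u.
rewrite !E ractDr ractZr scaler_sumr -big_split; apply: eq_bigr => P _ /=.
apply: kappa_part_multilinear => //.
by rewrite size_rcons size_cat !sw /=; lia.
Qed.

End Existence.

(* Main.v *)
Require Import Defs.
From mathcomp Require Import all_boot all_order all_algebra.
From mathcomp Require Import boolp reals complex zify.

Set Implicit Arguments.
Unset Strict Implicit.
Unset Printing Implicit Defensive.

Import GRing.Theory.

(** The proof reads words from left to right. A non-crossing partition of a word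
    can be built with a stack of open blocks: each letter either opens a new
    block or joins the block on top of the stack, and afterwards either closes
    this block or keeps it open. A closing block multiplies the last letter of
    the block below it by its cumulant, which is exactly what the nested
    evaluation of a partitioned cumulant does ([nested_run]). Since non-crossing
    partitions correspond to the possible sequences of such moves
    ([sum_NC_flags]), [phi] of a product of letters is the value of a machine,
    [sweep], which sums over all the moves ([moment_sweep]). The same machine
    computes [V_series]: the partitions obtained from an irreducible one and its
    Kreweras complement are those for which the moves follow an alternating
    rule, where the letter after one which closed its block joins, and the
    letter after one which kept it open opens ([flags_interleave_Kr],
    [valid_expand], [V_series_moment]).

    The machine is local: while a block is open, the letters up to its next
    letter are read as if they formed a word on their own, whose value multiplies
    the previous letter of that block ([sweep_final_bottom]). Following the first
    block of a periodic word, one gets the cumulant series of its letter composed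
    with the values of the gaps, times the value of what comes after the block
    ([periodic_series]). If mixed cumulants vanish, a block of a word alternating
    in [a] and [b] uses one of these letters only, so that the gaps are again
    alternating words and the equations close up. For the alternating rule the
    first block must reach the end of the word, and one finds the first identity
    V = Ka o [W I] with W = Kb o [I V] ([moment_a_alt], [moment_b_alt]). For the
    full rule one finds three equations for the series P, Q, N of the moments of
    ab c1 ab c2 ... ab, of b c1 ab c2 ... ab and of ab c1 ab c2 ... a
    ([moment_ab_full], [moment_b_full], [moment_a_full]); reading the first
    word as a word in the single letter [a * b] gives P = (Kab o [I D]) D' with
    D = 1 + P I and D' = 1 + I P ([moment_power_full]).

    These equations determine P, Q, N by induction on the order, and composing
    the first identity with I D produces a solution: with X = V o [I D] and
    Y = W o [I D] one finds P = X Y D', Q = Y D', N = D X. Hence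
    (Kab o [I D]) D' = ((V W) o [I D]) D', and right multiplication by D' and
    composition with I D can be cancelled ([free_product_series]).

    It remains to see that freeness with amalgamation makes the mixed cumulants
    vanish ([free_mixed_vanish]). Let the machine use the cumulants of [a] and
    [b] with the mixed ones replaced by zero. A maximal run of letters of one
    colour cannot join blocks of the other colour, so a product of centred runs
    has value zero in this machine, as it has under [phi] by freeness; expanding
    the centrings, all moments agree by induction on the number of letters
    ([moment_mono]), and the moments determine the cumulants ([sweep_top]). *)

(** * Non-crossing partitions as paths *)

Section Labels.
Implicit Types (fl : seq (bool * bool)).

(** For each entry of [l]: does it occur here for the first time ([seen] lists
    the earlier entries), and for the last time? *)
Fixpoint flags (L : eqType) (seen l : seq L) : seq (bool * bool) :=
  if l is V :: l' then (V \notin seen, V \notin l') :: flags (V :: seen) l'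
  else [::].

Lemma size_flags (L : eqType) (seen l : seq L) : size (flags seen l) = size l.
Proof. by elim: l seen => //= V l IH seen; rewrite IH. Qed.

Lemma flags_map (T : Type) (L L' : eqType) (f : T -> L) (g : T -> L') seen s :
  (forall x y, (f x == f y) = (g x == g y)) ->
  flags (map f seen) (map f s) = flags (map g seen) (map g s).
Proof.
move=> fg; have memE x t : (f x \in map f t) = (g x \in map g t).
  by elim: t => //= y t IH; rewrite !in_cons IH fg.
by elim: s seen => //= x s IH seen; rewrite !memE -!map_cons IH.
Qed.

(** These are the coloured Motzkin paths: [h] is the number of open blocks, and
    a letter which does not open a block needs one to join. *)
Fixpoint valid (h : nat) fl : bool :=
  if fl is (f, e) :: fl' then
    (f || (0 < h)) && valid (h + f - e) fl'
  else h == 0.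

(** The form of non-crossing which passes to subsequences of the list of labels,
    hence to what remains after the removal of a block. *)
Definition uncrossed (L : eqType) (l : seq L) :=
  forall U V, U != V -> ~~ subseq [:: U; V; U; V] l.

Lemma uncrossed_mapP (T L : eqType) (f : T -> L) s :
  uncrossed (map f s) <->
  forall i j k l, subseq [:: i; j; k; l] s -> f i = f k -> f j = f l -> f i = f j.
Proof.
split=> [unc i j k l /(map_subseq f) /= sub ik jl|unc U V UV].
  apply/eqP; apply/negPn/negP => ij.
  by move: sub (unc _ _ ij); rewrite -ik -jl => ->.
apply/negP => /subseqP[m]; rewrite size_map => sm; rewrite -map_mask.
case E: (mask m s) => [|i [|j [|k [|l [|? ?]]]]] //= [Ui Vj Uk Vl].
case/eqP: UV; rewrite Ui Vj; apply: (unc i j k l); rewrite -?Ui -?Vj //.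
by rewrite -E mask_subseq.
Qed.

Lemma subseq_enum_ord n (i j k l : 'I_n) :
  subseq [:: i; j; k; l] (enum 'I_n) = [&& i < j, j < k & k < l].
Proof.
have so : sorted (fun i j : 'I_n => i < j) (enum 'I_n).
  by rewrite -(sorted_map (f := val) (e' := ltn)) val_enum_ord iota_ltn_sorted.
have tr : transitive (fun i j : 'I_n => i < j) by move=> x y z; apply: ltn_trans.
apply/idP/idP => [sub|h].
  by have /= := subseq_sorted tr sub so; rewrite andbT.
have -> : [:: i; j; k; l] = filter (mem [:: i; j; k; l]) (enum 'I_n).
  apply: (@irr_sorted_eq _ (fun i j : 'I_n => i < j)) => //=.
  - by rewrite andbT.
  - exact: sorted_filter.
  - by move=> x; rewrite mem_filter mem_enum andbT.
exact: filter_subseq.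
Qed.

Definition labels n (P : {set {set 'I_n}}) := [seq pblock P i | i <- enum 'I_n].

Lemma noncrossing_labels n (P : {set {set 'I_n}}) : partition P [set: 'I_n] ->
  noncrossing P <-> uncrossed (labels P).
Proof.
move=> PP; have cP i : i \in cover P by rewrite (cover_partition PP).
have tP : trivIset P by case/and3P: PP.
rewrite uncrossed_mapP; split=> [nc i j k l|unc].
  rewrite subseq_enum_ord => h ik jl; apply/eqP; apply/negPn/negP => ij.
  move/forall_inP: nc => /(_ _ (pblock_mem (cP i))) /forall_inP.
  move=> /(_ _ (pblock_mem (cP j))) /implyP /(_ ij) /negP; apply.
  apply/existsP; exists i; rewrite mem_pblock cP /=.
  apply/existsP; exists j; rewrite mem_pblock cP /=.
  apply/existsP; exists k; rewrite ik mem_pblock cP /=.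
  by apply/existsP; exists l; rewrite jl mem_pblock cP.
apply/forall_inP => V VP; apply/forall_inP => W WP; apply/implyP => VW.
apply/negP => /existsP[i /andP[iV /existsP[j /andP[jW]]]].
move=> /existsP[k /andP[kV /existsP[l /andP[lW h]]]].
case/eqP: VW; rewrite -(def_pblock tP VP iV) -(def_pblock tP WP jW).
apply: (unc i j k l); first by rewrite subseq_enum_ord.
  by rewrite (def_pblock tP VP iV) (def_pblock tP VP kV).
by rewrite (def_pblock tP WP jW) (def_pblock tP WP lW).
Qed.

Definition pop (L : eqType) (V : L) (st : seq L) : seq L :=
  if st is U :: st' then if U == V then st' else st else st.

(** The stack [st] holds the labels of the open blocks, the most recent first;
    a label which was met before must be on top of the stack, and it is put back
    if it occurs again later. *)
Fixpoint parses (L : eqType) (st l : seq L) : bool :=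
  if l is V :: l' then
    (V \notin pop V st) &&
    parses (if V \in l' then V :: pop V st else pop V st) l'
  else st == [::].

Lemma subseq_uncrossed (L : eqType) (l l' : seq L) :
  subseq l l' -> uncrossed l' -> uncrossed l.
Proof.
move=> sub unc U V UV; apply: contra (unc U V UV) => h.
exact: subseq_trans sub.
Qed.

(** The open labels, read from the bottom of the stack, stand for one of their
    earlier occurrences. If the next letter had its label strictly below the top,
    the top label, which occurs again later, would cross it. *)
Lemma uncrossed_parses (L : eqType) (st l : seq L) :
  uniq st -> {subset st <= l} -> uncrossed (rev st ++ l) -> parses st l.
Proof.
elim: l st => [|V l IH] st ust sub unc /=.
  by case: st sub {ust unc} => // U st /(_ U); rewrite inE eqxx => /(_ isT).
have [ust' sub' VN unc'] : [/\ uniq (pop V st), {subset pop V st <= l},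
    V \notin pop V st & uncrossed (rev (pop V st) ++ V :: l)].
  case: st ust sub unc => [|U st] /=.
    by move=> _ _ unc; split=> // W; rewrite in_nil.
  move=> /andP[UN ust] sub.
  have [e|UV] := eqVneq U V; first subst U.
    move=> unc; split=> //.
      move=> W Wst; have := sub W; rewrite !inE Wst orbT => /(_ isT).
      by case/orP=> // /eqP e; rewrite -e Wst in UN.
    apply: subseq_uncrossed unc; rewrite rev_cons cat_rcons.
    by rewrite subseq_cat2l subseq_cons.
  move=> unc.
  have VN : V \notin U :: st.
    apply/negP => VU; have Vst : V \in st.
      by move: VU; rewrite inE eq_sym (negPf UV).
    have Ul : U \in l by have := sub U; rewrite !inE eqxx (negPf UV) => /(_ isT).
    move: (unc V U); rewrite eq_sym UV => /(_ isT) /negP; apply.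
    rewrite rev_cons cat_rcons -[[:: V; U; V; U]]/([:: V] ++ [:: U; V; U]).
    apply: cat_subseq; first by rewrite sub1seq mem_rev.
    by rewrite /= !eqxx sub1seq.
  split=> //; first by rewrite /= UN.
  move=> W WU; have := sub W WU; rewrite inE => /orP[/eqP e|//].
  by rewrite -e WU in VN.
rewrite VN; case: ifP => Vl; apply: IH => //.
- by rewrite /= VN.
- by move=> W; rewrite inE => /orP[/eqP->//|/sub'].
- by rewrite rev_cons cat_rcons.
- by apply: subseq_uncrossed unc'; rewrite subseq_cat2l subseq_cons.
Qed.

Lemma parses_subset (L : eqType) (st l : seq L) : parses st l -> {subset st <= l}.
Proof.
elim: l st => [|V l IH] st /=; first by move/eqP->.
case: st => [//|U st] /=.
have [->|UV] := eqVneq U V => /andP[VN /IH sub] W; rewrite !inE.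
  case/orP=> [->//|Wst]; have := sub W; case: ifP => Vl; rewrite ?inE Wst ?orbT;
  by move=> ->; rewrite ?orbT.
move=> Wst; have := sub W; case: ifP => Vl; rewrite !inE Wst ?orbT;
by move=> ->; rewrite ?orbT.
Qed.

(** The invariant of the parse: on the labels still to come, having been seen
    amounts to being on the stack. *)
Lemma parses_step (L : eqType) (seen st : seq L) V l :
  parses st (V :: l) -> {in V :: l, seen =i st} ->
  let st' := if V \in l then V :: pop V st else pop V st in
  [/\ parses st' l, {in l, V :: seen =i st'} &
      size st + (V \notin seen) - (V \notin l) = size st'].
Proof.
move=> /= /andP[VN r] ss; split=> //.
  move=> U Ul; rewrite inE; have [UV|UV] := eqVneq U V.
    by rewrite -UV Ul inE eqxx.
  have -> : (U \in (if V \in l then V :: pop V st else pop V st)) =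
      (U \in pop V st).
    by case: ifP; rewrite // inE (negPf UV).
  rewrite /= ss ?inE ?Ul ?orbT //; case: (st) => [//|W st0] /=.
  by case: eqVneq => [->|//]; rewrite inE (negPf UV).
rewrite ss ?mem_head //; move: VN; case: (st) => [|W st0] /=.
  by case: (V \in l).
have [->|WV] := eqVneq W V => VN.
  by rewrite mem_head /=; case: (V \in l) => /=; lia.
by rewrite VN; case: (V \in l) => /=; lia.
Qed.

Lemma parses_valid (L : eqType) (seen st l : seq L) :
  parses st l -> {in l, seen =i st} -> valid (size st) (flags seen l).
Proof.
elim: l seen st => [|V l IH] seen st; first by move/eqP->.
move=> r ss; have [r' ss' sz] := parses_step r ss.
rewrite [flags _ _]/= /valid -/valid sz IH // andbT ss ?mem_head //.
by case: (st) => [|W st0] //=; rewrite orbT.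
Qed.

(** Inverse of [flags] up to renaming: every block gets as its label the position
    of its first letter. *)
Fixpoint decode (st : seq nat) (i : nat) fl : seq nat :=
  if fl is (f, e) :: fl' then
    let v := if f then i else head 0 st in
    let st' := if f then st else behead st in
    v :: decode (if e then st' else v :: st') i.+1 fl'
  else [::].

Lemma size_decode st i fl : size (decode st i fl) = size fl.
Proof. by elim: fl st i => //= -[f e] fl IH st i; rewrite /= IH. Qed.

(** Flags determine the labels up to renaming, because the position of the first
    occurrence of a label is a canonical name for it. *)
Lemma decode_flags (L : eqType) (pre seen st l : seq L) :
  parses st l -> {in l, pre =i st} -> seen =i pre ->
  decode [seq index V (pre ++ l) | V <- st] (size pre) (flags seen l) =
  [seq index V (pre ++ l) | V <- l].
Proof.
elim: l pre seen st => [//|V l IH] pre seen st r ss sp.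
have [r' next _] := parses_step r ss.
have VV := ss V (mem_head V l); move: r => /= /andP[VN _].
rewrite sp; set v := (if _ then size pre else _).
have -> : v = index V (pre ++ V :: l).
  rewrite /v; case Vp: (V \in pre) => /=.
    move: VN VV; rewrite Vp; case: (st) => [//|W st0] /=.
    by have [->|WV /negPf->] := eqVneq W V.
  by rewrite index_cat Vp /= eqxx addn0.
congr (_ :: _).
have -> : (if V \notin pre then [seq index W (pre ++ V :: l) | W <- st]
    else behead [seq index W (pre ++ V :: l) | W <- st]) =
    [seq index W (pre ++ V :: l) | W <- pop V st].
  rewrite VV; move: VN; case: (st) => [//|W st0] /=.
  by have [->|WV VN] := eqVneq W V; rewrite ?mem_head // VN.
have {}next : {in l, rcons pre V =i if V \in l then V :: pop V st else pop V st}.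
  by move=> U Ul; rewrite -next // mem_rcons !inE.
rewrite -cat_rcons -(IH (rcons pre V) (V :: seen) _ r' next); last first.
  by move=> U; rewrite mem_rcons !inE sp.
by rewrite size_rcons; congr (decode _ _ _); case: (V \in l).
Qed.

Lemma decode_new (st : seq nat) i fl v :
  valid (size st) fl -> v \in decode st i fl -> (v \in st) || (i <= v).
Proof.
elim: fl st i => [//|[f e] fl IH] st i /=.
case: f => /=.
  move=> h; rewrite inE => /orP[/eqP->|]; first by rewrite leqnn orbT.
  case: e h => h /IH; rewrite ?inE /=.
    by move: h; rewrite addn1 subn1 => h /(_ h) /orP[->//|/ltnW->]; rewrite orbT.
  move: h; rewrite addn1 subn0 => h /(_ h) /orP[/orP[/eqP->|->//]|/ltnW->];
  by rewrite ?leqnn orbT.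
case: st => [//|U st] /=; rewrite addn0 => h.
rewrite !inE => /orP[->//|].
case: e h => h /IH; rewrite ?inE /=.
  by move: h; rewrite subn1 => h /(_ h) /orP[->|/ltnW->]; rewrite !orbT.
by move: h; rewrite subn0 => h /(_ h) /orP[->|/ltnW->]; rewrite ?orbT.
Qed.

Lemma decode_closes st i fl : valid (size st) fl -> {subset st <= decode st i fl}.
Proof.
elim: fl st i => [|[f e] fl IH] st i /=; first by move/nilP->.
case: f => /=.
  case: e => h v vst; rewrite inE; apply/orP; right.
    by apply: IH => //; move: h; rewrite addn1 subn1.
  by apply: IH => /=; [move: h; rewrite addn1 subn0 | rewrite inE vst orbT].
case: st => [//|U st] /=; rewrite addn0 => h v; rewrite !inE => /orP[->//|vst].
apply/orP; right; case: e h => h; apply: IH => //=.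
- by move: h; rewrite subn1.
- by rewrite inE vst orbT.
Qed.

Lemma flags_decode (seen st : seq nat) i fl :
  valid (size st) fl -> uniq st -> {subset st <= seen} ->
  (forall v, v \in seen -> v < i) -> flags seen (decode st i fl) = fl.
Proof.
elim: fl seen st i => [//|[f e] fl IH] seen st i /=.
case: f => /=.
  move=> h ust sub lt.
  have iN : i \notin seen by apply/negP => /lt; rewrite ltnn.
  have ist : i \notin st by apply: contra iN => /sub.
  have lt' v : v \in i :: seen -> v < i.+1.
    by rewrite inE => /orP[/eqP->//|/lt /ltnW].
  rewrite iN; case: e h => h.
    have h' : valid (size st) fl by move: h; rewrite addn1 subn1.
    rewrite IH //; last by move=> v /sub vs; rewrite inE vs orbT.
    congr ((_, _) :: _); apply/negP => /(decode_new h').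
    by rewrite (negPf ist) ltnn.
  have h' : valid (size (i :: st)) fl by move: h; rewrite addn1 subn0.
  rewrite IH //=; last 2 first.
  - by rewrite ist.
  - by move=> v; rewrite !inE => /orP[->//|/sub->]; rewrite orbT.
  by rewrite (decode_closes _ h') // mem_head.
case: st => [//|U st] /=; rewrite addn0 => h /andP[UN ust] sub lt.
have Us : U \in seen by apply: sub; rewrite mem_head.
have lt' v : v \in U :: seen -> v < i.+1.
  by rewrite inE => /orP[/eqP->|/lt /ltnW//]; apply/ltnW/lt.
rewrite Us; case: e h => h.
  have h' : valid (size st) fl by move: h; rewrite subn1.
  rewrite IH //; last by move=> v vs; rewrite inE sub ?orbT // inE vs orbT.
  congr ((_, _) :: _); apply/negP => /(decode_new h').
  by rewrite (negPf UN) /= leqNgt lt' // mem_head.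
have h' : valid (size (U :: st)) fl by move: h; rewrite subn0.
rewrite IH //=; last 2 first.
- by rewrite UN.
- by move=> v /sub vs; rewrite inE vs orbT.
by rewrite (decode_closes _ h') // mem_head.
Qed.

Lemma subseq_stutter (L : eqType) (s p q : seq L) v :
  sorted (fun x y => x != y) s ->
  subseq s (p ++ v :: v :: q) -> subseq s (p ++ v :: q).
Proof.
elim: p s => [|u p IH] [|x s] //=.
  case: eqVneq => [->|xv]; last by rewrite (negPf xv).
  case: s => [|y s] /=; first by rewrite !sub0seq.
  by move=> /andP[vy _]; rewrite eq_sym (negPf vy).
by case: eqVneq => _ h; apply: IH => //; apply: path_sorted h.
Qed.

Lemma uncrossed_stutter (L : eqType) (p q : seq L) v :
  uncrossed (p ++ v :: q) -> uncrossed (p ++ v :: v :: q).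
Proof.
move=> unc U V UV; apply: contra (unc U V UV); apply: subseq_stutter.
by rewrite /= UV eq_sym UV.
Qed.

Lemma uncrossed_insert (L : eqType) (p q : seq L) v :
  v \notin p -> v \notin q -> uncrossed (p ++ q) -> uncrossed (p ++ v :: q).
Proof.
move=> vp vq unc U V UV; apply/negP => sub.
have cnt W : count_mem W [:: U; V; U; V] <= count_mem W (p ++ v :: q).
  exact: leq_count_subseq.
have [vU|vU] := eqVneq v U.
  move: (cnt v); rewrite count_cat /= vU eqxx -vU.
  by rewrite !(count_memPn _) //=; lia.
have [vV|vV] := eqVneq v V.
  move: (cnt v); rewrite count_cat /= vV eqxx -vV.
  by rewrite !(count_memPn _) //=; lia.
move/negP: (unc U V UV); apply.
have fil (r : seq L) : v \notin r -> filter (predC1 v) r = r.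
  by move=> vr; apply/all_filterP/allP => x xr /=; apply: contraNneq vr => <-.
have <- : filter (predC1 v) (p ++ v :: q) = p ++ q.
  by rewrite filter_cat /= eqxx /= !fil.
by rewrite subseq_filter sub /= ![_ == v]eq_sym vU vV.
Qed.

(** Going back from the end of the word, the list of open and future labels
    changes by the repetition of an entry or the insertion of a new one, and
    neither creates a crossing. *)
Lemma uncrossed_decode (st : seq nat) i fl :
  valid (size st) fl -> uniq st -> (forall v, v \in st -> v < i) ->
  uncrossed (rev st ++ decode st i fl).
Proof.
elim: fl st i => [|[f e] fl IH] st i /=; first by case: st.
case: f => /=.
  move=> h ust lt.
  have ist : i \notin st by apply/negP => /lt; rewrite ltnn.
  case: e h => h.
    have h' : valid (size st) fl by move: h; rewrite addn1 subn1.
    apply: uncrossed_insert; rewrite ?mem_rev //.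
      by apply/negP => /(decode_new h'); rewrite (negPf ist) ltnn.
    by apply: IH => // v /lt /ltnW.
  have h' : valid (size (i :: st)) fl by move: h; rewrite addn1 subn0.
  rewrite -cat_rcons -rev_cons; apply: IH; rewrite //= ?ist //.
  by move=> v; rewrite inE => /orP[/eqP->//|/lt /ltnW].
case: st => [//|U st] /=; rewrite addn0 => h /andP[UN ust] lt.
rewrite rev_cons cat_rcons; apply: uncrossed_stutter.
have lt' v : v \in st -> v < i.+1.
  by move=> vs; apply/ltnW/lt; rewrite inE vs orbT.
case: e h => h.
  have h' : valid (size st) fl by move: h; rewrite subn1.
  apply: uncrossed_insert; rewrite ?mem_rev //; last exact: IH.
  apply/negP => /(decode_new h').
  by rewrite (negPf UN) /= leqNgt ltnS ltnW // lt // mem_head.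
have h' : valid (size (U :: st)) fl by move: h; rewrite subn0.
rewrite -cat_rcons -rev_cons; apply: IH; rewrite //= ?UN //.
by move=> v /lt /ltnW.
Qed.

End Labels.

Section Partitions.
Variable T : finType.

Lemma partition_map (h : T -> {set T}) :
  (forall x, x \in h x) -> (forall x y, y \in h x -> h y = h x) ->
  partition [set h x | x : T] [set: T] /\
  forall x, pblock [set h x | x : T] x = h x.
Proof.
move=> hx hxy.
have tI : trivIset [set h x | x : T].
  apply/trivIsetP => _ _ /imsetP[x _ ->] /imsetP[y _ ->].
  apply: contraR => /pred0Pn[z /= /andP[zx zy]].
  by rewrite -(hxy _ _ zx) -(hxy _ _ zy).
split; last by move=> x; apply: def_pblock => //; apply: imset_f.
apply/and3P; split=> //.
  apply/eqP/setP => x; rewrite inE; apply/bigcupP.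
  by exists (h x) => //; apply: imset_f.
by apply/imsetP => -[x _ e]; have := hx x; rewrite -e inE.
Qed.

Lemma pblock_preim (L : eqType) (f : T -> L) i j :
  (pblock (preim_partition f [set: T]) i == pblock (preim_partition f [set: T]) j)
  = (f i == f j).
Proof.
have PP : partition (preim_partition f [set: T]) [set: T].
  exact: preim_partitionP.
rewrite eq_pblock ?(cover_partition PP) ?inE //; last by case/and3P: PP.
rewrite pblock_equivalence_partition ?inE //.
by move=> x y z _ _ _; split=> // /eqP->.
Qed.

End Partitions.

Section NCFlags.
Variable n : nat.
Implicit Types (P Q : {set {set 'I_n}}) (fl : n.-tuple (bool * bool)).

Lemma partition_ext P Q :
  partition P [set: 'I_n] -> partition Q [set: 'I_n] ->
  (forall i j, (pblock P i == pblock P j) = (pblock Q i == pblock Q j)) -> P = Q.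
Proof.
suff sub (P' Q' : {set {set 'I_n}}) :
    partition P' [set: 'I_n] -> partition Q' [set: 'I_n] ->
    (forall i j, (pblock P' i == pblock P' j) = (pblock Q' i == pblock Q' j)) ->
    P' \subset Q'.
  move=> PP PQ PQe; apply/eqP; rewrite eqEsubset; apply/andP.
  by split; apply: sub => // i j; rewrite PQe.
move=> PP PQ PQe; apply/subsetP => V VP.
have cP i : i \in cover P' by rewrite (cover_partition PP).
have cQ i : i \in cover Q' by rewrite (cover_partition PQ).
have tP : trivIset P' by case/and3P: PP.
have tQ : trivIset Q' by case/and3P: PQ.
have [i iV] : exists i, i \in V.
  by apply/set0Pn; apply: contraTneq VP => ->; case/and3P: PP.
rewrite -(def_pblock tP VP iV).
suff -> : pblock P' i = pblock Q' i by apply: pblock_mem.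
by apply/setP => j; rewrite -!eq_pblock // PQe.
Qed.

Lemma NC_partition P : P \in NC n -> partition P [set: 'I_n].
Proof. by rewrite inE => /andP[]. Qed.

Lemma NC_parses P : P \in NC n -> parses [::] (labels P).
Proof.
rewrite inE => /andP[PP /(noncrossing_labels PP) unc].
by apply: uncrossed_parses => // x; rewrite in_nil.
Qed.

Lemma nth_labels P (i : 'I_n) : nth set0 (labels P) i = pblock P i.
Proof. by rewrite (nth_map i) ?nth_ord_enum ?size_enum_ord. Qed.

Lemma size_labels P : size (labels P) = n.
Proof. by rewrite size_map size_enum_ord. Qed.

Lemma flags_labels_inj P Q : P \in NC n -> Q \in NC n ->
  flags [::] (labels P) = flags [::] (labels Q) -> P = Q.
Proof.
move=> PN QN e; apply: partition_ext; try exact: NC_partition.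
have idx P' : P' \in NC n -> decode [::] 0 (flags [::] (labels P')) =
    [seq index V (labels P') | V <- labels P'].
  by move=> P'N; rewrite (@decode_flags _ [::] [::] [::]) //; apply: NC_parses.
have idxE P' i : nth 0 [seq index V (labels P') | V <- labels P'] (i : 'I_n) =
    index (pblock P' i) (labels P').
  by rewrite (nth_map set0) ?size_labels // nth_labels.
have memE P' i : pblock P' i \in labels P' by apply: map_f; rewrite mem_enum.
have eqE P' i j : (pblock P' i == pblock P' j) =
    (index (pblock P' i) (labels P') == index (pblock P' j) (labels P')).
  apply/eqP/eqP => [->//|h].
  by rewrite -(nth_index set0 (memE P' i)) h nth_index.
by move=> i j; rewrite eqE [RHS]eqE -!idxE -!idx // e.
Qed.

Lemma flags_labels_valid P : P \in NC n -> valid 0 (flags [::] (labels P)).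
Proof. by move/NC_parses/parses_valid; apply. Qed.

Lemma flags_labels_surj fl : valid 0 fl ->
  exists2 P, P \in NC n & flags [::] (labels P) = fl.
Proof.
move=> v; set L := decode [::] 0 fl.
have sL : size L = n by rewrite size_decode size_tuple.
pose f (i : 'I_n) := nth 0 L i.
have fL : map f (enum 'I_n) = L.
  apply: (@eq_from_nth _ 0); first by rewrite size_map size_enum_ord.
  move=> i; rewrite size_map size_enum_ord => i_n.
  by rewrite (nth_map (Ordinal i_n)) ?size_enum_ord // /f nth_enum_ord.
pose P := preim_partition f [set: 'I_n].
have PP : partition P [set: 'I_n] by apply: preim_partitionP.
have fE i j : (pblock P i == pblock P j) = (f i == f j) by apply: pblock_preim.
exists P; last first.
  rewrite /labels -[RHS](@flags_decode [::] [::] 0) // -/L -fL.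
  exact: (@flags_map _ _ _ (pblock P) f [::]).
have unc : uncrossed (map f (enum 'I_n)).
  by rewrite fL; apply: (@uncrossed_decode [::] 0) => // ?; rewrite in_nil.
rewrite inE PP /=; apply/(noncrossing_labels PP)/uncrossed_mapP.
move=> i j k l sub /eqP + /eqP; rewrite !fE => /eqP ik /eqP jl.
apply/eqP; rewrite fE; apply/eqP.
by move/uncrossed_mapP: unc => /(_ i j k l sub ik jl).
Qed.

Local Open Scope ring_scope.
(** Non-crossing partitions correspond bijectively to coloured Motzkin paths. *)
Lemma sum_NC_flags (V : nmodType) (F : seq (bool * bool) -> V) :
  \sum_(P in NC n) F (flags [::] (labels P)) =
  \sum_(fl : n.-tuple (bool * bool) | valid 0 fl) F fl.
Proof.
have sz P : size (flags [::] (labels P)) == n by rewrite size_flags size_labels.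
pose g P := Tuple (sz P).
rewrite -[LHS]/(\sum_(P in NC n) F (g P)) -(big_imset (fun fl => F fl)) /=.
  apply: eq_bigl => fl; apply/imsetP/idP => [[P PN ->]|].
    exact: flags_labels_valid.
  by move=> /flags_labels_surj[P PN e]; exists P => //; apply/val_inj.
by move=> P Q PN QN /(congr1 val); apply: flags_labels_inj.
Qed.

End NCFlags.

Lemma NC_uncrossed n (P : {set {set 'I_n}}) : partition P [set: 'I_n] ->
  noncrossing P <->
  forall i j k l : 'I_n, i < j -> j < k -> k < l ->
    pblock P i = pblock P k -> pblock P j = pblock P l -> pblock P i = pblock P j.
Proof.
move=> PP; rewrite noncrossing_labels // uncrossed_mapP.
by split=> H i j k l; [move=> ij jk kl; apply: H; rewrite subseq_enum_ord ij jk
  | rewrite subseq_enum_ord => /and3P[]; apply: H].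
Qed.

(** * The Kreweras complement *)

Section Kreweras.
Variable m : nat.
Implicit Types P Q : {set {set 'I_m}}.

Lemma refinesP P Q : partition P [set: 'I_m] -> partition Q [set: 'I_m] ->
  reflect (forall i j, pblock P i = pblock P j -> pblock Q i = pblock Q j)
    (refines P Q).
Proof.
move=> PP PQ.
have cP i : i \in cover P by rewrite (cover_partition PP).
have cQ i : i \in cover Q by rewrite (cover_partition PQ).
have tP : trivIset P by case/and3P: PP.
have tQ : trivIset Q by case/and3P: PQ.
apply: (iffP forall_inP) => [ref i j ij|ref V VP].
  have /exists_inP[W WQ /subsetP sub] := ref _ (pblock_mem (cP i)).
  rewrite (def_pblock tQ WQ (sub i _)) ?mem_pblock //.
  by rewrite (def_pblock tQ WQ (sub j _)) // ij mem_pblock.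
have [i iV] : exists i, i \in V.
  by apply/set0Pn; apply: contraTneq VP => ->; case/and3P: PP.
apply/exists_inP; exists (pblock Q i); first exact: pblock_mem.
apply/subsetP => j jV; rewrite -eq_pblock //; apply/eqP/ref.
by rewrite (def_pblock tP VP iV) (def_pblock tP VP jV).
Qed.

Definition ord_half (x : 'I_m.*2) : 'I_m.
Proof. by exists x./2; have := ltn_ord x; lia. Defined.

Lemma evn_half (x : 'I_m.*2) : ~~ odd x -> x = evn (ord_half x).
Proof. by move=> xo; apply/val_inj => /=; lia. Qed.

Lemma odn_half (x : 'I_m.*2) : odd x -> x = odn (ord_half x).
Proof. by move=> xo; apply/val_inj => /=; lia. Qed.

Lemma evn_inj : injective (@evn m).
Proof. by move=> i j /(congr1 val) /= e; apply/val_inj => /=; lia. Qed.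

Lemma odn_inj : injective (@odn m).
Proof. by move=> i j /(congr1 val) /= e; apply/val_inj => /=; lia. Qed.

Lemma odn_evn (i j : 'I_m) : odn i <> evn j.
Proof. by move=> /(congr1 val) /= e; lia. Qed.

Variant ord_double_spec : 'I_m.*2 -> Type :=
| OrdEvn i : ord_double_spec (evn i)
| OrdOdn i : ord_double_spec (odn i).

Lemma ord_doubleP x : ord_double_spec x.
Proof.
by case: (boolP (odd x)) => [/odn_half->|/evn_half->]; constructor.
Qed.

Lemma interleave_partition P Q :
  partition P [set: 'I_m] -> partition Q [set: 'I_m] ->
  [/\ partition (interleave P Q) [set: 'I_m.*2],
      forall i, pblock (interleave P Q) (evn i) = [set evn j | j in pblock P i] &
      forall i, pblock (interleave P Q) (odn i) = [set odn j | j in pblock Q i]].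
Proof.
move=> PP PQ.
have cP i : i \in cover P by rewrite (cover_partition PP).
have cQ i : i \in cover Q by rewrite (cover_partition PQ).
have tP : trivIset P by case/and3P: PP.
have tQ : trivIset Q by case/and3P: PQ.
pose h (x : 'I_m.*2) := if odd x then [set odn j | j in pblock Q (ord_half x)]
                        else [set evn j | j in pblock P (ord_half x)].
have hE i : h (evn i) = [set evn j | j in pblock P i].
  rewrite /h /= odd_double; congr [set evn j | j in pblock P _].
  by apply/val_inj; rewrite /= doubleK.
have hO i : h (odn i) = [set odn j | j in pblock Q i].
  rewrite /h /= odd_double /=; congr [set odn j | j in pblock Q _].
  by apply/val_inj; rewrite /= uphalf_double.
have -> : interleave P Q = [set h x | x : 'I_m.*2].
  apply/setP => V; rewrite inE; apply/orP/imsetP.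
    case=> /imsetP[W WP ->].
      have [i iW] : exists i, i \in W.
        by apply/set0Pn; apply: contraTneq WP => ->; case/and3P: PP.
      by exists (evn i) => //; rewrite hE (def_pblock tP WP iW).
    have [i iW] : exists i, i \in W.
      by apply/set0Pn; apply: contraTneq WP => ->; case/and3P: PQ.
    by exists (odn i) => //; rewrite hO (def_pblock tQ WP iW).
  case=> x _ ->; case: (ord_doubleP x) => i.
    by left; rewrite hE; apply: imset_f; apply: pblock_mem.
  by right; rewrite hO; apply: imset_f; apply: pblock_mem.
have [] := @partition_map _ h.
- move=> x; case: (ord_doubleP x) => i; rewrite ?hE ?hO imset_f //;
  by rewrite mem_pblock.
- move=> x y; case: (ord_doubleP x) => i; rewrite ?hE ?hO => /imsetP[j ji ->];
  by rewrite ?hE ?hO (same_pblock _ ji).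
by move=> hP hB; split=> // i; rewrite hB.
Qed.

(** The pairs of points of a common block of [P] which lie on both sides of the
    gap after [i]. *)
Definition cut P (i : 'I_m) : {set 'I_m * 'I_m} :=
  [set pq | (pblock P pq.1 == pblock P pq.2) && ((i < pq.1) != (i < pq.2))].

(** A point placed in the gap after [i] can share a block with one placed in the
    gap after [j] without crossing [P] exactly when no block of [P] has points
    both between and outside the two gaps. This is an equivalence relation, so it
    defines the greatest partition with this property. *)
Definition krew P := preim_partition (cut P) [set: 'I_m].

Lemma krew_partition P : partition (krew P) [set: 'I_m].
Proof. exact: preim_partitionP. Qed.

Lemma cut_eqP P (i j : 'I_m) : reflect
  (forall p q : 'I_m, pblock P p = pblock P q ->
     ((i < p) != (i < q)) = ((j < p) != (j < q))) (cut P i == cut P j).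
Proof.
apply: (iffP eqP) => [e p q pq|H].
  by move/setP: e => /(_ (p, q)); rewrite !inE /= pq eqxx.
apply/setP => -[p q]; rewrite !inE /=; case: eqP => //= pq; exact: H.
Qed.

Lemma krew_noncrossing P : noncrossing (krew P).
Proof.
apply/(NC_uncrossed (krew_partition P)) => i j k l ij jk kl.
move=> /eqP + /eqP; rewrite !pblock_preim => /cut_eqP ik /cut_eqP jl.
apply/eqP; rewrite pblock_preim; apply/cut_eqP => p q pq.
by have := ik p q pq; have := jl p q pq; lia.
Qed.

Lemma same_evn P Q i j : partition P [set: 'I_m] -> partition Q [set: 'I_m] ->
  (pblock (interleave P Q) (evn i) = pblock (interleave P Q) (evn j)) <->
  (pblock P i = pblock P j).
Proof.
by move=> PP PQ; have [_ E _] := interleave_partition PP PQ; rewrite !E;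
   split=> [/(imset_inj evn_inj)|->].
Qed.

Lemma same_odn P Q i j : partition P [set: 'I_m] -> partition Q [set: 'I_m] ->
  (pblock (interleave P Q) (odn i) = pblock (interleave P Q) (odn j)) <->
  (pblock Q i = pblock Q j).
Proof.
by move=> PP PQ; have [_ _ E] := interleave_partition PP PQ; rewrite !E;
   split=> [/(imset_inj odn_inj)|->].
Qed.

Lemma evn_odn_blocks P Q i j : partition P [set: 'I_m] -> partition Q [set: 'I_m] ->
  pblock (interleave P Q) (evn i) <> pblock (interleave P Q) (odn j).
Proof.
move=> PP PQ; have [_ -> ->] := interleave_partition PP PQ.
move=> /setP /(_ (odn j)); rewrite [X in _ = X]imset_f; last first.
  by rewrite mem_pblock (cover_partition PQ) inE.
by move=> /imsetP[k _] /odn_evn.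
Qed.

Lemma interleave_krew P : P \in NC m -> interleave P (krew P) \in NC m.*2.
Proof.
rewrite inE => /andP[PP ncP]; have PK := krew_partition P.
have [PI _ _] := interleave_partition PP PK.
rewrite inE PI /=; apply/(NC_uncrossed PI) => x y z w.
case: (ord_doubleP x) => i; case: (ord_doubleP z) => k; move=> xy yz zw.
- move=> /(same_evn _ _ PP PK) ik.
  case: (ord_doubleP y) xy yz => j xy yz; case: (ord_doubleP w) zw => l zw.
  + move=> /(same_evn _ _ PP PK) jl; apply/(same_evn _ _ PP PK).
    by move/(NC_uncrossed PP): ncP => /(_ i j k l); apply=> //; move: xy yz zw => /=; lia.
  + by move/evn_odn_blocks => /(_ PP PK).
  + by move/esym/evn_odn_blocks => /(_ PP PK).
  + move=> /(same_odn _ _ PP PK) /eqP; rewrite pblock_preim => /cut_eqP /(_ i k ik).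
    by move: xy yz zw => /=; lia.
- by move/evn_odn_blocks => /(_ PP PK).
- by move/esym/evn_odn_blocks => /(_ PP PK).
- move=> /(same_odn _ _ PP PK) ik.
  case: (ord_doubleP y) xy yz => j xy yz; case: (ord_doubleP w) zw => l zw.
  + move=> /(same_evn _ _ PP PK) jl.
    move/eqP: ik; rewrite pblock_preim => /cut_eqP /(_ j l jl).
    by move: xy yz zw => /=; lia.
  + by move/evn_odn_blocks => /(_ PP PK).
  + by move/esym/evn_odn_blocks => /(_ PP PK).
  + move=> /(same_odn _ _ PP PK) jl; apply/(same_odn _ _ PP PK).
    have /(NC_uncrossed PK) := krew_noncrossing P.
    by move=> /(_ i j k l); apply=> //; move: xy yz zw => /=; lia.
Qed.

Lemma krew_greatest P Q : P \in NC m -> Q \in Kr_candidates P ->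
  refines Q (krew P).
Proof.
move=> /NC_partition PP; rewrite inE => /andP[/NC_partition PQ].
have [PI _ _] := interleave_partition PP PQ.
rewrite inE => /andP[_ /(NC_uncrossed PI) unc].
apply/(refinesP PQ (krew_partition P)).
have half (i j p q : 'I_m) : pblock Q i = pblock Q j -> pblock P p = pblock P q ->
    i < j -> p < q -> ((i < p) != (i < q)) = ((j < p) != (j < q)).
  move=> /(same_odn _ _ PP PQ) ij /(same_evn _ _ PP PQ) pq lij lpq.
  have c1 : p <= i -> i < q -> q <= j -> False.
    move=> h1 h2 h3; apply: (@evn_odn_blocks P Q p i) => //.
    by apply: (unc _ _ (evn q) (odn j)) => //=; lia.
  have c2 : i < p -> p <= j -> j < q -> False.
    move=> h1 h2 h3; apply: (@evn_odn_blocks P Q p i) => //; symmetry.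
    by apply: (unc _ _ (odn j) (evn q)) => //=; lia.
  by apply/idP/idP => h; apply: contraT => h'; exfalso; [apply: c1 | apply: c2]; lia.
have full (i j p q : 'I_m) : pblock Q i = pblock Q j -> pblock P p = pblock P q ->
    i < j -> ((i < p) != (i < q)) = ((j < p) != (j < q)).
  move=> ij pq lij; case: (ltngtP p q) => lpq; first exact: half.
    by rewrite [(i < p) == _]eq_sym [(j < p) == _]eq_sym; apply: half.
  by rewrite (_ : p = q) ?eqxx //; apply/val_inj.
move=> i j ij; apply/eqP; rewrite pblock_preim; apply/cut_eqP => p q pq.
case: (ltngtP i j) => lij; first exact: full.
  by symmetry; apply: full.
by have -> : i = j by apply/val_inj.
Qed.

Lemma refines_anti P Q : partition P [set: 'I_m] -> partition Q [set: 'I_m] ->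
  refines P Q -> refines Q P -> P = Q.
Proof.
move=> PP PQ /(refinesP PP PQ) rPQ /(refinesP PQ PP) rQP.
apply: partition_ext => // i j.
by apply/eqP/eqP => [/rPQ|/rQP].
Qed.

Lemma Kr_krew P : P \in NC m -> Kr P = krew P.
Proof.
move=> PN; have KC : krew P \in Kr_candidates P.
  rewrite inE interleave_krew // andbT inE krew_partition.
  exact: krew_noncrossing.
rewrite /Kr; case: pickP => [Q /andP[QC /forall_inP Qmax]|] /=; last first.
  move/(_ (krew P)); rewrite /= KC /= => /negP[].
  by apply/forall_inP => Q QC; apply: krew_greatest.
apply: refines_anti; [|exact: krew_partition| |exact: Qmax].
  by move: QC; rewrite inE => /andP[/NC_partition].
exact: krew_greatest.
Qed.

End Kreweras.

(** In the gap after a point, the complement opens a block exactly when this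
    point does not close its own, and closes one exactly when the next point does
    not open one. The argument [e] tells whether the point before the current gap
    closes its block; [fl] are the flags of the points after it. *)
Fixpoint kr_flags (e : bool) (fl : seq (bool * bool)) :=
  if fl is q :: fl' then
    [:: (~~ e, ~~ q.1), q & kr_flags q.2 fl']
  else [::].

Definition expand (fl : seq (bool * bool)) :=
  if fl is q :: fl' then q :: kr_flags q.2 fl' else [::].

(** The path stays positive between its first step and its last one: some block remains open all the
    way, as it should for an irreducible partition. *)
Fixpoint positive (h : nat) (fl : seq (bool * bool)) : bool :=
  if fl is (f, e) :: (_ :: _) as fl' then
    (0 < h + f - e) && positive (h + f - e) fl'
  else true.

Lemma positive_cons h f e q fl : positive h [:: (f, e), q & fl] =
  (0 < h + f - e) && positive (h + f - e) (q :: fl).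
Proof. by []. Qed.

(** On the stack of the interleaved partition the open blocks of the two kinds
    alternate, starting from the bottom with the first kind and having the first
    kind on top exactly when [e] does not hold. Hence [h] open blocks of the first
    kind make [h.*2 + e - 1] open blocks in total. *)
Lemma valid_kr_flags h (e : bool) k fl : k.+1 = h.*2 + e ->
  valid k (rcons (kr_flags e fl) (true, true)) ->
  valid h fl && ((fl == [::]) || (0 < h) && positive h fl).
Proof.
elim: fl h e k => [|[f l] fl IH] h e k kh /=.
  by move=> /eqP k0; rewrite andbT; move: kh k0; case: e => /=; lia.
move=> /andP[h1 /andP[h2 v]].
have {v} /andP[v p] : valid (h + f - l) fl &&
    ((fl == [::]) || (0 < h + f - l) && positive (h + f - l) fl).
  apply: IH v; move: h1 h2 kh; case: e; case: f; case: l => /=; lia.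
have h0 : 0 < h by move: h1 h2 kh {v p}; case: e; case: f => /=; lia.
rewrite v andbT h0 orbT /=; case: fl IH v p => [//|q fl] _ _.
by [].
Qed.

Lemma valid_expand fl :
  valid 0 (rcons (expand fl) (true, true)) -> valid 0 fl && positive 0 fl.
Proof.
case: fl => [//|[f e] fl] /= /andP[]; rewrite orbF => -> /=.
rewrite add0n => /(@valid_kr_flags (1 - e)) /andP[]; first by case: e.
by move=> ->; case: fl.
Qed.

Section Irreducible.
Variable L : eqType.
Implicit Types st l seen : seq L.

(** The label at the bottom of the stack can only leave it at its last
    occurrence. *)
Lemma positive_parses seen st V U l :
  parses (rcons st V) (U :: l) -> {in U :: l, seen =i rcons st V} ->
  positive (size (rcons st V)) (flags seen (U :: l)) = (last U l == V).
Proof.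
elim: l seen st U => [|W l IH] seen st U r ss.
  case: st r {ss} => [|X st] /= /andP[_].
    by rewrite [U == V]eq_sym; case: (V == U).
  by case: (X == U); case: st.
have [r' ss' sz] := parses_step r ss.
rewrite -[flags _ _]/((_, _) :: flags (U :: seen) (W :: l)) positive_cons sz.
set st2 := (if U \in _ then _ else _) in r' ss' sz *.
have [[e [UV Ul]]|[st3 e]] :
    (st2 = [::] /\ U = V /\ U \notin W :: l) \/ exists st3, st2 = rcons st3 V.
  rewrite /st2; case: (st) => [|X s] /=.
    case: (eqVneq V U) => [->|VU].
      by case: ifP => h; [right; exists [::] | left; split=> //; split=> //; apply: negbT].
    by case: ifP => _; right; [exists [:: U] | exists [::]].
  case: (eqVneq X U) => XU; case: ifP => _; right.
  - by exists (U :: s).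
  - by exists s.
  - by exists [:: U, X & s].
  - by exists (X :: s).
  rewrite e /=; symmetry; apply/negbTE; apply: contra Ul => /eqP lV.
  by rewrite UV -lV mem_last.
have H := IH (U :: seen) st3 W; rewrite -e in H.
by rewrite H // e size_rcons.
Qed.

End Irreducible.

Section FlagsNC.
Variable n : nat.
Implicit Types P Q : {set {set 'I_n}}.

Definition is_first P (i : 'I_n) :=
  [forall j : 'I_n, (pblock P j == pblock P i) ==> (i <= j)].
Definition is_last P (i : 'I_n) :=
  [forall j : 'I_n, (pblock P j == pblock P i) ==> (j <= i)].

Lemma flags_nth (L : eqType) (seen l : seq L) x0 d i : i < size l ->
  nth d (flags seen l) i =
  ((nth x0 l i \notin seen) && (nth x0 l i \notin take i l),
    nth x0 l i \notin drop i.+1 l).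
Proof.
elim: l seen i => [//|V l IH] seen [|i] /=; first by rewrite drop0 andbT.
by rewrite ltnS => il; rewrite IH // !inE !negb_or andbCA andbA.
Qed.

Lemma flags_labels P :
  flags [::] (labels P) = [seq (is_first P i, is_last P i) | i <- enum 'I_n].
Proof.
apply: (@eq_from_nth _ (true, true)); first by rewrite size_flags !size_map.
move=> k; rewrite size_flags size_labels => kn.
rewrite (flags_nth _ set0) ?size_labels //.
rewrite (nth_map (Ordinal kn)) ?size_enum_ord //.
have -> : nth (Ordinal kn) (enum 'I_n) k = Ordinal kn.
  by apply/val_inj; rewrite /= nth_enum_ord.
rewrite -[nth _ _ k]/(nth set0 (labels P) (Ordinal kn)) nth_labels.
set i := Ordinal kn; congr (_, _).
  apply/negP/forallP => [h j|h].
    apply/implyP => /eqP ji; rewrite leqNgt; apply/negP => lji; apply: h.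
    rewrite -ji -nth_labels -(nth_take (n0 := k)) ?mem_nth //.
    by rewrite size_take_min size_labels leq_min; apply/andP; split => //; lia.
  move=> /(nthP set0)[j]; rewrite size_take_min size_labels => jk.
  have jn : j < n by lia.
  rewrite nth_take; last by lia.
  rewrite -[j]/(val (Ordinal jn)) nth_labels => e.
  by have := h (Ordinal jn); rewrite e eqxx /=; lia.
apply/negP/forallP => [h j|h].
  apply/implyP => /eqP ji; rewrite leqNgt; apply/negP => lij; apply: h.
  rewrite -ji -nth_labels -(subnKC (lij : k.+1 <= j)) -nth_drop mem_nth //.
  by rewrite size_drop size_labels; have := ltn_ord j; move: lij => /=; lia.
move=> /(nthP set0)[j]; rewrite size_drop size_labels nth_drop => jk.
have jn : k.+1 + j < n by lia.
rewrite -[k.+1 + j]/(val (Ordinal jn)) nth_labels => e.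
by have := h (Ordinal jn); rewrite e eqxx /=; lia.
Qed.

End FlagsNC.

Section KrewerasFlags.

Lemma enum_ord_double m :
  enum 'I_m.*2 = flatten [seq [:: evn i; odn i] | i <- enum 'I_m].
Proof.
apply: (inj_map val_inj); rewrite val_enum_ord map_flatten -map_comp.
rewrite (@eq_map _ _ _ ((fun k => [:: k.*2; k.*2.+1]) \o val)) //.
rewrite map_comp val_enum_ord -[X in iota X _]/(0.*2).
by elim: m 0 => //= m IH k; rewrite -IH doubleS.
Qed.

Section Interleave.
Variables (m : nat) (P Q : {set {set 'I_m}}).
Hypotheses (PP : partition P [set: 'I_m]) (PQ : partition Q [set: 'I_m]).

Lemma is_first_evn i : is_first (interleave P Q) (evn i) = is_first P i.
Proof.
apply/forallP/forallP => h x.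
  apply/implyP => /eqP /(same_evn _ _ PP PQ) e.
  by have := h (evn x); rewrite e eqxx /= leq_double.
case: (ord_doubleP x) => j; apply/implyP => /eqP.
  by move=> /(same_evn _ _ PP PQ) e; have := h j; rewrite e eqxx /= leq_double.
by move/esym/evn_odn_blocks => /(_ PP PQ).
Qed.

Lemma is_last_evn i : is_last (interleave P Q) (evn i) = is_last P i.
Proof.
apply/forallP/forallP => h x.
  apply/implyP => /eqP /(same_evn _ _ PP PQ) e.
  by have := h (evn x); rewrite e eqxx /= leq_double.
case: (ord_doubleP x) => j; apply/implyP => /eqP.
  by move=> /(same_evn _ _ PP PQ) e; have := h j; rewrite e eqxx /= leq_double.
by move/esym/evn_odn_blocks => /(_ PP PQ).
Qed.

Lemma is_first_odn i : is_first (interleave P Q) (odn i) = is_first Q i.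
Proof.
apply/forallP/forallP => h x.
  apply/implyP => /eqP /(same_odn _ _ PP PQ) e.
  by have := h (odn x); rewrite e eqxx /= ltnS leq_double.
case: (ord_doubleP x) => j; apply/implyP => /eqP.
  by move/evn_odn_blocks => /(_ PP PQ).
by move=> /(same_odn _ _ PP PQ) e; have := h j; rewrite e eqxx /= ltnS leq_double.
Qed.

Lemma is_last_odn i : is_last (interleave P Q) (odn i) = is_last Q i.
Proof.
apply/forallP/forallP => h x.
  apply/implyP => /eqP /(same_odn _ _ PP PQ) e.
  by have := h (odn x); rewrite e eqxx /= ltnS leq_double.
case: (ord_doubleP x) => j; apply/implyP => /eqP.
  by move/evn_odn_blocks => /(_ PP PQ).
by move=> /(same_odn _ _ PP PQ) e; have := h j; rewrite e eqxx /= ltnS leq_double.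
Qed.

Lemma flags_interleave : flags [::] (labels (interleave P Q)) =
  flatten [seq [:: (is_first P i, is_last P i); (is_first Q i, is_last Q i)]
          | i <- enum 'I_m].
Proof.
rewrite flags_labels enum_ord_double map_flatten -map_comp; congr flatten.
by apply: eq_map => i /=; rewrite is_first_evn is_last_evn is_first_odn is_last_odn.
Qed.

End Interleave.

Section Irreducible.
Variables (n : nat) (P : {set {set 'I_n.+1}}).
Hypothesis PN : P \in NC n.+1.
Hypothesis Pirr : pblock P ord0 = pblock P ord_max.
Let PP := NC_partition PN.

Lemma NC_crossing (i j k l : 'I_n.+1) : i < j -> j < k -> k < l ->
    pblock P i = pblock P k -> pblock P j = pblock P l -> pblock P i = pblock P j.
Proof. by move: PN; rewrite inE => /andP[_ /(NC_uncrossed PP)]; apply. Qed.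

Lemma first_exists i : exists2 f, pblock P f = pblock P i & is_first P f.
Proof.
case: (@arg_minnP _ i (fun j => pblock P j == pblock P i) val) => // f /eqP fi min.
by exists f => //; apply/forallP => j; rewrite fi; apply/implyP => /min.
Qed.

Lemma last_exists i : exists2 f, pblock P f = pblock P i & is_last P f.
Proof.
case: (@arg_maxnP _ i (fun j => pblock P j == pblock P i) val) => // f /eqP fi min.
by exists f => //; apply/forallP => j; rewrite fi; apply/implyP => /min.
Qed.

Lemma is_firstP i : is_first P i -> forall j, pblock P j = pblock P i -> i <= j.
Proof. by move/forallP => h j e; have := h j; rewrite e eqxx. Qed.

Lemma is_lastP i : is_last P i -> forall j, pblock P j = pblock P i -> j <= i.
Proof. by move/forallP => h j e; have := h j; rewrite e eqxx. Qed.

(** The interval spanned by a block is a union of blocks. *)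
Lemma hull_stable f e x y : is_first P f -> is_last P e ->
  pblock P f = pblock P e -> pblock P x = pblock P y ->
  f <= x -> x <= e -> f <= y /\ y <= e.
Proof.
move=> /is_firstP ff /is_lastP le fe xy fx xe.
have [xf|xf] := eqVneq (pblock P x) (pblock P f).
  by split; [apply: ff; rewrite -xy | apply: le; rewrite -xy xf].
have fx' : f < x.
  by rewrite ltn_neqAle fx andbT; apply: contraNneq xf => e'; rewrite (val_inj e').
have xe' : x < e.
  rewrite ltn_neqAle xe andbT; apply: contraNneq xf => e'.
  by rewrite (val_inj e' : x = e) fe.
split; rewrite leqNgt; apply/negP => h; case/eqP: xf.
  by rewrite xy; apply: (NC_crossing h fx' xe').
by symmetry; apply: (NC_crossing fx' xe' h).
Qed.

(** No block has points both inside and outside of the interval spanned by a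
    block, so the gaps before and after this interval cut the same pairs. *)
Lemma cut_hull (f e j : 'I_n.+1) : is_first P f -> is_last P e ->
  pblock P f = pblock P e -> f = j.+1 :> nat -> cut P j = cut P e.
Proof.
move=> ff le fe fj; apply/eqP/cut_eqP => x y xy.
have h1 := hull_stable ff le fe xy; have h2 := hull_stable ff le fe (esym xy).
have fle : f <= e by apply: is_firstP => //.
by apply/idP/idP => h; lia.
Qed.

Lemma krew_block i j :
  (pblock (krew P) i == pblock (krew P) j) = (cut P i == cut P j).
Proof. exact: pblock_preim. Qed.

(** If [i] closes its block, then the gap before the first point of that block is
    an earlier equivalent gap; it exists because irreducibility keeps [ord0] in a
    block that ends with [ord_max]. Otherwise a later point of the block of [i]
    separates the gap after [i] from all the earlier gaps. *)
Lemma krew_first (i : 'I_n.+1) : i < n -> is_first (krew P) i = ~~ is_last P i.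
Proof.
move=> i_n; apply/idP/negP => [/forallP h li|].
  have [f fi ff] := first_exists i.
  have f0 : 0 < f.
    rewrite lt0n; apply/negP => /eqP f0.
    have e0 : f = ord0 by apply/val_inj.
    have := is_lastP li (j := ord_max); rewrite -Pirr -e0 fi => /(_ erefl) /=.
    by lia.
  have jn : f.-1 < n.+1 by have := ltn_ord f; lia.
  have := h (Ordinal jn); rewrite krew_block (@cut_hull f i) ?eqxx //=; last by lia.
  by have := is_firstP ff (esym fi) => /=; lia.
move=> nl; apply/forallP => j; apply/implyP; rewrite krew_block => /cut_eqP cc.
have /forallPn[q] := introN idP nl; rewrite negb_imply => /andP[/eqP qi h].
have := cc i q (esym qi); move: h; lia.
Qed.

(** Mirror image of [krew_first], with the next point [i'] in place of [i]. *)
Lemma krew_last (i i' : 'I_n.+1) : i' = i.+1 :> nat ->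
  is_last (krew P) i = ~~ is_first P i'.
Proof.
move=> ii; apply/idP/negP => [/forallP h fi|].
  have [e ei le] := last_exists i'.
  have := h e; rewrite krew_block (@cut_hull i' e i) ?eqxx //=.
  by have := is_lastP le (esym ei); lia.
move=> nf; apply/forallP => j; apply/implyP; rewrite krew_block => /cut_eqP cc.
have /forallPn[q] := introN idP nf; rewrite negb_imply => /andP[/eqP qi h].
have := cc i' q (esym qi); move: h; lia.
Qed.

(** The gap after the last point is alone in its block since the block of [ord0]
    and [ord_max] is cut by every other gap. *)
Lemma krew_max : is_first (krew P) ord_max && is_last (krew P) ord_max.
Proof.
apply/andP; split; apply/forallP => j; apply/implyP; last by rewrite -ltnS.
rewrite krew_block => /cut_eqP /(_ ord0 ord_max Pirr) /=.
by have := ltn_ord j; lia.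
Qed.

Lemma flatten_kr_flags (f g : nat -> bool * bool) k r :
  (forall i, k <= i < k + r -> g i = (~~ (f i).2, ~~ (f i.+1).1)) ->
  flatten [seq [:: f i; g i] | i <- iota k r.+1] =
  rcons (expand [seq f i | i <- iota k r.+1]) (g (k + r)).
Proof.
rewrite /=; elim: r k => [|r IH] k gE /=; first by rewrite addn0.
rewrite gE ?addnS -?addSn; last by lia.
by rewrite IH // => i ik; apply: gE; lia.
Qed.

Lemma flags_interleave_Kr : flags [::] (labels (interleave P (Kr P))) =
  rcons (expand (flags [::] (labels P))) (true, true).
Proof.
rewrite Kr_krew // flags_interleave ?krew_partition //.
rewrite flags_labels.
pose f i := (is_first P (inord i), is_last P (inord i)).
pose g i := (is_first (krew P) (inord i), is_last (krew P) (inord i)).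
have -> : [seq (is_first P i, is_last P i) | i <- enum 'I_n.+1] =
    [seq f i | i <- iota 0 n.+1].
  by rewrite -val_enum_ord -map_comp; apply: eq_map => i /=; rewrite /f inord_val.
rewrite -[(true, true)]/((true, true)) (_ : (true, true) = g (0 + n)); last first.
  have -> : g (0 + n) = (is_first (krew P) ord_max, is_last (krew P) ord_max).
    by rewrite /g (_ : inord (0 + n) = ord_max) //; apply/val_inj; rewrite /= inordK.
  by have /andP[-> ->] := krew_max.
rewrite -flatten_kr_flags.
  rewrite -val_enum_ord -map_comp; congr flatten; apply: eq_map => i /=.
  by rewrite /f /g inord_val.
move=> i /andP[_ i_n]; rewrite /g krew_first ?inordK //; last by lia.
by rewrite (@krew_last _ (inord i.+1)) // !inordK //; lia.
Qed.

End Irreducible.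

Lemma positive_labels n (P : {set {set 'I_n.+1}}) : P \in NC n.+1 ->
  positive 0 (flags [::] (labels P)) = (pblock P ord0 == pblock P ord_max).
Proof.
move=> PN; have r := NC_parses PN.
have e0 : nth set0 (labels P) 0 = pblock P ord0 by rewrite -[0]/(val (@ord0 n)) nth_labels.
have en : last set0 (labels P) = pblock P ord_max.
  by rewrite -nth_last size_labels -[n.+1.-1]/(val (@ord_max n)) nth_labels.
move: r e0 en; case: (labels P) (size_labels P) => [//|V l] _ r <- <-.
rewrite [nth _ _ _]/= [last _ _]/=; case: l r => [|U l] r; first by rewrite eqxx.
have [r' ss sz] := parses_step r (fun x _ => erefl : (x \in [::]) = (x \in [::])).
rewrite -[flags _ _]/((_, _) :: flags [:: V] (U :: l)) positive_cons sz.
move: r' ss {sz}; rewrite /=; case: ifP => Vl r' ss.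
  have := @positive_parses _ [:: V] [::] V U l r' ss.
  by rewrite /= eq_sym.
symmetry; apply/negbTE/eqP => e; move: Vl; rewrite e.
by rewrite mem_last.
Qed.

End KrewerasFlags.

Local Open Scope ring_scope.

(** * Multilinear function series *)

Section SplitSum.
Variables (T : Type) (V : nmodType).
Implicit Types (f g : seq T -> seq T -> V) (s u v : seq T).

(** The sum of [f u v] over all the ways to write [s = u ++ v]. *)
Fixpoint split_sum f s : V :=
  f [::] s +
  (if s is c :: s' then split_sum (fun u v => f (c :: u) v) s' else 0).

Lemma split_sum_nil f : split_sum f [::] = f [::] [::].
Proof. exact: addr0. Qed.

Lemma split_sum_cons f c s :
  split_sum f (c :: s) =
  f [::] (c :: s) + split_sum (fun u v => f (c :: u) v) s.
Proof. by []. Qed.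

Lemma split_sum_index f s :
  \sum_(0 <= k < (size s).+1) f (take k s) (drop k s) = split_sum f s.
Proof.
elim: s f => [|c s IH] f; first by rewrite big_nat1 split_sum_nil.
rewrite big_nat_recl // take0 drop0 split_sum_cons -IH.
by congr (_ + _); apply: eq_bigr.
Qed.

Lemma eq_split_sum f g s :
  (forall u v, s = u ++ v -> f u v = g u v) -> split_sum f s = split_sum g s.
Proof.
elim: s f g => [|c s IH] f g fg; first by rewrite !split_sum_nil fg.
rewrite !split_sum_cons; congr (_ + _); first exact: fg.
by apply: IH => u v e; apply: fg; rewrite e.
Qed.

Lemma split_sumD f g s :
  split_sum (fun u v => f u v + g u v) s = split_sum f s + split_sum g s.
Proof.
elim: s f g => [|c s IH] f g; first by rewrite !split_sum_nil.
by rewrite !split_sum_cons IH addrACA.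
Qed.

Lemma split_sum0 f s :
  (forall u v, s = u ++ v -> f u v = 0) -> split_sum f s = 0.
Proof.
elim: s f => [|c s IH] f f0; first by rewrite !split_sum_nil f0.
by rewrite split_sum_cons f0 // IH ?addr0 // => u v e; apply: f0; rewrite e.
Qed.

Lemma split_sum_assoc (F : seq T -> seq T -> seq T -> V) s :
  split_sum (fun u v => split_sum (fun v1 v2 => F u v1 v2) v) s =
  split_sum (fun u v => split_sum (fun u1 u2 => F u1 u2 v) u) s.
Proof.
elim: s F => [|c s IH] F; first by rewrite !split_sum_nil.
rewrite split_sum_cons (IH (fun u v1 v2 => F (c :: u) v1 v2)).
rewrite split_sum_cons [RHS]split_sum_cons split_sum_nil -addrA; congr (_ + _).
by rewrite -split_sumD.
Qed.

Lemma split_sum_last f s :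
  split_sum f s =
  f s [::] + (if s is c :: s' then
                split_sum (fun u v => f u (rcons v (last c s'))) (belast c s')
              else 0).
Proof.
case: s => [//|c s]; elim: s c f => [|d s IH] c f.
  by rewrite split_sum_cons !split_sum_nil addrC.
rewrite split_sum_cons IH addrCA; congr (_ + _).
by rewrite [RHS]split_sum_cons /= -lastI.
Qed.

End SplitSum.

Lemma raddf_split_sum (T : Type) (V W : nmodType) (h : V -> W)
    (f : seq T -> seq T -> V) s :
  h 0 = 0 -> {morph h : x y / x + y} ->
  h (split_sum f s) = split_sum (fun u v => h (f u v)) s.
Proof.
move=> h0 hD; elim: s f => [|c s IH] f; first by rewrite !split_sum_nil.
by rewrite !split_sum_cons hD IH.
Qed.

Section Series.
Variable C : numClosedFieldType.
Variable B : algType C.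
Implicit Types (al be ga : seq B -> B) (s t u v : seq B).

Local Notation I := (@series_I C B).
Lemma series_catE al be s :
  series_cat al be s = split_sum (fun u v => al u * be v) s.
Proof. exact: split_sum_index. Qed.

Lemma series_cat_nil al be : series_cat al be [::] = al [::] * be [::].
Proof. by rewrite series_catE split_sum_nil. Qed.

Lemma series_catA al be ga :
  series_cat al (series_cat be ga) = series_cat (series_cat al be) ga.
Proof.
apply/funext => s; rewrite !series_catE.
transitivity (split_sum (fun u v =>
    split_sum (fun v1 v2 => al u * be v1 * ga v2) v) s).
  apply: eq_split_sum => u v _; rewrite series_catE raddf_split_sum ?mulr0 //.
    by apply: eq_split_sum => *; rewrite mulrA.
  by move=> x y; rewrite mulrDr.
rewrite split_sum_assoc; apply: eq_split_sum => u v _; rewrite series_catE.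
rewrite (@raddf_split_sum _ _ _ ( *%R^~ (ga v))) ?mul0r //.
by move=> x y; rewrite mulrDl.
Qed.

Definition series_add al be s := al s + be s.
Definition series_1 s : B := if s is [::] then 1 else 0.

Lemma series_cat_addl al be ga :
  series_cat (series_add al be) ga =
  series_add (series_cat al ga) (series_cat be ga).
Proof.
apply/funext => s; rewrite /series_add !series_catE -split_sumD.
by apply: eq_split_sum => *; rewrite mulrDl.
Qed.

Lemma series_cat_addr al be ga :
  series_cat al (series_add be ga) =
  series_add (series_cat al be) (series_cat al ga).
Proof.
apply/funext => s; rewrite /series_add !series_catE -split_sumD.
by apply: eq_split_sum => *; rewrite mulrDr.
Qed.

Lemma series_cat_1l al : series_cat series_1 al = al.
Proof.
apply/funext => -[|c s]; rewrite series_catE ?split_sum_nil ?split_sum_cons mul1r //.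
by rewrite split_sum0 ?addr0 // => u v _; rewrite mul0r.
Qed.

Lemma series_cat_1r al : series_cat al series_1 = al.
Proof.
apply/funext => s; rewrite series_catE split_sum_last mulr1.
case: s => [|c s]; rewrite ?addr0 //.
by rewrite split_sum0 ?addr0 // => u [|d v] _; rewrite mulr0.
Qed.

Lemma series_cat_I_cons al c s : series_cat I al (c :: s) = c * al s.
Proof.
rewrite series_catE split_sum_cons mul0r add0r.
case: s => [|d s]; first by rewrite split_sum_nil.
rewrite split_sum_cons split_sum0 ?addr0 // => u v _.
by case: u => [|? ?]; rewrite mul0r.
Qed.

Lemma series_cat_I_nil al : series_cat I al [::] = 0.
Proof. by rewrite series_cat_nil mul0r. Qed.

Lemma series_cat_I_rcons al c s : series_cat al I (rcons s c) = al s * c.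
Proof.
rewrite series_catE split_sum_last mulr0 add0r.
case E: (rcons s c) => [|d t]; first by case: (s) E.
move: E; rewrite lastI => /rcons_inj[<- <-].
rewrite split_sum_last /= (_ : (if s is _ :: _ then _ else _) = 0) ?addr0 //.
case: s => // e s; rewrite split_sum0 // => u v _.
by case: v => [|? [|? ?]]; rewrite mulr0.
Qed.

Lemma split_sum_sum (r : seq nat) (F : nat -> seq B -> seq B -> B) s :
  \sum_(k <- r) split_sum (F k) s = split_sum (fun u v => \sum_(k <- r) F k u v) s.
Proof.
elim: r => [|k r IH].
  by rewrite big_nil split_sum0 // => u v _; rewrite big_nil.
rewrite big_cons IH -split_sumD.
by apply: eq_split_sum => u v _; rewrite big_cons.
Qed.

(** The terms of a composition with [k] parts. The bound [N] on the sizes of the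
    parts is a separate argument since it must stay the same while parts are
    removed. *)
Definition comp_parts (N k : nat) al be s :=
  \sum_(p : k.-tuple 'I_N.+1 |
           all (ltn 0) [seq val i | i <- p]
           && (sumn [seq val i | i <- p] == size s))
      al [seq be q | q <- reshape [seq val i | i <- p] s].

Lemma comp_parts0 N al be s :
  comp_parts N 0 al be s = if s is [::] then al [::] else 0.
Proof.
rewrite /comp_parts (eq_bigl (fun p : 0.-tuple 'I_N.+1 => s == [::] )).
  case: s => [|c s] /=; last by rewrite big_pred0.
  rewrite (eq_bigr (fun=> al [::])) ?sumr_const ?card_tuple ?expn0 ?mulr1n //.
  by move=> p _; rewrite tuple0.
by move=> p; rewrite tuple0 /=; case: s.
Qed.

Lemma comp_partsS N k al be s : (size s <= N)%N ->
  comp_parts N k.+1 al be s =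
  if s is c :: s' then
    split_sum (fun u v => comp_parts N k (fun t => al (be (c :: u) :: t)) be v) s'
  else 0.
Proof.
move=> sN.
transitivity (\sum_(j < N.+1 | (0 < j)%N && (j <= size s)%N)
    comp_parts N k (fun t => al (be (take j s) :: t)) be (drop j s)).
  rewrite /comp_parts pair_big_dep /=.
  rewrite (reindex (fun q : 'I_N.+1 * k.-tuple 'I_N.+1 => cons_tuple q.1 q.2)).
    apply: eq_bigl => -[j p] /=.
    rewrite size_drop -!andbA; case: (0 < j)%N => //=; rewrite andbCA.
    by case: (all _ _) => //=; rewrite ?andbF //; lia.
  exists (fun p : k.+1.-tuple 'I_N.+1 => (thead p, behead_tuple p)).
    by move=> [j p] _; congr (_, _) => /=; apply/val_inj.
  by move=> p _; rewrite [p in RHS]tuple_eta; apply/val_inj.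
rewrite -(big_mkord (fun j => (0 < j)%N && (j <= size s)%N)
  (fun j => comp_parts N k (fun t => al (be (take j s) :: t)) be (drop j s))).
case: s sN => [|c s] /= sN; first by rewrite big1 // => i; lia.
rewrite -split_sum_index (@big_cat_nat _ _ _ (size s).+2) //=.
rewrite [X in _ + X]big_nat_cond.
rewrite [X in _ + X]big_pred0 ?addr0; last by move=> i /=; lia.
rewrite big_ltn_cond //= big_add1 /= big_nat_cond [RHS]big_nat_cond.
by apply: eq_bigl => i; lia.
Qed.

Lemma comp_parts_big N k al be s : (size s <= N)%N -> (size s < k)%N ->
  comp_parts N k al be s = 0.
Proof.
elim: k al s => [//|k IH] al [|c s] sN sk; rewrite comp_partsS //.
by apply: split_sum0 => u v e; apply: IH; move: sN sk; rewrite e /= size_cat; lia.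
Qed.

Lemma comp_parts_bound N M k al be s : (size s <= N)%N -> (size s <= M)%N ->
  comp_parts N k al be s = comp_parts M k al be s.
Proof.
elim: k al s => [|k IH] al s sN sM; first by rewrite !comp_parts0.
rewrite !comp_partsS //; case: s sN sM => // c s sN sM.
apply: eq_split_sum => u v e; apply: IH; move: sN sM; rewrite e /= size_cat; lia.
Qed.

Lemma series_comp_parts N K al be s : (size s <= N)%N -> (size s < K)%N ->
  series_comp al be s = \sum_(0 <= k < K) comp_parts N k al be s.
Proof.
move=> sN sK; rewrite (@big_cat_nat _ _ _ (size s).+1) //=.
rewrite [X in _ + X]big_nat_cond [X in _ + X]big1 ?addr0; last first.
  by move=> i /andP[/andP[h _] _]; apply: comp_parts_big.
case: s sN sK => [|c s] sN sK; first by rewrite big_nat1 comp_parts0.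
rewrite big_ltn // comp_parts0 add0r /series_comp.
by apply: eq_bigr => k _; apply: comp_parts_bound.
Qed.

Lemma series_comp_nil al be : series_comp al be [::] = al [::].
Proof. by []. Qed.

(** Recursion on the first part [c :: u] of the composition; every later
    induction on compositions goes through it. *)
Lemma series_comp_cons al be c s :
  series_comp al be (c :: s) =
  split_sum (fun u v => series_comp (fun t => al (be (c :: u) :: t)) be v) s.
Proof.
have sN : (size (c :: s) <= (size s).+1)%N by [].
have sK : (size (c :: s) < (size s).+2)%N by [].
rewrite (series_comp_parts _ _ sN sK) big_ltn // comp_parts0 add0r big_add1 /=.
under eq_bigr do rewrite comp_partsS //.
rewrite split_sum_sum; apply: eq_split_sum => u v e.
by rewrite -series_comp_parts // e size_cat; lia.
Qed.

Lemma size_ind (P : seq B -> Prop) :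
  (forall s, (forall t, (size t < size s)%N -> P t) -> P s) -> forall s, P s.
Proof.
move=> H s; have [n sn] := ubnP (size s); elim: n s sn => // n IH s sn.
by apply: H => t ts; apply: IH; lia.
Qed.

Lemma series_comp_add al1 al2 ga s :
  series_comp (fun t => al1 t + al2 t) ga s =
    series_comp al1 ga s + series_comp al2 ga s.
Proof.
elim/size_ind: s al1 al2 => -[|d v] IHv f1 f2; first by rewrite !series_comp_nil.
rewrite !series_comp_cons -split_sumD; apply: eq_split_sum => x y e.
by apply: IHv; rewrite e /= size_cat; lia.
Qed.

(** Common core of the distributivity of composition over concatenation, where
    [f u v = al u * be v], and of its associativity, where [f u v] has [u] as the
    first part of an inner composition. *)
Lemma series_comp_split_sum (f : seq B -> seq B -> B) ga s :
  series_comp (split_sum f) ga s =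
  split_sum (fun u v => series_comp (fun t => series_comp (f t) ga v) ga u) s.
Proof.
elim/size_ind: s f => -[|c s] IH f; first by rewrite !(split_sum_nil, series_comp_nil).
rewrite series_comp_cons split_sum_cons series_comp_nil series_comp_cons.
under eq_split_sum => u v e.
  rewrite (_ : (fun t => _) = (fun t => f [::] (ga (c :: u) :: t) +
     split_sum (fun x y => f (ga (c :: u) :: x) y) t)); last first.
    by apply/funext => t; rewrite split_sum_cons.
  over.
under eq_split_sum => u v e do rewrite series_comp_add.
rewrite split_sumD; congr (_ + _).
under eq_split_sum => u v e do
  [rewrite IH; last by rewrite /= e size_cat; lia].
rewrite split_sum_assoc; apply: eq_split_sum => u v e.
by rewrite series_comp_cons.
Qed.

Lemma raddf_comp (h : B -> B) al ga s :
  h 0 = 0 -> {morph h : x y / x + y} ->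
  series_comp (fun t => h (al t)) ga s = h (series_comp al ga s).
Proof.
move=> h0 hD; elim/size_ind: s al => -[|d v] IHv al; first by rewrite !series_comp_nil.
rewrite !series_comp_cons raddf_split_sum //; apply: eq_split_sum => x y e.
by apply: IHv; rewrite e /= size_cat; lia.
Qed.

Lemma series_comp_cat al be ga :
  series_comp (series_cat al be) ga =
  series_cat (series_comp al ga) (series_comp be ga).
Proof.
apply/funext => s.
rewrite (_ : series_cat al be = split_sum (fun u v => al u * be v)); last first.
  by apply/funext => t; rewrite series_catE.
rewrite series_comp_split_sum series_catE; apply: eq_split_sum => u v _.
rewrite -(@raddf_comp ( *%R^~ _)) ?mul0r //; last first.
  by move=> x y; rewrite mulrDl.
congr (series_comp _ _ _); apply/funext => t.
by rewrite (@raddf_comp ( *%R _)) ?mulr0 // => x y; rewrite mulrDr.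
Qed.

Lemma series_comp0 ga s : series_comp (fun=> 0) ga s = 0.
Proof.
by rewrite (@raddf_comp (fun=> 0) (fun=> 0)) // => x y; rewrite addr0.
Qed.

Lemma eq_series_comp_nonempty al al' ga c s :
  (forall d t, al (d :: t) = al' (d :: t)) ->
  series_comp al ga (c :: s) = series_comp al' ga (c :: s).
Proof.
move=> e; rewrite !series_comp_cons; apply: eq_split_sum => u v _.
by congr (series_comp _ _ _); apply/funext => t.
Qed.

Lemma series_comp_I ga : ga [::] = 0 -> series_comp I ga = ga.
Proof.
move=> ga0; apply/funext => -[|c s]; first by rewrite series_comp_nil.
rewrite series_comp_cons split_sum_last series_comp_nil /=.
case: s => [|d s]; rewrite ?addr0 // split_sum0 ?addr0 // => u v _.
by case: v => [|e v]; rewrite series_comp_cons split_sum0 // => x y _; rewrite series_comp0.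
Qed.

Definition additive_series al := forall u c d v,
  al (u ++ (c + d) :: v) = al (u ++ c :: v) + al (u ++ d :: v).

(** The inner composition is expanded along its first part [u]. Additivity of
    [al] in its first argument is what allows the sum that makes up the value of
    [be] composed with [ga] to be taken out. *)
Lemma series_compA al be ga : additive_series al ->
  series_comp (series_comp al be) ga = series_comp al (series_comp be ga).
Proof.
move=> alD; apply/funext => s; elim/size_ind: s al alD => -[|c s] IH al alD //.
pose f u v := if u is [::] then (if v is [::] then al [::] else 0)
              else series_comp (fun t => al (be u :: t)) be v.
rewrite (_ : series_comp al be = split_sum f); last first.
  apply/funext => -[|d t]; first by rewrite series_comp_nil split_sum_nil.
  by rewrite series_comp_cons split_sum_cons /= add0r.
rewrite series_comp_split_sum split_sum_cons series_comp_nil (@eq_series_comp_nonempty _ (fun=> 0)) //.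
rewrite series_comp0 add0r series_comp_cons; apply: eq_split_sum => u v e.
pose h x := series_comp (fun t => al (x :: t)) (series_comp be ga) v.
have alxD x : additive_series (fun t => al (x :: t)).
  by move=> w y z w'; rewrite -!cat_cons alD.
have hD : {morph h : x y / x + y}.
  move=> x y; rewrite /h -series_comp_add; congr (series_comp _ _ _).
  by apply/funext => t; apply: (alD [::]).
have h0 : h 0 = 0 by apply: (addrI (h 0)); rewrite -hD !addr0.
rewrite -[RHS]/(h _) -(raddf_comp _ _ _ h0 hD).
apply: eq_series_comp_nonempty => d t; rewrite /= IH //.
by rewrite e /= size_cat; lia.
Qed.

Lemma series_comp_cat_cons al be rho c s :
  series_cat (series_comp al be) rho (c :: s) =
  al [::] * rho (c :: s) +
  split_sum (fun u v =>
    series_cat (series_comp (fun t => al (be (c :: u) :: t)) be) rho v) s.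
Proof.
rewrite series_catE split_sum_cons series_comp_nil; congr (_ + _).
under [RHS]eq_split_sum => u v _ do rewrite series_catE.
rewrite split_sum_assoc; apply: eq_split_sum => u v _.
rewrite series_comp_cons (@raddf_split_sum _ _ _ ( *%R^~ (rho v))) ?mul0r //.
by move=> x y; rewrite mulrDl.
Qed.

Definition eq_upto (n : nat) al be := forall s, (size s < n)%N -> al s = be s.

Lemma eq_upto_cat n al al' be be' :
  eq_upto n al al' -> eq_upto n be be' ->
  eq_upto n (series_cat al be) (series_cat al' be').
Proof.
move=> ea eb s sn; rewrite !series_catE; apply: eq_split_sum => u v e.
by rewrite ea ?eb //; move: sn; rewrite e size_cat; lia.
Qed.

Lemma eq_upto_I_cat n be be' :
  eq_upto n be be' -> eq_upto n.+1 (series_cat I be) (series_cat I be').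
Proof.
by move=> eb [|c s] sn; rewrite ?series_cat_I_nil // !series_cat_I_cons eb.
Qed.

Lemma series_cat_I_nil_r al : series_cat al I [::] = 0.
Proof. by rewrite series_cat_nil mulr0. Qed.

Lemma eq_upto_cat_I n be be' :
  eq_upto n be be' -> eq_upto n.+1 (series_cat be I) (series_cat be' I).
Proof.
move=> eb; case/lastP=> [|s c] sn; rewrite ?series_cat_I_nil_r // !series_cat_I_rcons eb //.
by move: sn; rewrite size_rcons.
Qed.

Lemma eq_upto_comp n al be be' :
  eq_upto n be be' -> eq_upto n (series_comp al be) (series_comp al be').
Proof.
move=> eb s; elim/size_ind: s al => -[|c s] IH al // sn.
rewrite !series_comp_cons; apply: eq_split_sum => u v e.
move: sn; rewrite e /= size_cat => sn; rewrite IH ?eb ?e //= ?size_cat; lia.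
Qed.

Lemma eq_upto_add n al al' be be' :
  eq_upto n al al' -> eq_upto n be be' ->
  eq_upto n (series_add al be) (series_add al' be').
Proof. by move=> ea eb s sn; rewrite /series_add ea ?eb. Qed.

Lemma eq_upto_comp_l n al al' be :
  eq_upto n al al' -> eq_upto n (series_comp al be) (series_comp al' be).
Proof.
move=> e s sn; elim/size_ind: s n al al' e sn => -[|c s] IH n al al' e sn.
  exact: e.
rewrite !series_comp_cons; apply: eq_split_sum => u v es.
move: sn; rewrite es /= size_cat => sn.
apply: (IH _ _ (size v).+1) => //; first by rewrite es /= size_cat; lia.
by move=> t tv; apply: e; rewrite /=; lia.
Qed.

(** At the first order where two series may differ, composition with a series
    that starts with [I] does not change their difference: all other terms
    involve lower orders only. *)
Lemma eq_upto_comp_top n al al' be s :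
  (forall c, be [:: c] = c) -> size s = n -> eq_upto n al al' ->
  al s - al' s = series_comp al be s - series_comp al' be s.
Proof.
move=> be1; elim: s n al al' => [|c s IH] n al al' <- e; first by [].
rewrite !series_comp_cons; case: s IH e => [|d s] IH e.
  by rewrite !split_sum_nil !series_comp_nil be1.
rewrite !split_sum_cons be1.
rewrite (@eq_split_sum _ _ _
  (fun u v => series_comp (fun t => al' (be (c :: d :: u) :: t)) be v) s).
  rewrite opprD addrACA subrr addr0; apply: (IH (size s).+1) => // t ts.
  by apply: e; rewrite /=; lia.
move=> u v e'; apply: (@eq_upto_comp_l (size v).+1) => // t tv.
by apply: e; move: tv; rewrite e' /= size_cat; lia.
Qed.

Lemma series_comp_cat_inj al al' be rho :
  (forall c, be [:: c] = c) -> rho [::] = 1 ->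
  series_cat (series_comp al be) rho = series_cat (series_comp al' be) rho ->
  al = al'.
Proof.
move=> be1 rho1 E; suff H n : eq_upto n al al'.
  by apply/funext => s; apply: (H (size s).+1).
elim: n => // n IH s; rewrite ltnS leq_eqVlt => /orP[/eqP sn|]; last exact: IH.
apply/eqP; rewrite -subr_eq0; rewrite (eq_upto_comp_top be1 sn IH) subr_eq0.
have := congr1 (fun f => f s) E; rewrite !series_catE !split_sum_last rho1 !mulr1.
case: s sn => [|c s] sn; first by move/addIr/eqP.
rewrite (@eq_split_sum _ _ _ (fun u v => series_comp al' be u *
  rho (rcons v (last c s))) (belast c s)); first by move/addIr->.
move=> u v e /=; congr (_ * _); apply: (@eq_upto_comp_l n) => //.
by rewrite -sn /= -(size_belast c s) e size_cat ltnS leq_addr.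
Qed.

(** The equations for [P], [Q], [N] determine each order by the lower ones, and
    [X Y D'], [Y D'], [D X] satisfy them. For [N] this uses
    [D = 1 + X Y I D], which follows from [P = X Y D'] and [D' I = I D]. *)
Theorem free_product_series Ka Kb Kab V W P Q N :
  let D := series_add series_1 (series_cat P I) in
  let D' := series_add series_1 (series_cat I P) in
  additive_series Ka -> additive_series Kb ->
  V = series_comp Ka (series_cat W I) ->
  W = series_comp Kb (series_cat I V) ->
  P = series_cat (series_comp Ka (series_cat Q I)) Q ->
  Q = series_cat (series_comp Kb (series_cat I N)) D' ->
  N = series_cat (series_comp Ka (series_cat Q I))
        (series_add series_1
           (series_cat (series_comp Kb (series_cat I N)) (series_cat I N))) ->
  P = series_cat (series_comp Kab (series_cat I D)) D' ->
  Kab = series_cat V W.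
Proof.
move=> D D' KaD KbD eV eW eP eQ eN eK.
have ID : series_cat D' I = series_cat I D.
  by rewrite /D /D' series_cat_addl series_cat_addr series_cat_1l series_cat_1r series_catA.
have ID0 : series_cat I D [::] = 0 by rewrite series_cat_I_nil.
pose X := series_comp V (series_cat I D).
pose Y := series_comp W (series_cat I D).
have eX : X = series_comp Ka (series_cat Y (series_cat I D)).
  by rewrite /X {1}eV series_compA // series_comp_cat series_comp_I.
have eY : Y = series_comp Kb (series_cat (series_cat I D) X).
  by rewrite /Y {1}eW series_compA // series_comp_cat series_comp_I.
have key n : [/\ eq_upto n Q (series_cat Y D'),
                 eq_upto n P (series_cat X (series_cat Y D')) &
                 eq_upto n N (series_cat D X)].
  elim: n => [//|n [IHQ IHP IHN]].
  have IN : eq_upto n.+1 (series_cat I N) (series_cat (series_cat I D) X).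
    by rewrite -series_catA; apply: eq_upto_I_cat.
  have KIN : eq_upto n.+1 (series_comp Kb (series_cat I N)) Y.
    by rewrite eY; apply: eq_upto_comp.
  have HQ : eq_upto n.+1 Q (series_cat Y D').
    by rewrite eQ; apply: eq_upto_cat.
  have KQI : eq_upto n.+1 (series_comp Ka (series_cat Q I)) X.
    rewrite eX -ID series_catA; apply: eq_upto_comp.
    by apply: eq_upto_cat_I; apply: IHQ.
  have HP : eq_upto n.+1 P (series_cat X (series_cat Y D')).
    by rewrite eP; apply: eq_upto_cat.
  split=> //.
  have HD : eq_upto n.+1 D
      (series_add series_1 (series_cat X (series_cat Y (series_cat I D)))).
    rewrite -ID !series_catA -(series_catA X) -/D; apply: eq_upto_add => //.
    exact: eq_upto_cat_I.
  have DX : eq_upto n.+1 (series_cat D X) (series_cat X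
      (series_add series_1 (series_cat Y (series_cat (series_cat I D) X)))).
    rewrite series_cat_addr series_cat_1r [series_cat Y _]series_catA [series_cat X (series_cat _ X)]series_catA.
    rewrite -[X in series_add X]series_cat_1l -series_cat_addl.
    exact: eq_upto_cat.
  move=> s sn; rewrite DX // eN; move: s sn.
  apply: eq_upto_cat => //; apply: eq_upto_add => //.
  exact: eq_upto_cat.
have PE : P = series_cat X (series_cat Y D').
  by apply/funext => s; have [_ h _] := key (size s).+1; apply: h.
apply: (@series_comp_cat_inj _ _ (series_cat I D) D').
- by move=> c; rewrite series_cat_I_cons /D /series_add /= series_cat_I_nil_r addr0 mulr1.
- by rewrite /D' /series_add /= series_cat_I_nil addr0.
- by rewrite -eK series_comp_cat -series_catA.
Qed.

End Series.

(** * The stack machine *)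

Section Sweep.
Variables (B : nzRingType) (X : Type) (act : X -> B -> X).

(** An open block: its last letter, and the earlier ones in reverse order. The
    last letter is the only one which can still be multiplied by a scalar. *)
Definition block := (X * seq X)%type.
Definition item := (B + X)%type.
(** The value of what remains to be read, as a function of the stack of open
    blocks and of whether the previous letter closed its block. *)
Definition state_fun := seq block -> bool -> B.

Implicit Types (G H : state_fun) (st : seq block) (w : seq item).

(** A scalar multiplies the last letter of the innermost open block on the right.
    If no block is open, it can be taken out on the left of the value of the
    rest. *)
Definition give (c : B) G : state_fun := fun st p =>
  if st is (x, b) :: st' then G ((act x c, b) :: st') p else c * G [::] p.

(* [allow p f]: may a letter open a block (if f) or join one (if not f) when the
   previous letter closed its block (if p) or kept it open (if not p)? *)
Variables (kap : seq X -> B) (allow : bool -> bool -> bool).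

(** The two fates of a block after it received a letter: it stays open, or it
    closes and its cumulant becomes a scalar. *)
Definition settle (b : block) G st : B :=
  G (b :: st) false + give (kap (rev (b.1 :: b.2))) G st true.

Definition join (x : X) G st : B :=
  if st is (y, b) :: st' then settle (x, y :: b) G st' else 0.

Definition step (i : item) G : state_fun := fun st p =>
  match i with
  | inl c => give c G st p
  | inr x => (if allow p true then settle (x, [::]) G st else 0)
             + (if allow p false then join x G st else 0)
  end.

(** The end of the word counts as a letter which does not open a block. *)
Definition final : state_fun := fun st p =>
  if st is [::] then (allow p false)%:R else 0.

Definition sweep G w : state_fun := foldr step G w.

Lemma sweep_cons G i w : sweep G (i :: w) = step i (sweep G w).
Proof. by []. Qed.

Lemma sweep_cat G u w : sweep G (u ++ w) = sweep (sweep G w) u.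
Proof. exact: foldr_cat. Qed.

(** The stacks [st], [st1], [st2] agree except for one letter, which was
    multiplied by [c + d], [c] and [d] respectively. *)
Definition sum_stack st st1 st2 := exists s1 s2 b b1 b2 u v z c d,
  [/\ st = s1 ++ b :: s2, st1 = s1 ++ b1 :: s2 & st2 = s1 ++ b2 :: s2] /\
  [/\ b.1 :: b.2 = u ++ act z (c + d) :: v,
      b1.1 :: b1.2 = u ++ act z c :: v & b2.1 :: b2.2 = u ++ act z d :: v].

Definition additive_fun G := forall st st1 st2 p,
  sum_stack st st1 st2 -> G st p = G st1 p + G st2 p.

Hypothesis actA : forall x c d, act (act x c) d = act x (c * d).
Hypothesis act1 : forall x, act x 1 = x.
Hypothesis kapD : forall u v z c d,
  kap (u ++ act z (c + d) :: v) = kap (u ++ act z c :: v) + kap (u ++ act z d :: v).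

Lemma sum_stack_head z b c d st :
  sum_stack ((act z (c + d), b) :: st) ((act z c, b) :: st) ((act z d, b) :: st).
Proof.
exists [::], st, (act z (c + d), b), (act z c, b), (act z d, b).
by exists [::], b, z, c, d.
Qed.

Lemma sum_stack_cons b st st1 st2 :
  sum_stack st st1 st2 -> sum_stack (b :: st) (b :: st1) (b :: st2).
Proof.
move=> [s1 [s2 [b0 [b1 [b2 [u [v [z [c [d [[-> -> ->] h]]]]]]]]]]].
by exists (b :: s1), s2, b0, b1, b2, u, v, z, c, d.
Qed.

Lemma sum_stack_inv st st1 st2 : sum_stack st st1 st2 ->
  (exists b b1 b2 s u v z c d,
    [/\ st = b :: s, st1 = b1 :: s & st2 = b2 :: s] /\
    [/\ b.1 :: b.2 = u ++ act z (c + d) :: v,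
      b1.1 :: b1.2 = u ++ act z c :: v & b2.1 :: b2.2 = u ++ act z d :: v])
  \/ (exists b s s1 s2, [/\ st = b :: s, st1 = b :: s1 & st2 = b :: s2] /\
       sum_stack s s1 s2).
Proof.
move=> [s1 [s2 [b0 [b1 [b2 [u [v [z [c [d [[-> -> ->] h]]]]]]]]]]].
case: s1 => [|b s1]; first by left; exists b0, b1, b2, s2, u, v, z, c, d.
right; exists b, (s1 ++ b0 :: s2), (s1 ++ b1 :: s2), (s1 ++ b2 :: s2); split=> //.
by exists s1, s2, b0, b1, b2, u, v, z, c, d.
Qed.

Lemma sum_stack_act x1 b1 x2 b2 x3 b3 u v z c d e st :
  x1 :: b1 = u ++ act z (c + d) :: v -> x2 :: b2 = u ++ act z c :: v ->
  x3 :: b3 = u ++ act z d :: v ->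
  sum_stack ((act x1 e, b1) :: st) ((act x2 e, b2) :: st) ((act x3 e, b3) :: st).
Proof.
case: u => [|y u] /= [-> ->] [-> ->] [-> ->].
  by rewrite !actA mulrDl; apply: sum_stack_head.
set b := u ++ _; set b' := u ++ _; set b'' := u ++ _.
exists [::], st, (act y e, b), (act y e, b'), (act y e, b'').
by exists (act y e :: u), v, z, c, d.
Qed.

Lemma giveDl c d G st p : additive_fun G ->
  give (c + d) G st p = give c G st p + give d G st p.
Proof.
move=> GD; case: st => [|[x b] st] /=; first by rewrite mulrDl.
by apply: GD; apply: sum_stack_head.
Qed.

Lemma give0 G st p : additive_fun G -> give 0 G st p = 0.
Proof.
by move=> GD; apply: (addrI (give 0 G st p)); rewrite -giveDl // !addr0.
Qed.

Lemma give_additive c G : additive_fun G -> additive_fun (give c G).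
Proof.
move=> GD st st1 st2 p /sum_stack_inv[]; last first.
  move=> [[x b] [s [s1 [s2 [[-> -> ->] h]]]]]; apply: GD; exact: sum_stack_cons.
move=> [[x b] [[x1 b1] [[x2 b2] [s [u [v [z [c1 [d1 [[-> -> ->] [/= h h1 h2]]]]]]]]]]].
by apply: GD; apply: sum_stack_act h h1 h2.
Qed.

Lemma settle_additive G b st st1 st2 : additive_fun G ->
  sum_stack st st1 st2 -> settle b G st = settle b G st1 + settle b G st2.
Proof.
move=> GD h; rewrite /settle (GD _ _ _ _ (sum_stack_cons b h)).
by rewrite (give_additive _ GD _ h) addrACA.
Qed.

Lemma settle_additive_block G b b1 b2 u v z c d st : additive_fun G ->
  b.1 :: b.2 = u ++ act z (c + d) :: v ->
  b1.1 :: b1.2 = u ++ act z c :: v -> b2.1 :: b2.2 = u ++ act z d :: v ->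
  settle b G st = settle b1 G st + settle b2 G st.
Proof.
move=> GD h h1 h2; rewrite /settle (GD (b :: st) (b1 :: st) (b2 :: st)).
  rewrite h h1 h2 !rev_cat !rev_cons !cat_rcons kapD giveDl //.
  by rewrite addrACA.
by exists [::], st, b, b1, b2, u, v, z, c, d.
Qed.

Lemma join_additive x G st st1 st2 : additive_fun G ->
  sum_stack st st1 st2 -> join x G st = join x G st1 + join x G st2.
Proof.
move=> GD /sum_stack_inv[]; last first.
  move=> [[y b] [s [s1 [s2 [[-> -> ->] h]]]]]; exact: settle_additive.
move=> [[y b] [[y1 b1] [[y2 b2] [s [u [v [z [c1 [d1 [[-> -> ->] [/= h h1 h2]]]]]]]]]]].
by apply: (@settle_additive_block _ _ _ _ (x :: u) v z c1 d1) => //=; congr (_ :: _).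
Qed.

Lemma step_additive i G : additive_fun G -> additive_fun (step i G).
Proof.
case: i => [c|x] GD st st1 st2 p h /=; first exact: give_additive.
case: (allow p true); case: (allow p false); rewrite ?addr0 ?add0r //.
- by rewrite (settle_additive _ GD h) (join_additive _ GD h) addrACA.
- exact: settle_additive.
- exact: join_additive.
Qed.

Lemma sweep_additive G w : additive_fun G -> additive_fun (sweep G w).
Proof. by move=> GD; elim: w => [//|i w IH]; apply: step_additive. Qed.

Lemma final_additive : additive_fun final.
Proof.
move=> st st1 st2 p /sum_stack_inv[].
  by move=> [b [b1 [b2 [s [u [v [z [c1 [d1 [[-> -> ->] _]]]]]]]]]]; rewrite addr0.
by move=> [b [s [s1 [s2 [[-> -> ->] h]]]]]; rewrite addr0.
Qed.

Notation sw := (sweep final).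

Lemma sweep_final_additive w : additive_fun (sw w).
Proof. exact: sweep_additive final_additive. Qed.
Hint Resolve sweep_final_additive : core.

Section SplitAt.
Variable V : nmodType.
(** The sum of [h u i v] over all the ways to write [w = u ++ i :: v]. *)
Fixpoint split_at (h : seq item -> item -> seq item -> V) w : V :=
  if w is i :: w' then h [::] i w' + split_at (fun u j v => h (i :: u) j v) w'
  else 0.

Lemma split_at_cat h u w :
  split_at h (u ++ w) = split_at (fun x i y => h x i (y ++ w)) u +
                        split_at (fun x i y => h (u ++ x) i y) w.
Proof.
elim: u h => [|i u IH] h /=; first by rewrite add0r.
by rewrite IH addrA.
Qed.

Lemma eq_split_at h h' w : (forall u i v, w = u ++ i :: v -> h u i v = h' u i v) ->
  split_at h w = split_at h' w.
Proof.
elim: w h h' => [//|i w IH] h h' e /=; congr (_ + _); first exact: e.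
by apply: IH => u j v ew; apply: e; rewrite ew.
Qed.

Lemma split_atD h h' w :
  split_at (fun u i v => h u i v + h' u i v) w = split_at h w + split_at h' w.
Proof.
by elim: w h h' => [|i w IH] h h' /=; rewrite ?addr0 // IH addrACA.
Qed.

Lemma split_at0 h w : (forall u i v, w = u ++ i :: v -> h u i v = 0) ->
  split_at h w = 0.
Proof.
elim: w h => [//|i w IH] h e /=; rewrite (e [::] i w) // add0r.
by apply: IH => u j v ew; apply: e; rewrite ew.
Qed.
End SplitAt.

Definition join_item (i : item) G : state_fun := fun st _ =>
  if i is inr x then join x G st else 0.

Lemma join_item_additive i G : additive_fun G -> additive_fun (join_item i G).
Proof.
case: i => [c|x] GD st st1 st2 p h /=; first by rewrite addr0.
exact: join_additive.
Qed.

(** Locality. Let [i] be the next letter of the bottom block. The letters before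
    [i] close all the blocks above the bottom one and do not touch it, so they
    are read as if it were absent, and their total value multiplies its last
    letter. The rule [allow] is respected on both sides: the letter [i] joins, as
    the end of a word does. *)
Lemma sweep_final_bottom w st b p :
  sw w (rcons st b) p =
  split_at (fun u i v =>
    give (sw u st p) (join_item i (sw v)) [:: b] false) w.
Proof.
have GD v i : additive_fun (join_item i (sw v)) by apply: join_item_additive.
elim: w st b p => [|i w IH] st b p; first by case: st.
case: i => [c|x].
  rewrite /= [X in _ = X + _](_ : _ = 0); last first.
    by case: (b).
  rewrite add0r; case: st => [|[y b'] st] /=; last by rewrite -rcons_cons IH.
  case: b => [y b]; rewrite -[[:: _]]/(rcons [::] (act y c, b)) IH.
  by apply: eq_split_at => u i v _ /=; rewrite actA.
rewrite /= -/(sw w).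
have splitD F1 F2 : split_at (fun u j v =>
     give (F1 u + F2 u) (join_item j (sw v)) [:: b] false) w =
   split_at (fun u j v => give (F1 u) (join_item j (sw v)) [:: b] false) w +
   split_at (fun u j v => give (F2 u) (join_item j (sw v)) [:: b] false) w.
  by rewrite -split_atD; apply: eq_split_at => u j v _; rewrite giveDl.
have split0 : split_at (fun u j v =>
     give 0 (join_item j (sw v)) [:: b] false) w = 0.
  by apply: split_at0 => u j v _; rewrite give0.
have settleE st' b' : settle b' (sw w) (rcons st' b) =
  split_at (fun u j v =>
    give (settle b' (sw u) st') (join_item j (sw v)) [:: b] false) w.
  rewrite /settle splitD -rcons_cons IH; congr (_ + _).
  case: st' => [|[y c] st'] /=; last by rewrite -rcons_cons IH.
  case: b {splitD split0} => [y b]; rewrite -[[:: _]]/(rcons [::] (_, b)) IH.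
  by apply: eq_split_at => u i v _ /=; rewrite actA.
have splitif (q : bool) F : split_at (fun u j v =>
     give (if q then F u else 0) (join_item j (sw v)) [:: b] false) w =
     if q then split_at (fun u j v =>
       give (F u) (join_item j (sw v)) [:: b] false) w else 0.
  by case: q.
rewrite splitD !splitif.
case: st => [|[y b'] st] /=.
  rewrite -[[:: b]]/(rcons [::] b) settleE addrCA; congr (_ + _).
  rewrite split0 if_same addr0; case: b {splitD split0 settleE splitif} => y b.
  case: (allow p false); first by rewrite /= act1.
  by symmetry; apply: (give0 [:: (y, b)] false (GD w (inr x))).
rewrite -rcons_cons !settleE [X in _ = X + _](give0 [:: b] false (GD w (inr x))).
by rewrite add0r; congr (_ + _).
Qed.

(** A block alone on the stack either closes at once, or waits for its next
    letter. *)
Lemma settle_bottom b w :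
  settle b (sw w) [::] =
  kap (rev (b.1 :: b.2)) * sw w [::] true +
  split_at (fun u i v => join_item i (sw v)
    [:: (act b.1 (sw u [::] false), b.2)] false) w.
Proof.
rewrite /settle addrC /=; congr (_ + _).
by rewrite -[[:: b]]/(rcons [::] b) sweep_final_bottom; case: b.
Qed.

Lemma sweep_rcons_scalar w c st p : sw (rcons w (inl c)) st p = sw w st p * c.
Proof.
elim: w st p => [|i w IH] st p.
  by case: st => [|[y b] st] /=; rewrite ?mul0r // commr_nat.
rewrite rcons_cons !sweep_cons.
have giveE k st' q : give k (sw (rcons w (inl c))) st' q =
    give k (sw w) st' q * c.
  by case: st' => [|[y b] st'] /=; rewrite IH ?mulrA.
have settleE b st' : settle b (sw (rcons w (inl c))) st' =
    settle b (sw w) st' * c.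
  by rewrite /settle IH giveE mulrDl.
case: i => [k|x] /=; first exact: giveE.
rewrite mulrDl settleE; congr (_ + _); first by case: ifP; rewrite ?mul0r.
case: ifP; rewrite ?mul0r // => _.
by case: st => [|[y b] st] /=; rewrite ?mul0r.
Qed.

Lemma give_give c d G st p : give c (give d G) st p = give (c * d) G st p.
Proof. by case: st => [|[y b] st] /=; rewrite ?mulrA ?actA. Qed.

Lemma give1 G st p : give 1 G st p = G st p.
Proof. by case: st => [|[y b] st] /=; rewrite ?mul1r ?act1. Qed.

Section Absorb.
Hypothesis kap_act : forall u x c, kap (rcons u (act x c)) = kap (rcons u x) * c.

Lemma settle_give x b c G st :
  settle (x, b) (give c G) st = settle (act x c, b) G st.
Proof.
by rewrite /settle /=; congr (_ + _); rewrite give_give !rev_cons kap_act.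
Qed.

(** A scalar after a letter may be absorbed by it: if the block of this letter
    stays open this is what [give] does, and if it closes this is the right
    linearity of the cumulant. *)
Lemma step_absorb x c G :
  step (inr x) (give c G) = step (inr (act x c)) G.
Proof.
apply/funext => st; apply/funext => p /=; rewrite settle_give.
congr (_ + _); congr (if _ then _ else _).
by case: st => [|[y b] st] //=; rewrite settle_give.
Qed.
End Absorb.

Section Colours.
Variables (K : eqType) (col : X -> K).
Hypothesis col_act : forall x c, col (act x c) = col x.
Hypothesis kap_mixed : forall s, ~~ constant (map col s) -> kap s = 0.

Definition mixed (b : block) := ~~ constant [seq col x | x <- b.1 :: b.2].

Definition dead G := forall st p, has mixed st -> G st p = 0.

Lemma constant_rev (L : eqType) (s : seq L) : constant (rev s) = constant s.
Proof.
have H (t : seq L) : constant t -> constant (rev t).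
  case: t => // x t /= /all_pred1P ->.
  by rewrite -[x :: _]/(nseq (size t).+1 x) rev_nseq constant_nseq.
by apply/idP/idP; [move/H; rewrite revK | exact: H].
Qed.

Lemma kap_rev_mixed b : mixed b -> kap (rev (b.1 :: b.2)) = 0.
Proof. by move=> bM; apply: kap_mixed; rewrite map_rev constant_rev. Qed.

Lemma give_dead c G : dead G -> dead (give c G).
Proof.
move=> Gd [|[y b] st] p //= h; apply: Gd; move: h.
by rewrite /= /mixed /= col_act.
Qed.

Lemma settle_dead b G st : additive_fun G -> dead G -> has mixed (b :: st) ->
  settle b G st = 0.
Proof.
move=> GD Gd /= h; rewrite /settle Gd // add0r.
by case/orP: h => h; [rewrite kap_rev_mixed // give0 | rewrite give_dead].
Qed.

Lemma mixed_cons x y b : mixed (y, b) -> mixed (x, y :: b).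
Proof.
by apply: contra => /= /andP[/eqP->].
Qed.

Lemma join_dead x G st : additive_fun G -> dead G -> has mixed st ->
  join x G st = 0.
Proof.
case: st => [//|[y b] st] GD Gd /= h; apply: settle_dead => //=.
by case/orP: h => [/mixed_cons->//|->]; rewrite orbT.
Qed.

Lemma step_dead i G : additive_fun G -> dead G -> dead (step i G).
Proof.
case: i => [c|x] GD Gd st p h /=; first exact: give_dead.
by rewrite settle_dead ?join_dead //= ?h ?orbT // !if_same addr0.
Qed.

(** A block with letters of two colours makes the value zero: it keeps its
    colours until it closes, and then its cumulant vanishes. *)
Lemma sweep_final_dead w : dead (sw w).
Proof.
elim: w => [|i w IH]; last by apply: step_dead.
by move=> [].
Qed.

End Colours.
End Sweep.
Arguments final {B X} allow _ _ /.

(** * The first block of a periodic word *)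

Section BlockSeries.
Variables (C : numClosedFieldType) (B : algType C).
Variables (X : Type) (act : X -> B -> X) (kap : seq X -> B).
Variable allow : bool -> bool -> bool.
Hypothesis actA : forall x c d, act (act x c) d = act x (c * d).
Hypothesis act1 : forall x, act x 1 = x.
Hypothesis kapD : forall u v z c d,
  kap (u ++ act z (c + d) :: v) = kap (u ++ act z c :: v) + kap (u ++ act z d :: v).

Notation sw := (sweep act kap allow (final allow)).

Variables (x : X) (pre : B -> seq (item B X)) (tau : seq (item B X)).

(** What follows a first letter [x]: the gaps [pre c], each ended by [x], and a
    tail. *)
Definition periodic s := flatten [seq rcons (pre c) (inr x) | c <- s] ++ tau.
(** The part of [periodic t] between the first letter and its last occurrence of
    [x]: the word between two successive letters of a block. *)
Definition gap_word t :=
  if t is c :: u then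
    flatten [seq rcons (pre d) (inr x) | d <- belast c u] ++ pre (last c u)
  else [::].

(* The block of [x] cannot continue inside a gap or inside the tail. *)
Hypothesis pre_skip : forall c u i v, pre c = u ++ i :: v ->
  forall w e b, join_item act kap i (sw w) [:: (act x e, b)] false = 0.
Hypothesis tau_skip : forall u i v, tau = u ++ i :: v ->
  forall w e b, join_item act kap i (sw w) [:: (act x e, b)] false = 0.

Lemma split_at_periodic (h : seq (item B X) -> item B X -> seq (item B X) -> B) s :
  (forall c u i v, pre c = u ++ i :: v -> forall u' v', h u' i v' = 0) ->
  (forall u i v, tau = u ++ i :: v -> forall u' v', h u' i v' = 0) ->
  split_at h (periodic s) =
  if s is c :: s' then
    split_sum (fun u v => h (gap_word (c :: u)) (inr x) (periodic v)) s'
  else 0.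
Proof.
move=> hpre htau; elim: s h hpre htau => [|c s IH] h hpre htau.
  by rewrite /periodic /= split_at0 // => u i v /htau.
rewrite /periodic /= -catA split_at_cat -cats1 split_at_cat /= addr0 cats0.
rewrite split_at0 ?add0r; last by move=> u i v /hpre.
rewrite -/(periodic s) IH; last 2 first.
- by move=> d u i v /hpre.
- by move=> u i v /htau.
case: s {IH} => [|d s]; first (rewrite addr0 split_sum_nil; reflexivity).
rewrite split_sum_cons; congr (_ + _); apply: eq_split_sum => u v _.
by rewrite /periodic cats1 /= -catA.
Qed.

(** The next letter of the first block is some later [x], which cuts the word into
    a gap and a shorter periodic word. Iterating, the choice of all the letters of
    this block is the choice of the parts in a composition of series, followed by
    the part of the word that comes after the block. *)
Lemma periodic_series b0 s :
  settle act kap (x, b0) (sw (periodic s)) [::] =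
  series_cat
    (series_comp (fun t => kap (rev b0 ++ rcons [seq act x c | c <- t] x))
       (fun t => sw (gap_word t) [::] false))
    (fun t => sw (periodic t) [::] true) s.
Proof.
elim/size_ind: s b0 => s IH b0.
rewrite settle_bottom // split_at_periodic; last 2 first.
- by move=> c u i v e u' v'; apply: pre_skip e _ _ _.
- by move=> u i v e u' v'; apply: tau_skip e _ _ _.
case: s IH => [|c s] IH.
  by rewrite addr0 series_cat_nil series_comp_nil /= rev_cons cats1.
rewrite series_comp_cat_cons /= rev_cons cats1; congr (_ + _).
apply: eq_split_sum => u v e; rewrite IH; last by rewrite /= e size_cat; lia.
congr (series_cat (series_comp _ _) _ _); apply/funext => t.
by rewrite rev_cons cat_rcons.
Qed.

End BlockSeries.

(** * Functional equations for alternating words *)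

(** With no restriction the machine runs through all non-crossing partitions. *)
Definition allow_full (p f : bool) := true.
(** The rule of a partition interleaved with its Kreweras complement: a letter
    opens a block exactly when the previous one did not close its own. *)
Definition allow_alt (p f : bool) := p != f.

Section Words.
Variables (C : numClosedFieldType) (B : algType C).

Lemma eq_series_comp (al be be' : seq B -> B) :
  (forall c s, be (c :: s) = be' (c :: s)) -> series_comp al be = series_comp al be'.
Proof.
move=> e; apply/funext => s; elim/size_ind: s al => -[|c s] IH al //.
rewrite !series_comp_cons; apply: eq_split_sum => u v es.
by rewrite e IH // es /= size_cat; lia.
Qed.

Lemma series_cat_rcons (al be : seq B -> B) s c : be [::] = 0 ->
  series_cat al be (rcons s c) = series_cat al (fun t => be (rcons t c)) s.
Proof.
move=> b0; rewrite !series_catE split_sum_last b0 mulr0 add0r.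
case E: (rcons s c) => [|d t]; first by case: (s) E.
by move: E; rewrite lastI => /rcons_inj[-> ->].
Qed.

Lemma sweep_scalar (X : Type) (act : X -> B -> X) kap allow c w p :
  sweep act kap allow (final allow) (inl c :: w) [::] p =
  c * sweep act kap allow (final allow) w [::] p.
Proof. by []. Qed.

Lemma sweep_full_prev (X : Type) (act : X -> B -> X) kap w st p q :
  sweep act kap allow_full (final allow_full) w st p =
  sweep act kap allow_full (final allow_full) w st q.
Proof.
elim: w st => [|[c|x] w IH] st //; rewrite !sweep_cons /=.
by case: st => [|[y b] st] /=; rewrite IH.
Qed.

Section Free.
(** The pair [(t, c)] stands for [a c] if [t] holds and for [b c] otherwise. *)
Definition letter := (bool * B)%type.
Definition actl (x : letter) c : letter := (x.1, x.2 * c).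
Variable kap : seq letter -> B.
Hypothesis kapD : forall u v z c d,
  kap (u ++ actl z (c + d) :: v) =
  kap (u ++ actl z c :: v) + kap (u ++ actl z d :: v).
Hypothesis kap_mixed : forall s, ~~ constant (map fst s) -> kap s = 0.

Lemma actlA x c d : actl (actl x c) d = actl x (c * d).
Proof. by rewrite /actl mulrA. Qed.
Lemma actl1 x : actl x 1 = x.
Proof. by case: x => t d; rewrite /actl mulr1. Qed.

Definition la : letter := (true, 1).
Definition lb : letter := (false, 1).
Definition wa s : seq (item B letter) :=
  flatten [seq [:: inr lb; inl c; inr la] | c <- s].
Definition wb s : seq (item B letter) :=
  flatten [seq [:: inl c; inr la; inr lb] | c <- s].

Lemma wa_wb s : wa s ++ [:: inr lb] = inr lb :: wb s.
Proof. by elim: s => //= c s ->. Qed.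

Lemma wb_tail d s :
  wb s ++ [:: inl d; inr la] = inl (head d s) :: inr la :: wa (behead (rcons s d)).
Proof.
by elim: s => //= e s ->; case: s.
Qed.

Definition letter_series (x : letter) t :=
  kap (rcons [seq actl x c | c <- t] x).

Section Rule.
Variable allow : bool -> bool -> bool.
Notation sw := (sweep actl kap allow (final allow)).
Hypothesis allow_open : allow false true.

Definition moment_a s := sw (inr la :: wa s) [::] false.
Definition moment_b s := sw (inr lb :: wb s) [::] false.
Definition moment_ab s := sw (inr la :: inr lb :: wb s) [::] false.

Notation I := (@series_I C B).

Lemma sweep_open x w : sw (inr x :: w) [::] false = settle actl kap (x, [::]) (sw w) [::].
Proof. by rewrite sweep_cons /= allow_open if_same addr0. Qed.

(** A block cannot accept a letter of another colour, because it would be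
    mixed. *)
Lemma join_other x y w e b : x.1 != y.1 ->
  join_item actl kap (inr y) (sw w) [:: (actl x e, b)] false = 0.
Proof.
move=> xy; apply: (settle_dead (col := fst) (act := actl)) => //=.
- by move=> *; apply: (sweep_final_additive _ actlA).
- by move=> *; apply: (sweep_final_dead _ actlA kapD (col := fst)).
- by rewrite /mixed /= (negPf xy).
Qed.

(** The gaps of the block of the first [a] are of the form b c1 ab c2 ... b c: a
    word of [moment_b] followed by a scalar. *)
Lemma moment_a_tail s tau : (tau = [::] \/ tau = [:: inr lb]) ->
  sw (inr la :: wa s ++ tau) [::] false =
  series_cat (series_comp (letter_series la) (series_cat moment_b I))
    (fun t => sw (wa t ++ tau) [::] true) s.
Proof.
move=> tauE; pose pre c := [:: inr lb; inl c] : seq (item B letter).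
rewrite sweep_open (@periodic_series _ _ _ _ _ _ actlA actl1 kapD la pre tau).
- congr (series_cat _ _ _); apply: eq_series_comp => c s'.
  rewrite lastI series_cat_I_rcons -sweep_rcons_scalar; congr (sw _ _ _).
  rewrite -wa_wb -lastI /gap_word.
  by rewrite -!cats1 -catA.
- move=> c [|? [|? [|? ?]]] i v [] // *; subst=> //.
  by apply: join_other.
- case: tauE => -> [|? [|? ?]] i v // [] // *; subst=> //.
  by apply: join_other.
Qed.

(** The gaps of the block of the first [b] are of the form c1 a b c2 ... a: a
    scalar followed by a word of [moment_a]. *)
Lemma moment_b_tail s tau :
  (tau = [::] \/ exists c, tau = [:: inl c; inr la]) ->
  sw (inr lb :: wb s ++ tau) [::] false =
  series_cat (series_comp (letter_series lb) (series_cat I moment_a))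
    (fun t => sw (wb t ++ tau) [::] true) s.
Proof.
move=> tauE; pose pre c := [:: inl c; inr la] : seq (item B letter).
rewrite sweep_open (@periodic_series _ _ _ _ _ _ actlA actl1 kapD lb pre tau).
- congr (series_cat _ _ _); apply: eq_series_comp => c s'.
  rewrite series_cat_I_cons /gap_word -[flatten _]/(wb _) wb_tail.
  rewrite -lastI /=; congr (_ * _).
  by case: s'.
- move=> c [|? [|? [|? ?]]] i v [] // *; subst=> //.
  by apply: join_other.
- case: tauE => [|[c]] -> [|? [|? [|? ?]]] i v // [] // *; subst=> //.
  by apply: join_other.
Qed.

End Rule.

Section Full.
Notation sw := (sweep actl kap allow_full (final allow_full)).
Notation I := (@series_I C B).
Let P := moment_ab allow_full.
Let Q := moment_b allow_full.
Let N := moment_a allow_full.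

Lemma moment_ab_full :
  P = series_cat (series_comp (letter_series la) (series_cat Q I)) Q.
Proof.
apply/funext => s; rewrite /P /moment_ab -wa_wb moment_a_tail //; last by right.
congr (series_cat _ _ _); apply/funext => t.
by rewrite wa_wb (sweep_full_prev _ _ _ _ _ false).
Qed.

Lemma moment_b_full :
  Q = series_cat (series_comp (letter_series lb) (series_cat I N))
        (series_add (@series_1 C B) (series_cat I P)).
Proof.
apply/funext => s; rewrite /Q /moment_b -[wb s]cats0 moment_b_tail //; last by left.
congr (series_cat _ _ _); apply/funext => -[|c t].
  by rewrite /series_add series_cat_I_nil addr0.
by rewrite cats0 /series_add add0r series_cat_I_cons sweep_scalar (sweep_full_prev _ _ _ _ _ false).
Qed.

(** What follows the block of the first [a] is empty or starts with [b]; in the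
    second case the block of this [b] is followed in turn. *)
Lemma moment_a_full :
  N = series_cat (series_comp (letter_series la) (series_cat Q I))
        (series_add (@series_1 C B)
           (series_cat (series_comp (letter_series lb) (series_cat I N)) (series_cat I N))).
Proof.
apply/funext => s; rewrite /N /moment_a -[wa s]cats0 moment_a_tail //; last by left.
congr (series_cat _ _ _); apply/funext => t; rewrite cats0.
case/lastP: t => [|t c]; first by rewrite /series_add series_cat_nil series_cat_I_nil mulr0 addr0.
rewrite /series_add (_ : series_1 _ = 0) ?add0r; last by case: t.
rewrite series_cat_rcons ?series_cat_I_nil // (sweep_full_prev _ _ _ _ _ false).
have -> : wa (rcons t c) = inr lb :: wb t ++ [:: inl c; inr la].
  by rewrite -cat_cons -wa_wb -catA /wa -cats1 map_cat flatten_cat.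
rewrite moment_b_tail //; last by right; exists c.
congr (series_cat _ _ _); apply/funext => u; rewrite wb_tail (sweep_full_prev _ _ _ _ _ false).
case: u => [|d u]; last by rewrite rcons_cons series_cat_I_cons.
by rewrite series_cat_I_cons.
Qed.

End Full.

Section Alt.
Notation sw := (sweep actl kap allow_alt (final allow_alt)).
Notation I := (@series_I C B).

(** The last letter of the first block closes it and leaves the stack empty, so
    the alternating rule lets no letter come after: there is no block to join. *)
Lemma moment_a_alt : moment_a allow_alt =
  series_comp (letter_series la) (series_cat (moment_b allow_alt) I).
Proof.
apply/funext => s; rewrite /moment_a -[wa s]cats0 moment_a_tail //; last by left.
rewrite -[series_comp _ _ in RHS]series_cat_1r; congr (series_cat _ _ _).
apply/funext => -[|c t] //=.
by rewrite addr0.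
Qed.

Lemma moment_b_alt : moment_b allow_alt =
  series_comp (letter_series lb) (series_cat I (moment_a allow_alt)).
Proof.
apply/funext => s; rewrite /moment_b -[wb s]cats0 moment_b_tail //; last by left.
rewrite -[series_comp _ _ in RHS]series_cat_1r; congr (series_cat _ _ _).
apply/funext => -[|c t] //=.
by rewrite addr0 mulr0.
Qed.
End Alt.
End Free.
Section Single.
Variables (X : Type) (act : X -> B -> X) (kap : seq X -> B).
Hypothesis actA : forall x c d, act (act x c) d = act x (c * d).
Hypothesis act1 : forall x, act x 1 = x.
Hypothesis kapD : forall u v z c d,
  kap (u ++ act z (c + d) :: v) = kap (u ++ act z c :: v) + kap (u ++ act z d :: v).
Variable x : X.
Notation sw := (sweep act kap allow_full (final allow_full)).
Notation I := (@series_I C B).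

Definition power_word s : seq (item B X) :=
  inr x :: flatten [seq [:: inl c; inr x] | c <- s].
Definition moment_power s := sw (power_word s) [::] false.

(** The gaps of the first block are of the form c, or c x c1 x ... x d. *)
Lemma moment_power_full : moment_power =
  series_cat
    (series_comp (fun t => kap (rcons [seq act x c | c <- t] x))
       (series_cat I (series_add (@series_1 C B) (series_cat moment_power I))))
    (series_add (@series_1 C B) (series_cat I moment_power)).
Proof.
apply/funext => s; pose pre c := [:: inl c] : seq (item B X).
rewrite /moment_power sweep_cons [LHS]addr0 -[flatten _]cats0.
rewrite (@periodic_series _ _ _ _ _ _ actA act1 kapD x pre [::]).
- congr (series_cat _ _ _).
    apply: eq_series_comp => c u; rewrite series_cat_I_cons.
    case/lastP: u => [|u d].
      by rewrite /= /series_add series_cat_nil mulr0 addr0.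
    rewrite /series_add series_cat_I_rcons (_ : series_1 _ = 0); last by case: (u).
    rewrite add0r -sweep_rcons_scalar /gap_word belast_rcons last_rcons.
    rewrite -sweep_scalar /moment_power; congr (sw _ _ _).
    by rewrite /power_word /= -!cats1.
  apply/funext => -[|c u]; first by rewrite /series_add series_cat_I_nil addr0.
  rewrite /series_add add0r series_cat_I_cons.
  by rewrite /periodic cats0.
- by move=> c [|? [|? ?]] i v [] // <-.
- by move=> [].
Qed.
End Single.
End Words.

(** * From nested cumulants to the machine *)

Section Run.
Variables (B : nzRingType) (X : Type) (act : X -> B -> X) (kap : seq X -> B).
Implicit Types (G : state_fun B X) (st : seq (block X)).

(** [settle], [step] and [sweep] along one given sequence of moves. *)
Definition settle_flag (e : bool) (b : block X) G st : B :=
  if e then give act (kap (rev (b.1 :: b.2))) G st true else G (b :: st) false.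

Definition flag_step (q : bool * bool) (x : X) G : state_fun B X := fun st _ =>
  if q.1 then settle_flag q.2 (x, [::]) G st
  else if st is (y, b) :: st' then settle_flag q.2 (x, y :: b) G st' else 0.

Fixpoint run (fl : seq (bool * bool)) (xs : seq X) : state_fun B X :=
  match fl, xs with
  | q :: fl', x :: xs' => flag_step q x (run fl' xs')
  | _, _ => final allow_full
  end.

Lemma give_sum (I : Type) (r : seq I) (P : pred I) c (F : I -> state_fun B X) st p :
  give act c (fun st p => \sum_(i <- r | P i) F i st p) st p =
  \sum_(i <- r | P i) give act c (F i) st p.
Proof. by case: st => [|[y b] st] //=; rewrite mulr_sumr. Qed.

Lemma sum_flag_cons n (F : bool * bool -> seq (bool * bool) -> B) :
  \sum_(fl : n.+1.-tuple (bool * bool)) F (head (true, true) fl) (behead fl) =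
  \sum_(fl : n.-tuple (bool * bool)) (F (true, true) fl + F (true, false) fl +
    (F (false, true) fl + F (false, false) fl)).
Proof.
rewrite (reindex (fun q : (bool * bool) * n.-tuple (bool * bool) =>
   cons_tuple q.1 q.2)) /=; last first.
  exists (fun p : n.+1.-tuple (bool * bool) => (thead p, behead_tuple p)).
    by move=> [j p] _; congr (_, _) => /=; apply/val_inj.
  by move=> p _; rewrite [p in RHS]tuple_eta; apply/val_inj.
rewrite -(pair_big xpredT xpredT (fun q (fl : n.-tuple (bool * bool)) => F q fl)) /=.
rewrite exchange_big; apply: eq_bigr => fl _ /=.
transitivity (\sum_(f : bool) \sum_(e : bool) F (f, e) fl).
  by rewrite pair_big; apply: eq_bigr => -[].
by rewrite !big_bool.
Qed.

Lemma sweep_full_run xs st p :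
  sweep act kap allow_full (final allow_full) (map inr xs) st p =
  \sum_(fl : (size xs).-tuple (bool * bool)) run fl xs st p.
Proof.
elim: xs st p => [|x xs IH] st p.
  rewrite (eq_bigr (fun=> final allow_full st p)) ?sumr_const ?card_tuple ?expn0 ?mulr1n //.
  by move=> fl _; rewrite tuple0.
have -> : \sum_(fl : (size (x :: xs)).-tuple (bool * bool)) run fl (x :: xs) st p =
   \sum_(fl : (size xs).+1.-tuple (bool * bool))
     flag_step (head (true, true) fl) x (run (behead fl) xs) st p.
  by apply: eq_bigr => fl _; case: fl => -[].
rewrite (sum_flag_cons _ (fun q fl => flag_step q x (run fl xs) st p)).
have settleE b st' : settle act kap b (sweep act kap allow_full (final allow_full) (map inr xs)) st'
   = \sum_(fl : (size xs).-tuple (bool * bool))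
       (settle_flag true b (run fl xs) st' + settle_flag false b (run fl xs) st').
  rewrite big_split /= [RHS]addrC /settle IH.
  rewrite -(give_sum _ _ _ (fun fl : (size xs).-tuple _ => run fl xs)).
  by case: st' => [|[y c] st'] /=; rewrite IH.
rewrite map_cons sweep_cons big_split.
move: (sweep _ _ _ _ _) settleE => W settleE.
rewrite [LHS]/= settleE; congr (_ + _).
case: st => [|[y b] st]; last by rewrite [LHS]settleE.
by rewrite big1 // => fl _; rewrite /= addr0.
Qed.

(** Moves which are not those of a partition get stuck, which gives the value
    zero; therefore sums over paths may be taken over all sequences of flags. *)
Lemma run_invalid fl xs st p : size fl = size xs -> ~~ valid (size st) fl ->
  run fl xs st p = 0.
Proof.
elim: fl xs st p => [|[f e] fl IH] [|x xs] st p //=; first by case: st.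
move=> [sz] v; have settle0 b st' :
   ~~ valid ((size st').+1 - e) fl -> settle_flag e b (run fl xs) st' = 0.
  rewrite /settle_flag; case: e {v} => v; last by apply: IH.
  move: v; rewrite subn1 /=; case: st' => [|[y c] st'] v /=; last exact: IH.
  by rewrite IH ?mulr0.
rewrite /flag_step /=; case: f v => /=.
  by rewrite addn1; apply: settle0.
case: st => [//|[y b] st] /=; rewrite addn0; exact: settle0.
Qed.

End Run.

Section Nested.
Variables (C : numClosedFieldType) (B A : algType C) (S : opv_space B A).
Variable kap : seq A -> B.
Notation ract := (ract S).
Notation lact := (lact S).

(** The first letter always belongs to the word that is being evaluated, either
    as the first letter of the removed interval, whose value is then absorbed by
    the next letter, or as the first remaining letter. The disjunction about [l]
    says that only cumulants of at most [n] letters occur. *)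
Lemma nested_lact (T : finType) n m (l : seq {set T}) c x w :
  (forall x w, (size w < n)%N -> kap (lact c x :: w) = c * kap (x :: w)) ->
  size l = (size w).+1 -> (size w <= n)%N -> ~~ constant l || (size w < n)%N ->
  nested S kap m l (lact c x :: w) = c * nested S kap m l (x :: w).
Proof.
move=> kapl; elim: m l x w => [|m IH] l x w sl wn lc; first by rewrite /= mulr0.
rewrite /=; case: ifP lc => [_ /=|/negbT lN _]; first exact: kapl.
set r := find _ _; set s := count_mem _ _.
have := step_lt lN; have := step_cases l; rewrite -/r -/s => cs slt.
have IH' d (y y' : seq A) : size y = (size w).+1 ->
    (exists z v, absorb S d (take r y) (drop (r + s) y) = z :: v /\
                 y' = lact c z :: v) ->
    nested S kap m (take r l ++ drop (r + s) l) y' = c *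
    nested S kap m (take r l ++ drop (r + s) l)
      (absorb S d (take r y) (drop (r + s) y)).
  move=> sy [z [v [e ->]]]; rewrite e.
  have := congr1 size e; rewrite /= size_absorb !size_take_min !size_drop sy -sl.
    move=> sv; apply: IH.
    - by rewrite size_cat size_take_min size_drop sv.
    - by move: sv; lia.
    case: cs => [[rs s0]|lr].
      by apply/orP; right; move: sv; lia.
    by rewrite take_oversize // drop_oversize ?cats0 ?lN //; lia.
  by case: cs; lia.
case: (posnP r) => [r0|r0].
  have s0 : (0 < s)%N by case: cs; lia.
  have sE z : take s (drop r (z :: w)) = z :: take s.-1 w.
    by rewrite r0 drop0 -{1}(prednK s0).
  rewrite !sE kapl ?size_take_min; last by lia.
  apply: (IH' _ (x :: w)) => //.
  have dE z : drop (r + s) (z :: w) = drop s.-1 w.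
    by rewrite r0 add0n -{1}(prednK s0).
  rewrite !dE r0 !take0; case E: (drop s.-1 w) => [|z v].
    by have := congr1 size E; rewrite size_drop /=; lia.
  by exists (lact (kap (x :: take s.-1 w)) z), v; rewrite /= lactA.
have dE k z : (0 < k)%N -> drop k (z :: w) = drop k.-1 w by case: k.
have tE z : take r (z :: w) = z :: take r.-1 w by rewrite -{1}(prednK r0).
rewrite !(dE r) // (dE _ (lact c x)) ?addn_gt0 ?r0 //.
apply: (IH' _ (x :: w)) => //; rewrite !tE (dE (r + s)%N) ?addn_gt0 ?r0 //.
case: (take r.-1 w) => [|y u] /=.
  by eexists; eexists; split; [reflexivity | rewrite lractA].
by eexists; eexists; split; reflexivity.
Qed.

(** The first entry that is the last occurrence of its label: every label before
    it occurs again, there or later. *)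
Lemma first_closing (L : eqType) (l : seq L) : l != [::] ->
  exists p V q, [/\ l = p ++ V :: q, V \notin q & {subset p <= V :: q}].
Proof.
elim: l => [//|V l IH] _; have [Vl|Vl] := boolP (V \in l); last first.
  by exists [::], V, l; split=> // U; rewrite in_nil.
have [|p [W [q [e Wq pq]]]] := IH; first by case: (l) Vl.
exists (V :: p), W, q; rewrite e; split=> // U; rewrite inE => /orP[/eqP->|/pq//].
by move: Vl; rewrite e mem_cat => /orP[/pq|].
Qed.

Lemma trailing (L : eqType) (p : seq L) V : exists p0 j,
  p = p0 ++ nseq j V /\ (p0 = [::] \/ exists p1 U, p0 = rcons p1 U /\ U != V).
Proof.
elim/last_ind: p => [|p U [p0 [j [-> h]]]].
  by exists [::], 0%N; split=> //; left.
have [->|UV] := eqVneq U V.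
  by exists p0, j.+1; split=> //; rewrite -addn1 nseqD catA cats1.
by exists (rcons (p0 ++ nseq j V) U), 0%N; rewrite cats0; split=> //; right; exists (p0 ++ nseq j V), U.
Qed.

Lemma count_block (L : eqType) (p q : seq L) V k : V \notin p -> V \notin q ->
  count_mem V (p ++ nseq k V ++ q) = k.
Proof.
move=> Vp Vq; rewrite !count_cat count_nseq /= eqxx !(count_memPn _) //.
by rewrite mul1n addn0.
Qed.

Lemma interval_at_block (L : eqType) (p q : seq L) V k :
  V \notin p -> V \notin q ->
  interval_at (p ++ nseq k.+1 V ++ q) (size p).
Proof.
move=> Vp Vq; rewrite /interval_at drop_size_cat //.
case E: (nseq k.+1 V ++ q) => [//|W t].
have VW : V = W by case: E.
by rewrite -VW in E *; rewrite -E count_block // prefix_prefix.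
Qed.

(** The first block to close is an interval: a letter of another block between
    two of its letters would belong to a block which occurs again later, and thus
    crosses it. *)
Lemma uncrossed_interval (L : eqType) (l : seq L) : l != [::] -> uncrossed l ->
  (find (interval_at l) (iota 0 (size l)) < size l)%N.
Proof.
move=> l0 unc; rewrite -[X in (_ < X)%N](size_iota 0) -has_find.
have [p [V [q [e Vq pq]]]] := first_closing l0.
have [p0 [j [ep h]]] := trailing p V.
have Vp0 : V \notin p0.
  case: h => [->//|[p1 [U [e1 UV]]]].
  rewrite e1 mem_rcons inE eq_sym (negPf UV) /=; apply/negP => Vp1.
  have /pq : U \in p by rewrite ep e1 mem_cat mem_rcons mem_head.
  rewrite inE (negPf UV) /= => Uq.
  have := unc V U; rewrite [V == U]eq_sym UV => /(_ isT) /negP; apply.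
  rewrite e ep e1 -cats1 -!catA -[[:: V; U; V; U]]/([:: V] ++ [:: U] ++ [:: V; U]).
  apply: cat_subseq; first by rewrite sub1seq.
  apply: cat_subseq => //.
  by apply: subseq_trans (suffix_subseq _ _); rewrite /= eqxx sub1seq.
apply/hasP; exists (size p0); first by rewrite mem_iota e ep !size_cat /=; lia.
have eq1 : l = p0 ++ nseq j.+1 V ++ q by rewrite e ep -addn1 nseqD -!catA.
by rewrite eq1; apply: interval_at_block.
Qed.

(** Crossings are excluded because, in the absence of an interval block, the value
    of the empty word would multiply the last letter on the right of [c]. *)
Lemma nested_ract (T : finType) n m (l : seq {set T}) c x w :
  (forall x w, (size w < n)%N -> kap (rcons w (ract x c)) = kap (rcons w x) * c) ->
  uncrossed l ->
  size l = (size w).+1 -> (size w <= n)%N -> ~~ constant l || (size w < n)%N ->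
  nested S kap m l (rcons w (ract x c)) = nested S kap m l (rcons w x) * c.
Proof.
move=> kapr; elim: m l x w => [|m IH] l x w unc sl wn lc; first by rewrite /= mul0r.
rewrite /=; case: ifP lc => [_ /=|/negbT lN _]; first exact: kapr.
have := @uncrossed_interval _ l _ unc.
set r := find _ _ => rl; set s := count_mem _ _.
have := step_lt lN; have := step_cases l; rewrite -/r -/s => cs slt.
have {}rl : (r < size l)%N by apply: rl; case: (l) lN.
have [rs s0] : (r + s <= size l)%N /\ (0 < s)%N by case: cs => // h; lia.
have IH' d (y y' : seq A) : size y = (size w).+1 ->
    (exists v z, absorb S d (take r y) (drop (r + s) y) = rcons v z /\
                 y' = rcons v (ract z c)) ->
    nested S kap m (take r l ++ drop (r + s) l) y' =
    nested S kap m (take r l ++ drop (r + s) l)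
      (absorb S d (take r y) (drop (r + s) y)) * c.
  move=> sy [v [z [e ->]]]; rewrite e.
  have := congr1 size e; rewrite size_absorb !size_take_min !size_drop sy -sl; last by lia.
  rewrite size_rcons => sv; apply: IH.
  - apply: subseq_uncrossed unc; rewrite -[X in subseq _ X](cat_take_drop r).
    by rewrite subseq_cat2l addnC -drop_drop drop_subseq.
  - by rewrite size_cat size_take_min size_drop sv.
  - by move: sv; lia.
  - by apply/orP; right; move: sv; lia.
case: (leqP (r + s) (size w)) => rsw.
  have tE k z : (k <= size w)%N -> take k (rcons w z) = take k w.
    by move=> kw; rewrite -cats1 takel_cat.
  have dE k z : (k <= size w)%N -> drop k (rcons w z) = rcons (drop k w) z.
    by move=> kw; rewrite drop_rcons.
  have tdE z : take s (drop r (rcons w z)) = take s (drop r w).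
    by rewrite dE -?cats1 ?takel_cat // ?size_drop; lia.
  rewrite !tdE; apply: (IH' _ (rcons w x)); first by rewrite size_rcons.
  rewrite !tE ?dE; try lia.
  case: (take r w) => [|y u] /=.
    case: (drop (r + s) w) => [|y v] /=.
      by exists [::]; eexists; split; [reflexivity | rewrite lractA].
    by exists (lact (kap (take s (drop r w))) y :: v), x; rewrite !rcons_cons.
  by eexists; eexists; rewrite -!rcons_cat; split; reflexivity.
have e : (r + s)%N = (size w).+1 by lia.
have dE z : drop (r + s) (rcons w z) = [::] by rewrite drop_oversize // size_rcons e.
have tdE z : take s (drop r (rcons w z)) = rcons (drop r w) z.
  by rewrite drop_rcons ?take_oversize // ?size_rcons ?size_drop; lia.
have tE z : take r (rcons w z) = take r w by rewrite -cats1 takel_cat //; lia.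
rewrite !tdE kapr ?size_drop; last by lia.
apply: (IH' _ (rcons w x)); first by rewrite size_rcons.
rewrite !dE !tE; case E: (take r w) => [|y u].
  by have := congr1 size E; rewrite size_take_min /=; lia.
by rewrite /= !cats0; eexists; eexists; split; [reflexivity | rewrite ractA].
Qed.

End Nested.

Section Cumulants.
Variables (C : numClosedFieldType) (B A : algType C) (S : opv_space B A).
Variable kap : seq A -> B.
Hypothesis kapC : is_free_cumulants S kap.
Notation ract := (ract S).
Notation lact := (lact S).

Lemma phi_lact c x : phi S (lact c x) = c * phi S x.
Proof. by rewrite -[lact c x](ract1 S) phi_bimod mulr1. Qed.

Lemma phi_ract x c : phi S (ract x c) = phi S x * c.
Proof. by rewrite -{1}[x](lact1 S) phi_bimod mul1r. Qed.

(** The moment-cumulant formula solved for the one-block term. *)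
Lemma cumulant_moment x w : kap (x :: w) = phi S (\prod_(y <- x :: w) y) -
  \sum_(P in NC (size w).+1 | P != [set [set: 'I_(size w).+1]])
     kappa_part S kap P (x :: w).
Proof.
rewrite (moment_cumulant kapC) // (bigD1 [set [set: 'I_(size w).+1]]) ?setT_NC //=.
by rewrite kappa_part_setT addrK.
Qed.

(** Cumulants inherit left linearity from [phi], by induction on the number of
    letters through the moment-cumulant formula. *)
Lemma kap_lact c x w : kap (lact c x :: w) = c * kap (x :: w).
Proof.
have [n wn] := ubnP (size w); elim: n x w wn => // n IH x w wn.
rewrite !cumulant_moment mulrBr !big_cons -lact_mul phi_lact; congr (_ - _).
rewrite mulr_sumr; apply: eq_bigr => P /andP[/NC_partition PP PT].
apply: (@nested_lact _ _ _ _ _ _ (size w)).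
- by move=> y v vw; apply: IH; lia.
- exact: size_labels.
- by [].
- by rewrite partition_constant // PT.
Qed.

Lemma kap_ract w x c : kap (rcons w (ract x c)) = kap (rcons w x) * c.
Proof.
have [n wn] := ubnP (size w); elim: n x w wn => // n IH x w wn.
have cm z : kap (rcons w z) = phi S (\prod_(y <- rcons w z) y) -
  \sum_(P in NC (size w).+1 | P != [set [set: 'I_(size w).+1]])
     kappa_part S kap P (rcons w z).
  case: w wn => [|y w] wn; first exact: cumulant_moment.
  by rewrite /= cumulant_moment size_rcons.
rewrite !cm mulrBl !big_rcons /= -ract_mul phi_ract; congr (_ - _).
rewrite mulr_suml; apply: eq_bigr => P /andP[PN PT].
have PP := NC_partition PN.
apply: (@nested_ract _ _ _ _ _ _ (size w)).
- by move=> y v vw; apply: IH; lia.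
- by apply/(noncrossing_labels PP); move: PN; rewrite inE => /andP[].
- exact: size_labels.
- by [].
- by rewrite partition_constant // PT.
Qed.

Lemma kapD u v z c d :
  kap (u ++ ract z (c + d) :: v) = kap (u ++ ract z c :: v) + kap (u ++ ract z d :: v).
Proof. by rewrite ractDr -[ract z c]scale1r (cumulants_multilinear kapC) !scale1r. Qed.

(** The labels and the letters of the open blocks, the bottom block first. Only
    letters of open blocks remain in the list on which [nested] works when the
    machine has reached a given letter. *)
Fixpoint stack_labels (L : Type) (ls : seq L) (st : seq (block A)) : seq L :=
  match ls, st with
  | V :: ls', b :: st' => stack_labels ls' st' ++ nseq (size b.2).+1 V
  | _, _ => [::]
  end.

Fixpoint stack_letters (st : seq (block A)) : seq A :=
  if st is b :: st' then stack_letters st' ++ rev (b.1 :: b.2) else [::].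

Lemma size_stack (L : Type) (ls : seq L) st : size ls = size st ->
  size (stack_labels ls st) = size (stack_letters st).
Proof.
elim: ls st => [|V ls IH] [|b st] //= [/IH e].
by rewrite !size_cat e /= size_nseq size_rev.
Qed.

Lemma stack_labels_sub (L : eqType) (ls : seq L) st :
  {subset stack_labels ls st <= ls}.
Proof.
elim: ls st => [|V ls IH] [|b st] //= W; rewrite mem_cat -[V :: nseq _ V]/(nseq _.+1 V).
by rewrite mem_nseq inE => /orP[/IH->|/andP[_ ->]]; rewrite ?orbT.
Qed.

Lemma find_iota (p : pred nat) r n : (r < n)%N -> p r ->
  (forall i, (i < r)%N -> ~~ p i) -> find p (iota 0 n) = r.
Proof.
move=> rn pr before; rewrite -(subnKC (ltnW rn)) iotaD find_cat.
rewrite (_ : has p (iota 0 r) = false) ?size_iota; last first.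
  by apply/hasPn => i; rewrite mem_iota add0n => /before.
by case E: (n - r)%N => [|k]; [lia | rewrite /= add0n pr addn0].
Qed.

(** The entries of [p] belong to blocks which still occur in [q], hence are no
    intervals. *)
Lemma find_interval (L : eqType) (p q : seq L) V k :
  V \notin p -> V \notin q -> {subset p <= q} ->
  find (interval_at (p ++ nseq k.+1 V ++ q))
    (iota 0 (size (p ++ nseq k.+1 V ++ q))) = size p.
Proof.
move=> Vp Vq pq; apply: find_iota.
- by rewrite !size_cat size_nseq; lia.
- exact: interval_at_block.
move=> i ip; apply/negP; rewrite /interval_at.
case E: (drop i _) => [//|U t]; set c := count_mem _ _ => /prefixP[t2 e].
have Ep : drop i (p ++ nseq k.+1 V ++ q) = drop i p ++ nseq k.+1 V ++ q.
  by rewrite drop_cat ip.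
have Up : U \in drop i p.
  move: Ep; rewrite E; case: (drop i p) (size_drop i p) => [|W r] /=; first by lia.
  by move=> _ [-> _]; rewrite mem_head.
have Uq : U \in q by apply: pq; apply: mem_drop Up.
have UV : U != V by apply: contraNneq Vq => <-.
have Ut2 : U \notin t2.
  have := count_cat (pred1 U) (nseq c U) t2; rewrite -e -E => h.
  have : (count_mem U (drop i (p ++ nseq k.+1 V ++ q)) <= c)%N.
    by rewrite /c -[X in (_ <= count _ X)%N](cat_take_drop i) count_cat leq_addl.
  rewrite h count_nseq /= eqxx mul1n -[X in (_ <= X)%N]addn0 leq_add2l leqn0.
  by rewrite -has_pred1 has_count -eqn0Ngt.
have := congr1 (fun s => nth U s (size (drop i p))) e; rewrite -E Ep.
rewrite nth_cat ltnn subnn /= nth_cat size_nseq.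
case: ltnP => [|ca _]; first by move=> a; rewrite nth_nseq a => /eqP; rewrite eq_sym (negPf UV).
have := congr1 (drop c) e; rewrite -E Ep [RHS]drop_size_cat ?size_nseq // => e2.
case/negP: Ut2; rewrite -e2 drop_cat; case: ltnP => [_|].
  by rewrite !mem_cat Uq !orbT.
move=> h; have -> : (c - size (drop i p) = 0)%N by lia.
by rewrite drop0 mem_cat Uq orbT.
Qed.

Lemma absorb_rcons c (u v : seq A) y :
  absorb S c (rcons u y) v = rcons u (ract y c) ++ v.
Proof. by case: u => //= t u; rewrite belast_rcons last_rcons. Qed.

Lemma nestedS (T : finType) m (l : seq {set T}) x :
  nested S kap m.+1 l x =
  if constant l then kap x else
  let r := find (interval_at l) (iota 0 (size l)) in
  let s := count_mem (nth set0 l r) l in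
  nested S kap m (take r l ++ drop (r + s) l)
    (absorb S (kap (take s (drop r x))) (take r x) (drop (r + s) x)).
Proof. by []. Qed.

Lemma nested_step (T : finType) m (p q : seq {set T}) V k (u blk v : seq A) :
  V \notin p -> V \notin q -> {subset p <= q} -> q != [::] ->
  size p = size u -> size blk = k.+1 -> size v = size q ->
  nested S kap m.+1 (p ++ nseq k.+1 V ++ q) (u ++ blk ++ v) =
  nested S kap m (p ++ q) (absorb S (kap blk) u v).
Proof.
move=> Vp Vq pq q0 su sb sv.
have nC : ~~ constant (p ++ nseq k.+1 V ++ q).
  case: q q0 Vq {pq sv} => // W q _; rewrite inE negb_or => /andP[VW _].
  have mV : V \in p ++ nseq k.+1 V ++ W :: q by rewrite !mem_cat mem_head orbT.
  have mW : W \in p ++ nseq k.+1 V ++ W :: q by rewrite !mem_cat mem_head !orbT.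
  apply/negP => /(constantP V)[x e]; rewrite e in mV mW.
  by move: mV mW VW; rewrite !mem_nseq => /andP[_ /eqP<-] /andP[_ /eqP<-]; rewrite eqxx.
rewrite nestedS (negPf nC); cbv zeta; rewrite find_interval //.
have -> : nth set0 (p ++ nseq k.+1 V ++ q) (size p) = V.
  by rewrite nth_cat ltnn subnn.
rewrite count_block // take_size_cat // su.
have -> : drop (size u + k.+1) (p ++ nseq k.+1 V ++ q) = q.
  by rewrite catA drop_size_cat // size_cat size_nseq su.
have -> : drop (size u + k.+1) (u ++ blk ++ v) = v.
  by rewrite catA drop_size_cat // size_cat sb.
by rewrite drop_size_cat // !take_size_cat.
Qed.

(** The leftmost interval block, which [nested] removes, is the first block which
    closes in the left to right reading. While the machine only opens and joins,
    [nested] does nothing; when the machine closes a block, [nested] removes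
    it. *)
Lemma nested_run (T : finType) m (seen ls l : seq {set T}) st xs q :
  parses ls l -> uniq ls -> {in l, seen =i ls} -> size ls = size st ->
  size xs = size l -> l != [::] ->
  (size (stack_labels ls st) + size l <= m)%N ->
  nested S kap m (stack_labels ls st ++ l) (stack_letters st ++ xs) =
  run ract kap (flags seen l) xs st q.
Proof.
elim: l m seen ls st xs q => [//|V l IH] m seen ls st [//|x xs] q r uls ss sl [sx] _ ml.
have close b ls' st' : V \notin ls' -> uniq ls' -> size ls' = size st' ->
   parses (if V \in l then V :: ls' else ls') l ->
   {in l, V :: seen =i if V \in l then V :: ls' else ls'} ->
   (size (stack_labels (V :: ls') (b :: st')) + size l <= m)%N ->
   nested S kap m (stack_labels (V :: ls') (b :: st') ++ l)
      (stack_letters (b :: st') ++ xs) =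
   settle_flag ract kap (V \notin l) b (run ract kap (flags (V :: seen) l) xs) st'.
  move=> VN uls' sl' r' ss' ml'; case: ifP r' ss' => Vl r' ss' /=.
    by apply: (IH m (V :: seen) (V :: ls') (b :: st')) => //=;
      [rewrite VN | rewrite sl' | case: (l) Vl].
  rewrite -!catA -[V :: nseq _ _]/(nseq (size b.2).+1 V).
  case: m ml' {ml} => [|m] ml'; first by move: ml'; rewrite /= size_cat /=; lia.
  case: l IH sx Vl r' ss' {r ss} ml' => [|W l] IH sx Vl r' ss' ml'.
    have ls0 : ls' = [::] by apply/eqP; exact: r'.
    rewrite ls0 in sl' *; case: xs sx => // _; rewrite (size0nil (esym sl')).
    rewrite nestedS [stack_labels _ _]/= cat0s cats0 constant_nseq.
    by rewrite /= cats0 mulr1.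
  have sub : {subset stack_labels ls' st' <= W :: l}.
    by move=> U /stack_labels_sub /(parses_subset r').
  rewrite (@nested_step _ _ _ _ V) ?Vl ?size_rev //; last 2 first.
  - by apply: contra VN => /stack_labels_sub.
  - exact: size_stack.
  have mm : (size (stack_labels ls' st') + size (W :: l) <= m)%N.
    by move: ml'; rewrite /= size_cat /= size_nseq; lia.
  case: st' sl' mm {ml' sub} => [|[y b'] st'] sl' mm.
    move/size0nil: sl' => e; subst ls'; case: xs sx => [//|z v] sx /=.
    rewrite (@nested_lact _ _ _ _ _ _ (size v).+1).
    - by congr (_ * _); apply: (IH m _ [::] [::] _ true).
    - by move=> *; apply: kap_lact.
    - by case: sx => ->.
    - by [].
    - by rewrite ltnSn orbT.
  case: ls' VN uls' r' ss' sl' mm => [//|U ls'] VN uls' r' ss' sl' mm.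
  rewrite [stack_letters _]/= [rev (y :: b')]rev_cons -rcons_cat absorb_rcons rcons_cat -rev_cons.
  exact: (IH m _ (U :: ls') ((ract y (kap (rev (b.1 :: b.2))), b') :: st') _ true).
have [r' next _] := parses_step r ss.
have VV := ss V (mem_head V l); move: r => /= /andP[VN _].
rewrite /flag_step VV; case Vls: (V \in ls) => /=.
  case: ls uls sl VN Vls r' next ml {ss VV} => [//|W ls] uls sl VN Vls r' next ml.
  case: st sl ml => [//|[y b] st] sl ml.
  have WV : W = V by move: VN Vls => /=; case: eqVneq => [//|_ /negPf->].
  subst W; move: VN r' next; rewrite /= eqxx => VN r' next.
  rewrite -(close _ ls) //; last 3 first.
  - by case/andP: uls.
  - by case: sl.
  - by move: ml; rewrite /= !size_cat /= !size_nseq; lia.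
  have nseqC k : nseq k V ++ V :: l = V :: nseq k V ++ l.
    by elim: k => //= k ->.
  by rewrite /= -!catA /= nseqC [rev (x :: _)]rev_cons cat_rcons.
have e : pop V ls = ls.
  by case: (ls) Vls => [//|W ls0]; rewrite inE eq_sym /=; case: eqVneq.
rewrite e in VN r' next.
rewrite -(close _ ls) //; last by move: ml; rewrite /= !size_cat /=; lia.
by rewrite /= -!catA.
Qed.

Lemma kappa_part_run n (P : {set {set 'I_n.+1}}) x p :
  P \in NC n.+1 -> size x = n.+1 ->
  kappa_part S kap P x = run ract kap (flags [::] (labels P)) x [::] p.
Proof.
move=> PN sx; apply: (@nested_run _ n.+1 [::] [::] (labels P) [::]) => //.
- exact: NC_parses.
- by rewrite size_labels.
- by rewrite -size_eq0 size_labels.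
- by rewrite /= size_labels.
Qed.

Theorem moment_sweep x p : x != [::] ->
  phi S (\prod_(y <- x) y) =
  sweep ract kap allow_full (final allow_full) (map inr x) [::] p.
Proof.
case: x => [//|x w] _; rewrite (moment_cumulant kapC) // sweep_full_run.
transitivity (\sum_(P in NC (size w).+1)
    run ract kap (flags [::] (labels P)) (x :: w) [::] p).
  by apply: eq_bigr => P PN; apply: kappa_part_run.
rewrite (sum_NC_flags _ (fun fl => run ract kap fl (x :: w) [::] p)).
rewrite big_mkcond; apply: eq_bigr => fl _; case: ifP => // /negbT v.
by rewrite run_invalid // size_tuple.
Qed.

End Cumulants.

(** * The series of interleaved partitions *)

(** The machine does not see more of the letters than the scalar action and the
    cumulants. *)
Section Morphism.
Variables (B : nzRingType) (X Y : Type) (actX : X -> B -> X) (actY : Y -> B -> Y).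
Variables (kap : seq Y -> B) (allow : bool -> bool -> bool) (f : X -> Y).
Hypothesis fact : forall x c, f (actX x c) = actY (f x) c.

Definition map_block (b : block X) : block Y := (f b.1, map f b.2).
Definition map_item (i : item B X) : item B Y :=
  match i with inl c => inl c | inr x => inr (f x) end.

Lemma sweep_map w st p :
  sweep actX (fun s => kap (map f s)) allow (final allow) w st p =
  sweep actY kap allow (final allow) (map map_item w) (map map_block st) p.
Proof.
elim: w st p => [|i w IH] st p; first by case: st.
have giveE c st' q :
    give actX c (sweep actX (fun s => kap (map f s)) allow (final allow) w) st' q =
    give actY c (sweep actY kap allow (final allow) (map map_item w)) (map map_block st') q.
  by case: st' => [|[y b] st'] /=; rewrite IH //= /map_block /= fact.
rewrite map_cons !sweep_cons; case: i => [c|x]; first exact: giveE.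
have settleE b st' :
    settle actX (fun s => kap (map f s)) b
       (sweep actX (fun s => kap (map f s)) allow (final allow) w) st' =
    settle actY kap (map_block b) (sweep actY kap allow (final allow) (map map_item w))
       (map map_block st').
  by rewrite /settle IH giveE map_rev.
rewrite [LHS]/= [RHS]/= !settleE; congr (_ + _); congr (if _ then _ else _).
by case: st => [|[y b] st] //=; rewrite settleE.
Qed.
End Morphism.

Section AltSum.
Variables (B : nzRingType) (X : Type) (act : X -> B -> X) (kap : seq X -> B).
Notation flag_step := (flag_step act kap).
Notation run := (run act kap).
Notation sw := (sweep act kap allow_alt (final allow_alt)).

(** The alternating rule fixes whether a letter opens, so that only the choice
    between closing and staying open is left. *)
Lemma step_alt x G st p : step act kap allow_alt (inr x) G st p =
  flag_step (~~ p, true) x G st p + flag_step (~~ p, false) x G st p.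
Proof.
case: p => /=; rewrite /flag_step /= ?add0r ?addr0; last by rewrite addrC.
by case: st => [|[y b] st]; rewrite /= ?addr0 // addrC.
Qed.

(** After a letter which keeps its block open the stack is not empty. *)
Lemma eq_flag_step q x G G' st p :
  (forall st, q.2 || ~~ nilp st -> G st q.2 = G' st q.2) ->
  flag_step q x G st p = flag_step q x G' st p.
Proof.
case: q => f e /= GG.
have sE b st' : settle_flag act kap e b G st' = settle_flag act kap e b G' st'.
  rewrite /settle_flag; case: e GG => GG; last exact: GG.
  by case: st' => [|[y c] st'] /=; rewrite GG.
by rewrite /flag_step /=; case: f => //; case: st => [|[y b] st].
Qed.

Lemma flag_step_sum (I : finType) q x (F : I -> state_fun B X) st p :
  flag_step q x (fun st p => \sum_i F i st p) st p =
  \sum_i flag_step q x (F i) st p.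
Proof.
case: q => f e.
have sE b st' : settle_flag act kap e b (fun st p => \sum_i F i st p) st' =
    \sum_i settle_flag act kap e b (F i) st'.
  rewrite /settle_flag; case: e => //.
  exact: (give_sum act _ _ _ F).
rewrite /flag_step /=; case: f => //; case: st => [|[y b] st] //.
by rewrite big1.
Qed.

Lemma flag_stepD q x G G' st p :
  flag_step q x (fun st p => G st p + G' st p) st p =
  flag_step q x G st p + flag_step q x G' st p.
Proof.
have := flag_step_sum q x (fun b : bool => if b then G else G') st p.
rewrite big_bool /= => <-; apply: eq_flag_step => st' _.
by rewrite big_bool.
Qed.

(** The flags of [g i] are free, and they determine those of the two letters
    [f i] next to it by the alternating rule, read once forwards and once
    backwards. At the beginning, [e || ~~ nilp st] excludes a letter which kept
    its block open with nothing on the stack. *)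
Lemma sweep_alt_run (I : Type) (f g : I -> X) s st (e q : bool) : e || ~~ nilp st ->
  \sum_(fl : (size s).-tuple (bool * bool))
     run (kr_flags e fl) (flatten [seq [:: f i; g i] | i <- s]) st q =
  sw (map inr (flatten [seq [:: f i; g i] | i <- s])) st e.
Proof.
elim: s st e q => [|i s IH] st e q est.
  rewrite (eq_bigr (fun=> final allow_full st q)); last by move=> fl _; rewrite tuple0.
  by rewrite sumr_const card_tuple expn0 mulr1n; case: st est; case: e.
set xs := flatten [seq [:: f i; g i] | i <- s].
pose W := sw (map inr xs).
have -> : sw (map inr (flatten [seq [:: f i; g i] | i <- i :: s])) st e =
    flag_step (~~ e, true) (f i) (step act kap allow_alt (inr (g i)) W) st e +
    flag_step (~~ e, false) (f i) (step act kap allow_alt (inr (g i)) W) st e.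
  exact: step_alt.
have -> : \sum_(fl : (size (i :: s)).-tuple (bool * bool))
     run (kr_flags e fl) (flatten [seq [:: f i; g i] | i <- i :: s]) st q =
   \sum_(fl : (size s).+1.-tuple (bool * bool))
     flag_step (~~ e, ~~ (head (true, true) fl).1) (f i)
       (flag_step (head (true, true) fl) (g i)
         (run (kr_flags (head (true, true) fl).2 (behead fl)) xs)) st q.
  by apply: eq_bigr => fl _; case: fl => -[].
rewrite (sum_flag_cons _ (fun q' fl => flag_step (~~ e, ~~ q'.1) (f i)
   (flag_step q' (g i) (run (kr_flags q'.2 fl) xs)) st q)) !big_split /=.
have aux f' e' : \sum_(fl : (size s).-tuple (bool * bool))
   flag_step (~~ e, ~~ f') (f i)
     (flag_step (f', e') (g i) (run (kr_flags e' fl) xs)) st q =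
   flag_step (~~ e, ~~ f') (f i) (flag_step (f', e') (g i) W) st q.
  rewrite -flag_step_sum; apply: eq_flag_step => st' _ /=.
  by rewrite -flag_step_sum; apply: eq_flag_step => st'' h /=; rewrite IH.
rewrite (aux true true) (aux true false) (aux false true) (aux false false).
rewrite [RHS]addrC -!flag_stepD.
congr (_ + _); apply: eq_flag_step => st' _;
  by rewrite step_alt.
Qed.

(** In the series [V] the last letter [b] is a block of its own, and contributes
    the factor [phi b = 1]. *)
Lemma run_rcons_singleton fl xs y st q : size fl = size xs ->
  run (rcons fl (true, true)) (rcons xs y) st q = run fl xs st q * kap [:: y].
Proof.
elim: fl xs st q => [|[f e] fl IH] [|x xs] st q //.
  by move=> _; case: st => [|[z b] st]; rewrite /= /flag_step /= ?mulr1 ?mul1r ?mul0r.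
move=> [sz]; rewrite !rcons_cons.
have sE b st' : settle_flag act kap e b (run (rcons fl (true, true)) (rcons xs y)) st' =
    settle_flag act kap e b (run fl xs) st' * kap [:: y].
  rewrite /settle_flag; case: e; last exact: IH.
  by case: st' => [|[z c] st'] /=; rewrite IH // mulrA.
rewrite /= /flag_step /=; case: f => //; case: st => [|[z b] st] //.
by rewrite mul0r.
Qed.

Lemma sweep_alt_expand (I : Type) (f g : I -> X) x s :
  \sum_(fl : (size s).+1.-tuple (bool * bool))
     run (expand fl) (x :: flatten [seq [:: f i; g i] | i <- s]) [::] false =
  sw (map inr (x :: flatten [seq [:: f i; g i] | i <- s])) [::] false.
Proof.
set xs := flatten _; pose W := sw (map inr xs).
have -> : sw (map inr (x :: xs)) [::] false =
    flag_step (true, true) x W [::] false + flag_step (true, false) x W [::] false.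
  exact: step_alt.
have -> : \sum_(fl : (size s).+1.-tuple (bool * bool)) run (expand fl) (x :: xs) [::] false =
   \sum_(fl : (size s).+1.-tuple (bool * bool))
     flag_step (head (true, true) fl) x
         (run (kr_flags (head (true, true) fl).2 (behead fl)) xs) [::] false.
  by apply: eq_bigr => fl _; case: fl => -[].
rewrite (sum_flag_cons _ (fun q' fl =>
   (flag_step q' x (run (kr_flags q'.2 fl) xs)) [::] false)) !big_split /=.
rewrite [X in _ + X](_ : _ = 0) ?addr0; last by rewrite !big1 ?addr0.
rewrite -!flag_step_sum.
by congr (_ + _); apply: eq_flag_step => st h /=; apply: sweep_alt_run.
Qed.

End AltSum.

Section VSeries.
Variables (C : numClosedFieldType) (B A : algType C) (S : opv_space B A).
Variable kap : seq A -> B.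
Hypothesis kapC : is_free_cumulants S kap.
Variables a b : A.
Hypotheses (phia : phi S a = 1) (phib : phi S b = 1).

Definition eval_letter (x : letter B) : A := ract S (if x.1 then a else b) x.2.
Definition letter_kap (s : seq (letter B)) := kap (map eval_letter s).

Lemma kap_singleton x : kap [:: x] = phi S x.
Proof.
have := moment_sweep kapC false (isT : [:: x] != [::]).
by rewrite big_seq1 => ->; rewrite /= /settle /= add0r addr0 mulr1.
Qed.

Lemma eval_act x c : eval_letter (actl x c) = ract S (eval_letter x) c.
Proof. by rewrite /eval_letter /= ractA. Qed.

Lemma eval_la : eval_letter (la B) = a.
Proof. exact: ract1. Qed.

Lemma eval_lb : eval_letter (lb B) = b.
Proof. exact: ract1. Qed.

Lemma sweep_letter_kap allow w st p :
  sweep (@actl C B) letter_kap allow (final allow) w st p =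
  sweep (ract S) kap allow (final allow)
    (map (map_item eval_letter) w) (map (map_block eval_letter) st) p.
Proof. exact: (sweep_map _ _ eval_act). Qed.

Lemma sweep_absorb allow x c w :
  sweep (ract S) kap allow (final allow) [:: inr x, inl c & w] =
  sweep (ract S) kap allow (final allow) (inr (ract S x c) :: w).
Proof.
rewrite !sweep_cons -(step_absorb allow (fun x c d => esym (ractA S x c d))) //.
exact: kap_ract.
Qed.

Lemma moment_a_letters allow s : moment_a letter_kap allow s =
  sweep (ract S) kap allow (final allow)
    (map inr (a :: flatten [seq [:: ract S b c; a] | c <- s])) [::] false.
Proof.
have E t : sweep (ract S) kap allow (final allow) (map (map_item eval_letter) (wa t)) =
    sweep (ract S) kap allow (final allow)
      (map inr (flatten [seq [:: ract S b c; a] | c <- t])).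
  elim: t => // c t IH.
  rewrite -[map (map_item _) _]/[:: inr (eval_letter (lb B)), inl c,
     inr (eval_letter (la B)) & map (map_item eval_letter) (wa t)].
  by rewrite eval_la eval_lb sweep_absorb 2!sweep_cons IH.
rewrite /moment_a sweep_letter_kap map_cons sweep_cons E.
by rewrite -[map_item _ _]/(inr (eval_letter (la B))) eval_la.
Qed.

(** The sum over irreducible partitions becomes a sum over paths which are valid
    and positive. The other paths may be added, since their expansions are not
    valid and have value zero. *)
Lemma V_series_moment : V_series S kap a b = moment_a letter_kap allow_alt.
Proof.
apply/funext => -[|c0 s0].
  by rewrite moment_a_letters /= /settle /= add0r addr0 mulr1 kap_singleton.
set s := c0 :: s0; rewrite /V_series -/s; set n := size s.
pose ws := flatten [seq [:: ract S b c; a] | c <- s].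
have -> : flatten [seq [:: a; ract S b c] | c <- s] ++ [:: a; b] =
    rcons (a :: ws) b.
  rewrite /ws; elim: (s) => //= c s' ->; by [].
have sws : size ws = n.*2 by rewrite /ws /n; elim: (s) => //= c s' ->.
pose F fl := run (ract S) kap (rcons (expand fl) (true, true)) (rcons (a :: ws) b)
  [::] false.
transitivity (\sum_(P in NC n.+1) (fun fl => if positive 0 fl then F fl else 0)
    (flags [::] (labels P))).
  rewrite -[RHS]big_mkcondr /=; apply: eq_big => [P|P].
    by rewrite inE; case PN: (P \in NC n.+1); rewrite // positive_labels.
  rewrite inE => /andP[PN /eqP Pirr].
  rewrite /F -(flags_interleave_Kr PN Pirr).
  apply: (@kappa_part_run _ _ _ _ _ kapC (n.*2.+1)).
    by rewrite Kr_krew //; exact: (interleave_krew PN).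
  by have := sws; rewrite /= size_rcons /=; lia.
rewrite (sum_NC_flags _ (fun fl => if positive 0 fl then F fl else 0)).
rewrite moment_a_letters -/ws -(sweep_alt_expand _ _ (ract S b) (fun=> a)).
rewrite big_mkcond; apply: eq_bigr => fl _.
have sfl : size (expand fl) = size (a :: ws).
  rewrite -[size (a :: ws)]/((size ws).+1) sws; case: fl => -[//|q fl] /= /eqP[<-].
  by congr (_.+1); elim: fl (q.2) => //= q' fl IH e; rewrite IH.
have <- : F fl = run (ract S) kap (expand fl) (a :: ws) [::] false.
  by rewrite /F run_rcons_singleton // kap_singleton phib mulr1.
case: ifP => [_|/negbT nv]; first case: ifP => // /negbT np.
  rewrite /F run_invalid // ?size_rcons ?sfl //.
  by apply: contra np => /valid_expand /andP[].
rewrite /F run_invalid // ?size_rcons ?sfl //.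
by apply: contra nv => /valid_expand /andP[].
Qed.

End VSeries.

(** * Freeness makes mixed cumulants vanish *)

Section TopCumulant.
Variables (B : nzRingType) (X : Type) (act : X -> B -> X) (k1 k2 : seq X -> B).
Variable n : nat.
Hypothesis k12 : forall s, (0 < size s)%N -> (size s < n)%N -> k1 s = k2 s.
Notation sw1 := (sweep act k1 allow_full (final allow_full)).
Notation sw2 := (sweep act k2 allow_full (final allow_full)).

Definition stack_size (st : seq (block X)) := sumn [seq (size b.2).+1 | b <- st].

(** With fewer than [n] letters, or [n] letters and two open blocks, no block can collect [n]
    letters any more. *)
Lemma sweep_lower xs st p :
  (stack_size st + size xs < n)%N ||
  ((1 < size st)%N && (stack_size st + size xs <= n)%N) ->
  sw1 (map inr xs) st p = sw2 (map inr xs) st p.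
Proof.
elim: xs st p => [//|x xs IH] st p h.
have giveE c st' q : (stack_size st' + size xs < n)%N ->
    give act c (sw1 (map inr xs)) st' q = give act c (sw2 (map inr xs)) st' q.
  by case: st' => [|[y b] st'] /= h'; rewrite IH //= h'.
have settleE b st' :
    (stack_size st' + (size b.2).+1 + size xs < n)%N ||
    (0 < size st')%N && (stack_size st' + (size b.2).+1 + size xs <= n)%N ->
    settle act k1 b (sw1 (map inr xs)) st' = settle act k2 b (sw2 (map inr xs)) st'.
  move=> h'; have st'0 : (0 < size st')%N -> (0 < stack_size st')%N by case: (st').
  rewrite /settle IH; last by move: h'; rewrite /stack_size /=; lia.
  by rewrite giveE ?k12 ?size_rev //=; lia.
rewrite !map_cons !sweep_cons [LHS]/= [RHS]/= settleE; last first.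
  by move: h; rewrite /=; lia.
congr (_ + _); case: st h => [//|[y b] st] h /=.
by apply: settleE; move: h; rewrite /stack_size /=; lia.
Qed.

Lemma settle_top x b xs : ((size b).+1 + size xs)%N = n ->
  settle act k1 (x, b) (sw1 (map inr xs)) [::] - k1 (rev b ++ x :: xs) =
  settle act k2 (x, b) (sw2 (map inr xs)) [::] - k2 (rev b ++ x :: xs).
Proof.
elim: xs x b => [|x' xs IH] x b bn.
  by rewrite /settle /= !add0r !mulr1 rev_cons -cats1 !subrr.
have E k sw : settle act k (x, b) sw [::] = sw [:: (x, b)] false +
   k (rev (x :: b)) * sw [::] true by [].
rewrite !E (k12 (s := rev (x :: b))) ?size_rev //; last by move: bn => /=; lia.
rewrite (sweep_lower (st := [::])); last first.
  by rewrite /= /stack_size /=; move: bn => /=; lia.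
suff H : sw1 (map inr (x' :: xs)) [:: (x, b)] false - k1 (rev b ++ [:: x, x' & xs]) =
    sw2 (map inr (x' :: xs)) [:: (x, b)] false - k2 (rev b ++ [:: x, x' & xs]).
  by rewrite [LHS]addrAC H addrAC.
have swE k : sweep act k allow_full (final allow_full) (map inr (x' :: xs)) [:: (x, b)] false =
   settle act k (x', [::]) (sweep act k allow_full (final allow_full) (map inr xs)) [:: (x, b)] +
   settle act k (x', x :: b) (sweep act k allow_full (final allow_full) (map inr xs)) [::].
  by [].
have := IH x' (x :: b); rewrite rev_cons cat_rcons => IH'.
have aA (u v w : B) : u + v - w = u + (v - w) by rewrite addrA.
rewrite !swE [LHS]aA [RHS]aA IH'; last by move: bn => /=; lia.
have -> : settle act k1 (x', [::]) (sw1 (map inr xs)) [:: (x, b)] =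
          settle act k2 (x', [::]) (sw2 (map inr xs)) [:: (x, b)].
  rewrite /settle sweep_lower; last by rewrite /stack_size /=; move: bn => /=; lia.
  rewrite k12 //; last by move: bn => /=; lia.
  by rewrite /give sweep_lower // /stack_size /=; move: bn => /=; lia.
by [].
Qed.

(** The cumulant of all the letters occurs in their moment once, with
    coefficient one, and all the other terms involve fewer letters. *)
Lemma sweep_top s : size s = n -> (0 < n)%N ->
  sw1 (map inr s) [::] false - k1 s = sw2 (map inr s) [::] false - k2 s.
Proof.
case: s => [<-//|x s] sn _; rewrite map_cons !sweep_cons /= !addr0.
exact: (@settle_top x [::] s).
Qed.

End TopCumulant.

Section ItemWords.
Variables (C : numClosedFieldType) (B A : algType C) (S : opv_space B A).
Variable kap : seq A -> B.
Hypothesis kapC : is_free_cumulants S kap.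

(** The element of [A] which a word of scalars and letters stands for. *)
Fixpoint ev (w : seq (item B A)) : A :=
  match w with
  | [::] => 1
  | inl c :: w' => lact S c (ev w')
  | inr x :: w' => x * ev w'
  end.

Lemma ev_cat u w : ev (u ++ w) = ev u * ev w.
Proof.
elim: u => [|[c|x] u IH] /=; first by rewrite mul1r.
  by rewrite IH lact_mul.
by rewrite IH mulrA.
Qed.

Notation sw := (sweep (ract S) kap allow_full (final allow_full)).

Lemma absorb_scalars w : exists c xs,
  ev w = lact S c (\prod_(y <- xs) y) /\ sw w = give (ract S) c (sw (map inr xs)).
Proof.
have A3 y c d : ract S (ract S y c) d = ract S y (c * d) by rewrite ractA.
elim: w => [|[d|x] w [c [xs [e1 e2]]]].
- exists 1, [::]; rewrite big_nil lact1; split=> //.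
  by apply/funext => st; apply/funext => p; rewrite give1 // => x; apply: ract1.
- exists (d * c), xs; split; first by rewrite /= e1 lactA.
  rewrite sweep_cons e2; apply/funext => st; apply/funext => p /=.
  by rewrite give_give.
exists 1, (ract S x c :: xs); split.
  by rewrite /= e1 lact1 big_cons mul_ract_lact.
rewrite sweep_cons e2 (step_absorb _ A3 (kap_ract kapC)).
apply/funext => st; apply/funext => p; rewrite give1 // => y; exact: ract1.
Qed.

(** Each scalar is absorbed by the letter before it. *)
Lemma moment_word x w p : phi S (ev (inr x :: w)) = sw (inr x :: w) [::] p.
Proof.
have A3 y c d : ract S (ract S y c) d = ract S y (c * d) by rewrite ractA.
have [c [xs [e1 e2]]] := absorb_scalars w.
rewrite [ev _]/= e1 -mul_ract_lact.
have -> : ract S x c * \prod_(y <- xs) y = \prod_(y <- ract S x c :: xs) y.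
  by rewrite big_cons.
rewrite (moment_sweep kapC p) // [in RHS]sweep_cons e2.
by rewrite (step_absorb _ A3 (kap_ract kapC)).
Qed.

Lemma moment_word1 w p : phi S 1 = 1 -> phi S (ev w) = sw w [::] p.
Proof.
move=> phi1; have [c [[|x xs] [e1 e2]]] := absorb_scalars w.
  by rewrite e1 e2 big_nil phi_lact phi1 /=.
by rewrite e1 e2 phi_lact (moment_sweep kapC p).
Qed.
End ItemWords.

Section FreeRun.
Variables (C : numClosedFieldType) (B : algType C).
Notation letter := (letter B).
Variable kap : seq letter -> B.
Hypothesis kapD : forall u v z c d,
  kap (u ++ actl z (c + d) :: v) =
  kap (u ++ actl z c :: v) + kap (u ++ actl z d :: v).
Hypothesis kap_mixed : forall s, ~~ constant (map fst s) -> kap s = 0.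
Notation act := (@actl C B).
Notation sw := (sweep act kap allow_full (final allow_full)).
Implicit Types (F : state_fun B letter) (st : seq (block letter)).

Definition of_color (t : bool) (w : seq (item B letter)) :=
  all (fun i => if i is inr x then x.1 == t else true) w.

Definition top_is (t : bool) st := if st is (x, _) :: _ then x.1 == t else false.

(** The properties of [sweep final w] that the computation with centred runs
    uses. *)
Definition regular F := [/\ additive_fun act F, dead fst F & forall st p q, F st p = F st q].

Lemma sweep_regular F w : regular F -> regular (sweep act kap allow_full F w).
Proof.
move=> [FD Fd Fp]; elim: w => [//|i w [IHD IHd IHp]]; rewrite sweep_cons; split.
- by apply: step_additive => //; apply: actlA.
- by apply: (step_dead (act := act)) => //; apply: actlA.
case: i => [c|x] st p q //=.
by case: st => [|[y b] st] /=; rewrite (IHp _ p q).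
Qed.

Lemma final_regular : regular (final allow_full).
Proof. by split; [exact: final_additive | case | case]. Qed.

(** A run of letters of colour [t] read on a stack without [t] on top cannot join
    the blocks below. If the rest of the word has value zero whenever a block of
    colour [t] is on top, the run must close all its blocks, and hence acts as
    the scalar which is its value. The stack [st0] of blocks opened inside the run
    is there for the induction. *)
Lemma free_run t F u st0 st p q r : regular F ->
  (forall st p, top_is t st -> F st p = 0) ->
  of_color t u -> ~~ top_is t st -> all (fun b => b.1.1 == t) st0 ->
  sweep act kap allow_full F u (st0 ++ st) p = give act (sw u st0 q) F st r.
Proof.
move=> Freg Ft; have [FD Fd Fp] := Freg.
elim: u st0 st p q r => [|i u IH] st0 st p q r.
  move=> _ tst; case: st0 => [|[x b] st0] /=.
    move=> _; rewrite -[true%:R]/(1 : B) give1; last exact: actl1.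
    exact: Fp.
  by case/andP=> xt _; rewrite give0 // Ft.
have [GD Gd Gp] := sweep_regular u Freg.
have giveE c s0 p' q' r' : of_color t u -> ~~ top_is t st -> all (fun b => b.1.1 == t) s0 ->
   give act c (sweep act kap allow_full F u) (s0 ++ st) p' =
   give act (give act c (sw u) s0 q') F st r'.
  move=> ut tst; case: s0 => [|[x b] s0] s0t; last exact: (IH ((act x c, b) :: s0)).
  case: st tst => [|[y b] st] tst; first by rewrite /= (IH [::] [::] p' q' r') //= mulrA.
  rewrite [LHS]/= (IH [::] ((act y c, b) :: st) p' q' r') //.
  by rewrite /= actlA.
have settleE b s0 r' : of_color t u -> ~~ top_is t st -> b.1.1 == t ->
   all (fun b => b.1.1 == t) s0 ->
   settle act kap b (sweep act kap allow_full F u) (s0 ++ st) =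
   give act (settle act kap b (sw u) s0) F st r'.
  move=> ut tst bt s0t; rewrite /settle giveDl //; congr (_ + _); last exact: giveE.
  by rewrite -cat_cons; apply: IH => //=; rewrite bt.
rewrite !sweep_cons; case: i => [c|x] /= iu tst s0t; first exact: giveE.
case/andP: iu => xt ut; rewrite giveDl //; congr (_ + _); first exact: settleE.
case: st0 s0t => [|[y b] st0] /= => [_|/andP[yt s0t]]; last exact: settleE.
rewrite give0 //; case: st tst {giveE settleE} => [//|[y b] st] /= tst.
apply: (settle_dead (col := fst)) => //; rewrite /= /mixed /=.
by rewrite (eqP xt) (negPf tst).
Qed.

End FreeRun.

Section Freeness.
Variables (C : numClosedFieldType) (B A : algType C) (S : opv_space B A).
Variable kap : seq A -> B.
Hypothesis kapC : is_free_cumulants S kap.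
Variables a b : A.
Hypothesis phi1 : phi S 1 = 1.
Hypothesis free_ab : free_with_amalgamation S a b.

Notation letter := (letter B).
Notation act := (@actl C B).
Notation eval := (eval_letter S a b).
Notation k2 := (letter_kap S kap a b).

(** The cumulants that are expected of free variables. *)
Definition kap_mono (s : seq letter) := if constant (map fst s) then k2 s else 0.

Lemma letter_kapD u v z c d :
  k2 (u ++ act z (c + d) :: v) = k2 (u ++ act z c :: v) + k2 (u ++ act z d :: v).
Proof. by rewrite /letter_kap !map_cat !map_cons !eval_act (kapD kapC). Qed.

Lemma kap_monoD u v z c d :
  kap_mono (u ++ act z (c + d) :: v) =
  kap_mono (u ++ act z c :: v) + kap_mono (u ++ act z d :: v).
Proof.
rewrite /kap_mono !map_cat !map_cons /=.
by case: ifP => _; rewrite ?addr0 // letter_kapD.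
Qed.

Lemma kap_mono_mixed s : ~~ constant (map fst s) -> kap_mono s = 0.
Proof. by rewrite /kap_mono => /negPf->. Qed.

Notation sw2 := (sweep act k2 allow_full (final allow_full)).
Notation sw := (sweep act kap_mono allow_full (final allow_full)).

Definition word_value (w : seq (item B letter)) : A := ev S (map (map_item eval) w).

Lemma word_value_cat u w : word_value (u ++ w) = word_value u * word_value w.
Proof. by rewrite /word_value map_cat ev_cat. Qed.

Lemma moment_word_value w p : phi S (word_value w) = sw2 w [::] p.
Proof. by rewrite (moment_word1 kapC _ p) // sweep_letter_kap. Qed.

Lemma sweep_mono t w st p : of_color t w ->
  all (fun b => all (fun x => x.1 == t) (b.1 :: b.2)) st ->
  sw w st p = sw2 w st p.
Proof.
have monoE s : all (fun x : letter => x.1 == t) s -> kap_mono s = k2 s.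
  move=> h; rewrite /kap_mono (@all_pred1_constant _ t) // all_map.
  by apply: sub_all h => x.
elim: w st p => [//|i w IH] st p iw st_t.
have wt : of_color t w by case: i iw => [//|x] /= /andP[].
have giveE c s q : all (fun b => all (fun x => x.1 == t) (b.1 :: b.2)) s ->
    give act c (sw w) s q = give act c (sw2 w) s q.
  by case: s => [|[y e] s] /= h; rewrite IH.
have settleE e s : all (fun b => all (fun x => x.1 == t) (b.1 :: b.2)) (e :: s) ->
    settle act kap_mono e (sw w) s = settle act k2 e (sw2 w) s.
  move=> h; rewrite /settle IH // monoE ?all_rev; last by case/andP: h.
  by rewrite giveE //; case/andP: h.
rewrite !sweep_cons; case: i iw => [c|x] /= => [_|/andP[xt _]]; first exact: giveE.
rewrite settleE /= ?xt //; congr (_ + _).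
by case: st st_t {giveE IH} => [//|[y e] s] /= h; rewrite settleE //= xt.
Qed.

(** What the machine does on [word_value u - phi (word_value u)]. *)
Definition centre u F : state_fun B letter := fun st p =>
  sweep act kap_mono allow_full F u st p - give act (phi S (word_value u)) F st p.

Definition centred u : A := word_value u - lact S (phi S (word_value u)) 1.

Fixpoint centre_all us : state_fun B letter :=
  if us is u :: us' then centre u (centre_all us') else final allow_full.

Lemma centre_regular u F : regular F -> regular (centre u F).
Proof.
move=> Freg; have [GD Gd Gp] := sweep_regular kap_monoD kap_mono_mixed u Freg.
have [FD Fd Fp] := Freg; split.
- move=> st st1 st2 p h; rewrite /centre (GD _ _ _ _ h).
  by rewrite (give_additive (@actlA C B) _ FD _ h) opprD addrACA.
- by move=> st p h; rewrite /centre Gd // (give_dead (act := act) (col := fst)) ?subr0.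
- move=> st p q; rewrite /centre (Gp _ p q); congr (_ - _).
  by case: st => [|[y e] st] /=; rewrite (Fp _ p q).
Qed.

Lemma centre_all_regular us : regular (centre_all us).
Proof. by elim: us => [|u us]; [exact: final_regular | exact: centre_regular]. Qed.

(** Induction from the last run. The remaining runs vanish on a stack with [t] on
    top, because the next run has the other colour; so [free_run] applies to the
    first one, and says that it acts as its expectation, which is subtracted. *)
Lemma centre_all_vanish t u us st p :
  path (fun r s => r.1 != s.1) (t, u) us ->
  all (fun r => of_color r.1 r.2) ((t, u) :: us) -> ~~ top_is t st ->
  centre_all (map snd ((t, u) :: us)) st p = 0.
Proof.
elim: us t u st p => [|[t' u'] us IH] t u st p alt /= /andP[ut ust] tst.
  rewrite /centre (@free_run _ _ _ kap_monoD kap_mono_mixed t _ _ [::] _ _ true p) //.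
  - by rewrite (sweep_mono true ut) // -moment_word_value subrr.
  - exact: final_regular.
  - by case.
move: alt => /= /andP[tt' alt].
rewrite /centre (@free_run _ _ _ kap_monoD kap_mono_mixed t _ _ [::] _ _ true p) //.
- by rewrite (sweep_mono true ut) // -moment_word_value subrr.
- exact: (centre_all_regular (map snd ((t', u') :: us))).
- move=> st' q tst'; apply: (IH t' u' st' q) => //.
  by case: st' tst' => [//|[x e] st'] /= /eqP->.
Qed.

Lemma alg_gen_word t u : of_color t u ->
  alg_gen S (if t then a else b) (word_value u).
Proof.
elim: u => [|[c|x] u IH] /=.
- by move=> _; rewrite /word_value /= -(lact1 S 1); apply: AlgGenCst.
- move=> /IH h; rewrite /word_value /= -[ev _ _]mul1r lact_mul.
  by apply: AlgGenMul h; apply: AlgGenCst.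
move=> /andP[/eqP xt /IH h]; rewrite /word_value /=; apply: AlgGenMul h.
rewrite /eval_letter xt -[ract S _ _]mulr1 mul_ract_lact.
by apply: AlgGenMul; [apply: AlgGenVar | apply: AlgGenCst].
Qed.

Lemma centred_moment us : us != [::] -> sorted (fun r s => r.1 != s.1) us ->
  all (fun r => of_color r.1 r.2) us ->
  phi S (\prod_(r <- us) centred r.2) = 0.
Proof.
move=> us0 alt col; have := free_ab (s := [seq (r.1, centred r.2) | r <- us]).
rewrite big_map; apply.
- by case: us us0 {alt col}.
- by case: us us0 alt {col} => //= r us _; rewrite path_map.
move=> p /mapP[r rus ->] /=; split; last first.
  by rewrite /centred linearB /= phi_lact phi1 mulr1 subrr.
apply: AlgGenAdd; first by apply: alg_gen_word; move/allP: col; apply.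
rewrite -scaleN1r -lactZl; exact: AlgGenCst.
Qed.

Definition letters (w : seq (item B letter)) := count (fun i => if i is inr _ then true else false) w.

Lemma letters_cat u w : letters (u ++ w) = (letters u + letters w)%N.
Proof. exact: count_cat. Qed.

Lemma sweepB F G w st p :
  sweep act kap_mono allow_full (fun st p => F st p - G st p) w st p =
  sweep act kap_mono allow_full F w st p - sweep act kap_mono allow_full G w st p.
Proof.
elim: w st p => [//|i w IH] st p; rewrite !sweep_cons.
have giveE c s q : give act c (sweep act kap_mono allow_full (fun st p => F st p - G st p) w) s q =
    give act c (sweep act kap_mono allow_full F w) s q - give act c (sweep act kap_mono allow_full G w) s q.
  by case: s => [|[y e] s] /=; rewrite IH ?mulrBr.
have settleE e s : settle act kap_mono e (sweep act kap_mono allow_full (fun st p => F st p - G st p) w) s =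
    settle act kap_mono e (sweep act kap_mono allow_full F w) s - settle act kap_mono e (sweep act kap_mono allow_full G w) s.
  by rewrite /settle IH giveE opprD addrACA.
case: i => [c|x] /=; first exact: giveE.
have joinE : join act kap_mono x (sweep act kap_mono allow_full (fun st p => F st p - G st p) w) st =
    join act kap_mono x (sweep act kap_mono allow_full F w) st -
    join act kap_mono x (sweep act kap_mono allow_full G w) st.
  by case: st => [|[y e] st]; [rewrite /= subr0 | exact: settleE].
have subD (x1 x2 y1 y2 : B) : x1 - x2 + (y1 - y2) = x1 + y1 - (x2 + y2).
  by rewrite opprD addrACA.
by rewrite settleE joinE subD.
Qed.

(** Each centring replaces a run by a scalar, which removes letters; on words with
    fewer letters [phi] and the machine agree by induction. *)
Lemma expand_centred n us w p :
  (forall w, (letters w < n)%N -> phi S (word_value w) = sw w [::] true) ->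
  (letters (w ++ flatten us) <= n)%N -> all (fun u => 0 < letters u)%N us ->
  phi S (word_value w * \prod_(u <- us) centred u) -
    sweep act kap_mono allow_full (centre_all us) w [::] p =
  phi S (word_value (w ++ flatten us)) - sw (w ++ flatten us) [::] true.
Proof.
move=> small; elim: us w p => [|u us IH] w p.
  by rewrite big_nil mulr1 cats0 (sweep_full_prev _ _ _ _ p true).
rewrite [flatten _]/= catA letters_cat => le_n /andP[u0 us0].
set d := phi S (word_value u).
have ld : letters [:: inl d] = 0%N by [].
rewrite [centre_all _]/= sweepB.
rewrite -(sweep_cat _ _ _ _ w u).
have -> : sweep act kap_mono allow_full (give act d (centre_all us)) w =
   sweep act kap_mono allow_full (centre_all us) (w ++ [:: inl d]).
  by rewrite sweep_cat.
have -> : word_value w * \prod_(u <- u :: us) centred u =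
   word_value (w ++ u) * \prod_(u <- us) centred u -
   word_value (w ++ [:: inl d]) * \prod_(u <- us) centred u.
  rewrite big_cons mulrA -mulrBl; congr (_ * _).
  by rewrite !word_value_cat /centred mulrBr /word_value /=.
rewrite linearB /= opprD addrACA -opprD IH ?letters_cat //.
rewrite IH //; last by move: le_n u0; rewrite !letters_cat ?ld; lia.
rewrite (small ((w ++ [:: inl d]) ++ flatten us)) ?subrr ?subr0 //.
by move: le_n u0; rewrite !letters_cat ?ld; lia.
by move: le_n; rewrite letters_cat.
Qed.

Lemma letters0_color t w : letters w = 0%N -> of_color t w.
Proof. by elim: w => [//|[c|x] w IH] //=. Qed.

(** The decomposition into maximal runs; leading scalars go to the next run. *)
Lemma runs_exist w : (0 < letters w)%N -> exists us : seq (bool * seq (item B letter)),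
  [/\ us != [::], flatten (map snd us) = w, sorted (fun r s => r.1 != s.1) us,
      all (fun u => 0 < letters u)%N (map snd us) & all (fun r => of_color r.1 r.2) us].
Proof.
elim: w => [//|i w IH] iw.
have [w0|/IH[us [us0 e alt pos col]]] := posnP (letters w).
  case: i iw => [c|x] iw; first by move: iw; rewrite -[letters _]/(letters w) w0.
  exists [:: (x.1, inr x :: w)]; split=> //=; first by rewrite cats0.
  by rewrite eqxx !andbT; apply: letters0_color.
case: us us0 e alt pos col => [//|[t u] us] _ e /= alt /andP[u0 pos] /andP[ut col].
case: i {iw} => [c|x].
  exists ((t, inl c :: u) :: us).
  by split; [| rewrite -e | case: (us) alt | apply/andP | apply/andP].
have [xt|xt] := eqVneq x.1 t.
  exists ((t, inr x :: u) :: us); split; [by []|by rewrite -e|by case: (us) alt| |].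
    by apply/andP.
  by apply/andP; split=> //; apply/andP; split=> //; apply/eqP.
exists [:: (x.1, [:: inr x]), (t, u) & us]; split; [by []|by rewrite -e| | |].
- by apply/andP.
- by apply/andP; split=> //; apply/andP.
- by rewrite /= eqxx /=; apply/andP.
Qed.

(** By freeness a product of centred runs has moment zero, and by
    [centre_all_vanish] it has value zero for [kap_mono]. *)
Lemma moment_mono w : phi S (word_value w) = sw w [::] true.
Proof.
have [n wn] := ubnP (letters w); elim: n w wn => // n IH w wn.
have [w0|w0] := posnP (letters w).
  elim: w w0 {wn} => [_|[c|x] w IHw w0]; last by [].
    exact: phi1.
  rewrite -[word_value _]/(lact S c (word_value w)) phi_lact IHw //.
have [us [us0 e alt pos col]] := runs_exist w0.
have small v : (letters v < n)%N -> phi S (word_value v) = sw v [::] true by apply: IH.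
have := @expand_centred n (map snd us) [::] true small.
rewrite cat0s e => /(_ wn pos) H; apply/eqP; rewrite -subr_eq0 -H.
rewrite mul1r big_map centred_moment //.
case: us us0 alt col {e pos H} => [//|[t u] us] _ alt col.
by rewrite -[sweep _ _ _ _ _ _ _]/(centre_all (map snd ((t, u) :: us)) [::] true) (@centre_all_vanish t u us) // subrr.
Qed.

Lemma free_mixed_vanish s : ~~ constant (map fst s) -> k2 s = 0.
Proof.
suff -> : k2 s = kap_mono s by apply: kap_mono_mixed.
have [n sn] := ubnP (size s); elim: n s sn => // n IH s sn.
case: s sn => [|x s] sn; first by [].
have k12 s' : (0 < size s')%N -> (size s' < (size s).+1)%N -> k2 s' = kap_mono s'.
  by move=> _ h; apply: IH; apply: leq_trans h _; rewrite -ltnS.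
have := @sweep_top _ _ act _ _ _ k12 (x :: s) erefl isT.
have -> : sw2 (map inr (x :: s)) [::] false = sw (map inr (x :: s)) [::] false.
  by rewrite -moment_word_value moment_mono (sweep_full_prev _ _ _ _ _ false).
by move/addrI/oppr_inj.
Qed.

End Freeness.

(** * The cumulant series of a product *)

Section Main.
Variables (C : numClosedFieldType) (B A : algType C) (S : opv_space B A).
Variables (kap : seq A -> B) (a b : A).
Hypothesis kapC : is_free_cumulants S kap.

Lemma mixed_vanish : free_over S kap a b ->
  forall s : seq (letter B), ~~ constant (map fst s) -> letter_kap S kap a b s = 0.
Proof.
case=> [[phi1 fr] s|van s nc]; first exact: free_mixed_vanish.
rewrite /letter_kap (_ : map _ s = [seq ract S (lact S p.1.2 (if p.1.1 then a else b)) p.2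
    | p <- [seq (x.1, 1, x.2) | x <- s]]); last first.
  by rewrite -map_comp; apply: eq_map => x; rewrite /= lact1.
by apply: van; rewrite -map_comp.
Qed.

Lemma cumulant_series_additive x : additive_series (cumulant_series S kap x).
Proof.
move=> u c d v; rewrite -[c in LHS]scale1r.
by rewrite (cumulant_series_multilinear S x (cumulants_multilinear kapC)) scale1r.
Qed.

Hypotheses (phia : phi S a = 1) (phib : phi S b = 1).

Lemma cumulant_seriesE x : phi S x = 1 ->
  (fun t => kap (rcons [seq ract S x c | c <- t] x)) = cumulant_series S kap x.
Proof.
by move=> phix; apply/funext => -[|c t] //=; rewrite (kap_singleton kapC).
Qed.

Lemma letter_series_la : letter_series (letter_kap S kap a b) (la B) = cumulant_series S kap a.
Proof.
rewrite -cumulant_seriesE //; apply/funext => t.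
rewrite /letter_series /letter_kap map_rcons -map_comp eval_la; congr (kap (rcons _ _)).
by apply: eq_map => c; rewrite /= eval_act eval_la.
Qed.

Lemma letter_series_lb : letter_series (letter_kap S kap a b) (lb B) = cumulant_series S kap b.
Proof.
rewrite -cumulant_seriesE //; apply/funext => t.
rewrite /letter_series /letter_kap map_rcons -map_comp eval_lb; congr (kap (rcons _ _)).
by apply: eq_map => c; rewrite /= eval_act eval_lb.
Qed.

(** The powers of [a * b] are read either letter by letter, or with [a * b] as a
    single letter. *)
Lemma moment_power_ab :
  moment_power (ract S) kap (a * b) = moment_ab (letter_kap S kap a b) allow_full.
Proof.
apply/funext => s; rewrite /moment_power /moment_ab sweep_letter_kap.
rewrite /power_word -(moment_word kapC) map_cons.
rewrite -[map_item _ _]/(inr (eval_letter S a b (la B))) eval_la -(moment_word kapC).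
congr (phi S _).
elim: s => /= [|c s IH]; first by rewrite eval_lb !mulr1.
by rewrite IH eval_la -mulrA !eval_lb.
Qed.

End Main.

Theorem proposition3p1 (R : realType) (B A : algType R[i])
    (S : opv_space B A) (kappa : seq A -> B) (a b : A) :
  is_free_cumulants S kappa ->
  free_over S kappa a b ->
  phi S a = 1 -> phi S b = 1 ->
  let Ka := cumulant_series S kappa a in
  let Kb := cumulant_series S kappa b in
  let Kab := cumulant_series S kappa (a * b) in
  let V := V_series S kappa a b in
  let W := series_comp Kb (series_cat (@series_I _ B) V) in
  V =1 series_comp Ka (series_cat W (@series_I _ B)) /\
  Kab =1 series_cat V W.
Proof.
move=> kapC free phia phib Ka Kb Kab V W.
have mixed := mixed_vanish kapC free.
have k2D := letter_kapD kapC a b.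
have eKa : letter_series (letter_kap S kappa a b) (la B) = Ka by apply: letter_series_la.
have eKb : letter_series (letter_kap S kappa a b) (lb B) = Kb by apply: letter_series_lb.
have eV : moment_a (letter_kap S kappa a b) allow_alt = V by rewrite /V -V_series_moment.
have eW : moment_b (letter_kap S kappa a b) allow_alt = W.
  by rewrite moment_b_alt // eKb eV.
have VW : V = series_comp Ka (series_cat W (@series_I _ B)).
  by rewrite -eV moment_a_alt // eKa eW.
split; first by rewrite {1}VW.
have P := moment_ab_full k2D mixed; have Q := moment_b_full k2D mixed.
have N := moment_a_full k2D mixed.
rewrite eKa eKb in P Q N.
have K := moment_power_full (fun x c d => esym (ractA S x c d)) (ract1 S) (kapD kapC) (a * b).
rewrite moment_power_ab // in K.
have phiab : phi S (a * b) = 1.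
  have := congr1 (fun f => f [::]) P; rewrite -moment_power_ab // {1}/moment_power.
  rewrite -(moment_word kapC) /= mulr1 series_cat_nil series_comp_nil => ->.
  by rewrite Q series_cat_nil series_comp_nil /series_add series_cat_I_nil addr0 !mulr1.
rewrite cumulant_seriesE // in K.
have -> // : Kab = series_cat V W.
apply: (free_product_series _ _ VW erefl P Q N K); exact: cumulant_series_additive.
Qed.
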